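(* Let $\Omega\subset\mathbb{R}^3$ be a bounded Lipschitz domain and let $\Sigma\subset\partial\Omega$ be the closure of a nonempty (relatively) open subset of $\partial\Omega$. Let $\mathbb{C}$ be an elasticity tensor on $\Omega$ that has the full symmetries, is bounded ($\mathbb{C}\in L^\infty(\Omega)$) and is uniformly strongly convex. Let $S$ be a dislocation surface in $\Omega$, i.e. an open, bounded, oriented Lipschitz surface with Lipschitz boundary, with $\overline{S}\subset\Omega$, which extends to a closed orientable Lipschitz surface $\Gamma$ as described in the context. Let $\bm{g}\in H^{1/2}_{00}(S)$ (with values in $\mathbb{R}^3$). Then the problem $$\begin{cases}\mathrm{div}(\mathbb{C}\widehat{\nabla}\bm{u})=\bm{0} & \text{in }\Omega\setminus\overline{S},\\ (\mathbb{C}\widehat{\nabla}\bm{u})\bm{\nu}=\bm{0} & \text{on }\partial\Omega\setminus\Sigma,\\ \bm{u}=\bm{0} & \text{on }\Sigma,\\ [\bm{u}]_S=\bm{g},\\ [(\mathbb{C}\widehat{\nabla}\bm{u})\bm{n}]_S=\bm{0}\end{cases}$$ has at most one weak solution $\bm{u}\in H^1_\Sigma(\Omega\setminus\overline{S})$.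
   Context: Notation. For a matrix $\mathbf{A}$, $\widehat{\mathbf{A}}=\frac12(\mathbf{A}+\mathbf{A}^T)$, $\mathbf{A}:\mathbf{B}=\sum_{i,j}a_{ij}b_{ij}$, $|\mathbf{A}|=\sqrt{\mathbf{A}:\mathbf{A}}$; $\widehat{\nabla}\bm{u}$ is the symmetric part of $\nabla\bm{u}$. $\bm{\nu}$ is the unit outer normal to $\partial\Omega$. Function spaces are used for $\mathbb{R}^3$-valued fields without change of notation. Elasticity tensor. $\mathbb{C}=\mathbb{C}(\bm{x})$ is a fourth-order tensor field with $\mathbb{C}_{ijkh}(\bm{x})=\mathbb{C}_{jikh}(\bm{x})=\mathbb{C}_{khij}(\bm{x})$ for all $1\le i,j,k,h\le 3$ and $\bm{x}\in\Omega$. It satisfies $\mathbb{C}\in L^\infty(\Omega)$ and there is $c>0$ such that $\mathbb{C}(\bm{x})\widehat{\mathbf{A}}:\widehat{\mathbf{A}}\ge c|\widehat{\mathbf{A}}|^2$ for a.e. $\bm{x}\in\Omega$ and all matrices $\mathbf{A}$ (uniform strong convexity). Dislocation surface. $S$ is an open, bounded, oriented Lipschitz surface (locally the graph of a Lipschitz function), with Lipschitz boundary and $\overline{S}\subset\Omega$. It can be extended to a closed orientable Lipschitz surface $\Gamma\subset\Omega$ with $\Gamma\cap\partial\Omega=\emptyset$. $\Omega^-$ denotes the domain enclosed by $\Gamma$ and $\Omega^+=\Omega\setminus\overline{\Omega^-}$; both are bounded domains contained in $\Omega$. The orientation of $S$ is chosen so that its unit normal $\bm{n}$ is the unit outer normal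 to $\Omega^-$. Jumps. For a field $\bm{f}$, $[\bm{f}]_S=\bm{f}^+_S-\bm{f}^-_S$, where $\bm{f}^\pm_S$ are the traces on $S$ from $\Omega^\pm$ ($\bm{n}$ points into the $+$ side). Spaces. $H^{1/2}_{00}(S)$ is the space of $u\in H^{1/2}(S)$ with $\delta^{-1/2}u\in L^2(S)$, where $\delta$ is the distance to $\partial S$ on $S$, with norm $\|u\|_{H^{1/2}(S)}+\|\delta^{-1/2}u\|_{L^2(S)}$; its elements extend by zero to elements of $H^{1/2}(\Gamma)$. For an open set $D$ with $\Sigma\subset\partial D$, $H^1_\Sigma(D)=\{\bm{\eta}\in H^1(D):\bm{\eta}|_\Sigma=\bm{0}\}$ in the sense of traces. Weak solution. A weak solution is a field for which the equation holds in $(H^1_\Sigma(\Omega))'$, the traction condition on $\partial\Omega\setminus\Sigma$ in $H^{-1/2}(\partial\Omega\setminus\Sigma)$, $\bm{u}=\bm{0}$ in $H^{1/2}(\Sigma)$, $[\bm{u}]_S=\bm{g}$ in $H^{1/2}_{00}(S)$ and $[(\mathbb{C}\widehat{\nabla}\bm{u})\bm{n}]_S=\bm{0}$ in $H^{-1/2}(S)$. In variational form: $\bm{u}\in H^1_\Sigma(\Omega\setminus\overline{S})$, $[\bm{u}]_S=\bm{g}$ in the sense of traces, and $\int_{\Omega\setminus\overline{S}}\mathbb{C}\widehat{\nabla}\bm{u}:\widehat{\nabla}\bm{v}\,d\bm{x}=0$ for every $\bm{v}\in H^1_\Sigma(\Omega)$. *)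

(* Defs.v *)
From HB Require Import structures.
From mathcomp Require Import all_boot all_order all_algebra.
From mathcomp Require Import all_classical all_reals all_analysis.

Set Implicit Arguments.
Unset Strict Implicit.
Unset Printing Implicit Defensive.
Import Order.TTheory GRing.Theory Num.Theory.
Import numFieldNormedType.Exports.

Local Open Scope classical_set_scope.
Local Open Scope ring_scope.

(* Points of R^3 are triples, so that Lebesgue measure is the iterated product
   measure of the library.  The library norm on a product is the sup norm: it
   gives the usual topology and the usual bounded sets, but Euclidean lengths
   have to be defined. *)
Notation pt2 R := (R * R)%type.
Notation pt3 R := (R * R * R)%type.

Definition leb2 (R : realType) :=
  ((@lebesgue_measure R) \x (@lebesgue_measure R))%E.
Definition leb3 (R : realType) :=
  ((@leb2 R) \x (@lebesgue_measure R))%E.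

Definition coord (R : realType) (i : 'I_3) (x : pt3 R) : R :=
  match val i with 0%N => x.1.1 | 1%N => x.1.2 | _ => x.2 end.

Definition basis (R : realType) (i : 'I_3) : pt3 R :=
  ((val i == 0%N)%:R, (val i == 1%N)%:R, (val i == 2%N)%:R).

Definition dot (R : realType) (x y : pt3 R) : R :=
  \sum_(i < 3) coord i x * coord i y.

Definition enorm (R : realType) (x : pt3 R) : R := Num.sqrt (dot x x).

Definition comp (R : realType) (i : 'I_3) (u : pt3 R -> pt3 R) : pt3 R -> R :=
  fun x => coord i (u x).

Definition frontier (T : topologicalType) (D : set T) : set T :=
  closure D `\` interior D.

(* Elements of function spaces are represented by functions on the whole space,
   whose values outside of the set of interest are irrelevant. *)
Definition L2 (d : measure_display) (T : measurableType d) (R : realType)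
    (mu : {measure set T -> \bar R}) (D : set T) (f : T -> R) : Prop :=
  f \_ D \in Lfun mu 2%:E.

Definition L2norm (d : measure_display) (T : measurableType d) (R : realType)
    (mu : {measure set T -> \bar R}) (D : set T) (f : T -> R) : \bar R :=
  ('N[mu]_2%:E[EFin \o (f \_ D)])%E.

Definition Linfty (d : measure_display) (T : measurableType d) (R : realType)
    (mu : {measure set T -> \bar R}) (D : set T) (f : T -> R) : Prop :=
  f \_ D \in Lfun mu +oo%E.

Fixpoint iter_partial (R : realType) (s : seq 'I_3) (phi : pt3 R -> R) :
    pt3 R -> R :=
  if s is i :: s' then 'D_(basis R i) (iter_partial s' phi) else phi.

Definition smooth (R : realType) (phi : pt3 R -> R) : Prop :=
  forall s : seq 'I_3, continuous (iter_partial s phi) /\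
    forall (i : 'I_3) (x : pt3 R), derivable (iter_partial s phi) x (basis R i).

Definition test_function (R : realType) (D : set (pt3 R)) (phi : pt3 R -> R) :
    Prop :=
  smooth phi /\
  exists K : set (pt3 R), [/\ compact K, K `<=` D & forall x, ~ K x -> phi x = 0].

Definition is_weak_partial (R : realType) (D : set (pt3 R)) (i : 'I_3)
    (f w : pt3 R -> R) : Prop :=
  forall phi, test_function D phi ->
    \int[@leb3 R]_(x in D) (f x * 'D_(basis R i) phi x) =
    - \int[@leb3 R]_(x in D) (w x * phi x).

Definition H1 (R : realType) (D : set (pt3 R)) (f : pt3 R -> R) : Prop :=
  L2 (@leb3 R) D f /\
  forall i : 'I_3, exists w, L2 (@leb3 R) D w /\ is_weak_partial D i f w.

(* A representative of the weak derivative, unique a.e. in D when f is in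
   H^1(D). *)
Definition weak_partial (R : realType) (D : set (pt3 R)) (i : 'I_3)
    (f : pt3 R -> R) : pt3 R -> R :=
  get [set w | L2 (@leb3 R) D w /\ is_weak_partial D i f w].

(* Convergence in H^1(D `&` U) to a function f of H^1(D). *)
Definition H1_cvg (R : realType) (D U : set (pt3 R))
    (phi : nat -> pt3 R -> R) (f : pt3 R -> R) : Prop :=
  ((fun n => L2norm (@leb3 R) (D `&` U) (phi n \- f)) @ \oo --> 0%E) /\
  forall i : 'I_3,
    (fun n => L2norm (@leb3 R) (D `&` U)
       ('D_(basis R i) (phi n) \- weak_partial D i f)) @ \oo --> 0%E.

(* A chart consists of an origin o, a frame (e0, e1, e2), the half-sizes r and h
   of a box in the corresponding coordinates, and a function psi of two
   variables whose graph meets that box. *)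
Record chart (R : realType) := Chart {
  chart_o : pt3 R;
  chart_e : 'I_3 -> pt3 R;
  chart_r : R;
  chart_h : R;
  chart_psi : pt2 R -> R }.

Definition chart_map (R : realType) (c : chart R) (y : pt3 R) : pt3 R :=
  chart_o c + \sum_(i < 3) coord i y *: chart_e c i.

Definition chart_base (R : realType) (c : chart R) : set (pt2 R) :=
  [set y | `|y.1| < chart_r c /\ `|y.2| < chart_r c].

Definition chart_box (R : realType) (c : chart R) : set (pt3 R) :=
  chart_map c @` [set y | chart_base c y.1 /\ `|y.2| < chart_h c].

Definition chart_graph (R : realType) (c : chart R) (y : pt2 R) : pt3 R :=
  chart_map c (y, chart_psi c y).

(* c is a Lipschitz chart of the boundary of D at x: in the box, D is exactly
   the part lying strictly above the graph, so its boundary is the graph. *)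
Record boundary_chart (R : realType) (D : set (pt3 R)) (x : pt3 R)
    (c : chart R) : Prop := BoundaryChart {
  bc_origin : chart_o c = x;
  bc_frame : forall i j, dot (chart_e c i) (chart_e c j) = (i == j)%:R;
  bc_size : 0 < chart_r c /\ 0 < chart_h c;
  bc_lipschitz : exists k : R, k.-lipschitz (chart_psi c);
  bc_center : chart_psi c 0 = 0;
  bc_inside : forall y, chart_base c y -> `|chart_psi c y| < chart_h c;
  bc_above : forall y : pt3 R, chart_base c y.1 -> `|y.2| < chart_h c ->
    (D (chart_map c y) <-> chart_psi c y.1 < y.2) }.

Definition domain (R : realType) (D : set (pt3 R)) : Prop :=
  [/\ D !=set0, open D & connected D].

Definition lipschitz_domain (R : realType) (D : set (pt3 R)) : Prop :=
  [/\ domain D, bounded_set D &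
      forall x, frontier D x -> exists c, boundary_chart D x c].

(* Functions on a Lipschitz surface are measured in charts, by the Lebesgue
   measure of the base: since psi is Lipschitz, the surface measure has a density
   between two positive constants with respect to it, hence the same null sets
   and an equivalent L^2 norm. *)

Definition chart_part (R : realType) (c : chart R) (A : set (pt3 R)) :
    set (pt2 R) :=
  chart_base c `&` (chart_graph c @^-1` A).

(* P holds almost everywhere on A, for A a subset of the boundary of D. *)
Definition surface_ae (R : realType) (D A : set (pt3 R)) (P : pt3 R -> Prop) :
    Prop :=
  forall x, A x -> exists2 c, boundary_chart D x c &
    {ae (@leb2 R), forall y, chart_part c A y -> P (chart_graph c y)}.

(* tau is the trace on A, a subset of the boundary of D near which D is
   Lipschitz, of f in H^1(D): in a neighbourhood of each point of A, f is the
   H^1 limit of restrictions of smooth functions whose restrictions to A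
   converge to tau in L^2.  The definition is local because it is also used
   with slit domains, which are not Lipschitz away from A. *)
Definition is_trace (R : realType) (D A : set (pt3 R))
    (f tau : pt3 R -> R) : Prop :=
  forall x, A x -> exists2 c, boundary_chart D x c &
    L2 (@leb2 R) (chart_part c A) (tau \o chart_graph c) /\
    exists phi : nat -> pt3 R -> R,
      [/\ forall n, smooth (phi n),
          H1_cvg D (chart_box c) phi f &
          (fun n => L2norm (@leb2 R) (chart_part c A)
             ((phi n \- tau) \o chart_graph c)) @ \oo --> 0%E].

Definition H1_vec (R : realType) (D : set (pt3 R)) (u : pt3 R -> pt3 R) : Prop :=
  forall i : 'I_3, H1 D (comp i u).

Definition H1_zero_on (R : realType) (Sigma D : set (pt3 R))
    (u : pt3 R -> pt3 R) : Prop :=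
  H1_vec D u /\ forall i : 'I_3, is_trace D Sigma (comp i u) (fun=> 0).

(* The jump across S of u is g: trace from Dp minus trace from Dm. *)
Definition jump_eq (R : realType) (Dp Dm S : set (pt3 R))
    (u g : pt3 R -> pt3 R) : Prop :=
  forall i : 'I_3, exists taup taum : pt3 R -> R,
    [/\ is_trace Dp S (comp i u) taup,
        is_trace Dm S (comp i u) taum &
        surface_ae Dm S (fun x => taup x - taum x = comp i g x)].

(* Om is the domain enclosed by the closed surface that extends S. *)
Definition outer_part (R : realType) (Omega Om : set (pt3 R)) : set (pt3 R) :=
  Omega `\` closure Om.

(* S is relatively open in a closed surface, hence this is its boundary as a
   surface. *)
Definition surface_boundary (R : realType) (S : set (pt3 R)) : set (pt3 R) :=
  closure S `\` S.

(* In some graph chart of the closed surface bounding Om at x, S is the part of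
   the plane on one side of the graph of a Lipschitz function of one variable,
   in coordinates (s, t) along an orthonormal frame (a, b) of the base. *)
Definition lipschitz_edge_at (R : realType) (Om S : set (pt3 R)) (x : pt3 R) :
    Prop :=
  exists2 c : chart R, boundary_chart Om x c &
  exists (a b : pt2 R) (r h : R) (psi : R -> R),
    [/\ a.1 ^+ 2 + a.2 ^+ 2 = 1, b.1 ^+ 2 + b.2 ^+ 2 = 1 &
        a.1 * b.1 + a.2 * b.2 = 0] /\
    [/\ 0 < r, 0 < h, exists k : R, k.-lipschitz psi & psi 0 = 0] /\
    (forall s, `|s| < r -> `|psi s| < h) /\
    forall s t, `|s| < r -> `|t| < h ->
      chart_base c (s *: a + t *: b) /\
      (S (chart_graph c (s *: a + t *: b)) <-> psi s < t).

Record dislocation_surface (R : realType) (Omega S Gamma Om : set (pt3 R)) :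
    Prop := DislocationSurface {
  ds_inner : lipschitz_domain Om;
  ds_closed_surface : Gamma = frontier Om;
  ds_inner_sub : Om `<=` Omega;
  ds_closed_surface_sub : Gamma `<=` Omega;
  ds_outer : domain (outer_part Omega Om);
  ds_open : exists2 U : set (pt3 R), open U & S = Gamma `&` U;
  ds_compactly_inside : closure S `<=` Omega;
  ds_edge : forall x, surface_boundary S x -> lipschitz_edge_at Om S x }.

(* Distance to the edge of S.  If S has no edge the infimum is 0, and so is the
   weight 1 / delta below, which then imposes no condition. *)
Definition edge_dist (R : realType) (S : set (pt3 R)) (x : pt3 R) : R :=
  inf [set enorm (x - z) | z in surface_boundary S].

(* Membership in H^{1/2}_{00}(S), in charts covering the compact set closure S:
   L^2 norm, Gagliardo seminorm (the exponent 3 is dim S + 2 * (1/2)), and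
   weighted L^2 norm. *)
Definition H12_00 (R : realType) (Om S : set (pt3 R)) (g : pt3 R -> R) : Prop :=
  forall x, closure S x -> exists2 c, boundary_chart Om x c &
    let Phi := chart_graph c in
    [/\ L2 (@leb2 R) (chart_part c S) (g \o Phi),
        (\int[@leb2 R]_(y in chart_part c S) \int[@leb2 R]_(z in chart_part c S)
           ((g (Phi y) - g (Phi z)) ^+ 2 / enorm (Phi y - Phi z) ^+ 3)%:E
           < +oo)%E &
        (\int[@leb2 R]_(y in chart_part c S)
           (g (Phi y) ^+ 2 / edge_dist S (Phi y))%:E < +oo)%E].

Definition H12_00_vec (R : realType) (Om S : set (pt3 R))
    (g : pt3 R -> pt3 R) : Prop :=
  forall i : 'I_3, H12_00 Om S (comp i g).

Definition sym_part (R : realType) (A : 'M[R]_3) : 'M[R]_3 :=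
  2^-1 *: (A + A^T).

Definition ddot (R : realType) (A B : 'M[R]_3) : R :=
  \sum_(i < 3) \sum_(j < 3) A i j * B i j.

Definition mnorm (R : realType) (A : 'M[R]_3) : R := Num.sqrt (ddot A A).

Definition tensor4 (R : realType) := 'I_3 -> 'I_3 -> 'I_3 -> 'I_3 -> R.

Definition tapply (R : realType) (C : tensor4 R) (A : 'M[R]_3) : 'M[R]_3 :=
  \matrix_(i, j) \sum_(k < 3) \sum_(h < 3) C i j k h * A k h.

Record elasticity_tensor (R : realType) (Omega : set (pt3 R))
    (C : pt3 R -> tensor4 R) : Prop := ElasticityTensor {
  et_minor : forall x i j k h, Omega x -> C x i j k h = C x j i k h;
  et_major : forall x i j k h, Omega x -> C x i j k h = C x k h i j;
  et_bounded : forall i j k h, Linfty (@leb3 R) Omega (fun x => C x i j k h);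
  et_convex : exists2 c : R, 0 < c &
    {ae (@leb3 R), forall x, Omega x -> forall A : 'M[R]_3,
      c * mnorm (sym_part A) ^+ 2 <=
      ddot (tapply (C x) (sym_part A)) (sym_part A)} }.

Definition gradient (R : realType) (D : set (pt3 R)) (u : pt3 R -> pt3 R)
    (x : pt3 R) : 'M[R]_3 :=
  \matrix_(i, j) weak_partial D j (comp i u) x.

Definition strain (R : realType) (D : set (pt3 R)) (u : pt3 R -> pt3 R)
    (x : pt3 R) : 'M[R]_3 :=
  sym_part (gradient D u x).

Definition boundary_portion (R : realType) (Omega Sigma : set (pt3 R)) : Prop :=
  exists U : set (pt3 R), [/\ open U, (frontier Omega `&` U) !=set0 &
    Sigma = closure (frontier Omega `&` U)].

Definition slit_domain (R : realType) (Omega S : set (pt3 R)) : set (pt3 R) :=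
  Omega `\` closure S.

(* The variational form: the equation, the traction condition on the rest of the
   boundary of Omega and the continuity of tractions across S are encoded
   together by testing against all of H^1_Sigma(Omega), whose elements do not
   jump across S. *)
Record weak_solution (R : realType) (Omega Sigma S Om : set (pt3 R))
    (C : pt3 R -> tensor4 R) (g u : pt3 R -> pt3 R) : Prop := WeakSolution {
  ws_space : H1_zero_on Sigma (slit_domain Omega S) u;
  ws_jump : jump_eq (outer_part Omega Om) Om S u g;
  ws_variational : forall v, H1_zero_on Sigma Omega v ->
    \int[@leb3 R]_(x in slit_domain Omega S)
      ddot (tapply (C x) (strain (slit_domain Omega S) u x))
           (strain Omega v x) = 0 }.

(* Main.v *)
(* The difference w of two solutions, set to zero on the slit, has the same trace from
   both sides of S.  Near a point of S, approximating w by smooth functions on each side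
   and integrating by parts produces a boundary term that tends to zero, so w has weak
   derivatives there; the edge of S lies on a Lipschitz curve, which is removable for
   square integrable functions.  Hence w belongs to H^1_Sigma(Omega) and may be used as
   a test function, and convexity of the energy gives zero strain.  A field with zero
   strain is locally affine; extended by zero across Sigma it still has zero strain, so
   it vanishes near a point of Sigma and, Omega being connected, everywhere. *)
From HB Require Import structures.
From mathcomp Require Import all_boot all_order all_algebra.
From mathcomp Require Import all_classical all_reals all_analysis.
From mathcomp Require Import measurable_realfun ess_sup_inf.
From mathcomp Require Import ring lra.
Require Import Defs.

Set Implicit Arguments.
Unset Strict Implicit.
Unset Printing Implicit Defensive.
Import Order.TTheory GRing.Theory Num.Theory.
Import numFieldNormedType.Exports.

Local Open Scope classical_set_scope.
Local Open Scope ring_scope.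

(** * Comparison of measures on dyadic cells *)

(** The boundary term is only bounded, never computed, so neither a surface measure nor a divergence
    theorem occurs. Translation moves the difference quotients of a test function onto the indicator
    of the domain, where they live in a thin layer around the graph. The volume of the layer is
    controlled through a bi-Lipschitz flattening, for which it is enough to compare volumes up to a
    constant; dyadic cells provide this comparison. A bound suffices because it is applied to
    approximants whose restriction to the graph tends to zero in [L2]: the terms from the two sides
    of [S] are opposite, so only the difference of the two approximants on the graph counts.
    Mollification is avoided too: null functions and affine fields are recognised by testing with
    tensor products of one-variable functions, which reduces the analysis to primitives on the line.
    [weak_partial] is an arbitrary choice for each domain, hence the recurrent appeal to uniqueness
    almost everywhere when the domain changes. *)

Section algebra_approximation.
Context d (T : measurableType d) (R : realType).
Variable G : set (set T).
Hypothesis measurableG : d.-measurable = <<s G >>.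
Hypothesis GT : G setT.
Hypothesis GC : forall A, G A -> G (~` A).
Hypothesis GU : forall A B, G A -> G B -> G (A `|` B).

Let GI A B : G A -> G B -> G (A `&` B).
Proof. by move=> GA GB; rewrite -(setCK (A `&` B)) setCI; exact/GC/GU/GC/GB/GC. Qed.

Let mG A : G A -> measurable A.
Proof. by rewrite measurableG; exact: sub_sigma_algebra. Qed.

(** The sets that can be approximated in measure form a Dynkin system. For a disjoint union,
    finiteness of [mu] makes the tails small, and the finitely many remaining pieces are
    approximated one by one. *)
Lemma measure_algebra_approx (mu : {measure set T -> \bar R}) (A : set T)
    (e : R) : (mu setT < +oo)%E -> measurable A -> 0 < e ->
  exists2 E, G E & (mu ((A `\` E) `|` (E `\` A)) < e%:E)%E.
Proof.
move=> muT mA; move: e.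
apply: (@dynkin_induction _ T G (fun A => forall e, 0 < e ->
  exists2 E, G E & (mu ((A `\` E) `|` (E `\` A)) < e%:E)%E)).
- exact: measurableG.
- exact: GI.
- by move=> e e0; exists setT => //; rewrite setDv setU0 measure0 lte_fin.
- by move=> E GE e e0; exists E => //; rewrite setDv setU0 measure0 lte_fin.
- move=> S mS PS e /PS[E GE muE]; exists (~` E); first exact: GC.
  by rewrite !setDE !setCK setIC (setIC (~` E)) setUC -!setDE.
- move=> F mF tF PF e e0.
  pose B n := (\bigcup_k F k) `\` \big[setU/set0]_(k < n) F k.
  have mU : measurable (\bigcup_k F k) by apply: bigcupT_measurable.
  have mB n : measurable (B n).
    by apply: measurableD => //; apply: bigsetU_measurable.
  have /fine_cvgP[_ /cvgrPdist_lt/(_ (e / 2))] : (mu \o B) x @[x --> \oo] --> 0%:E.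
    have B0 : \bigcap_n B n = set0.
      rewrite -subset0 => x Bx; have [[k _ Fkx] _] := Bx 0%N I.
      by have [_] := Bx k.+1 I; apply; rewrite -bigcup_mkord; exists k => /=.
    rewrite [X in _ --> X](_ : _ = mu (\bigcap_n B n)); last by rewrite B0 measure0.
    apply: nonincreasing_cvg_mu => //.
    + by rewrite (le_lt_trans _ muT)// le_measure ?inE.
    + by apply: bigcapT_measurable.
    + move=> n m nm; apply/subsetPset; apply: setDS.
      by rewrite -!bigcup_mkord => x [k /= kn Fk]; exists k => //=; apply: leq_trans kn nm.
  case; first by rewrite divr_gt0.
  move=> n _ /(_ n (leqnn n)); rewrite /= sub0r normrN => Bn.
  (* One half of [e] pays for the tail [B n]; the other is shared by the [n] remaining pieces.
     Dividing by [n.+1] allows [n = 0] and keeps the final inequality strict. *)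
  have e2n : 0 < e / 2 / n.+1%:R by rewrite !divr_gt0.
  have : forall k, exists E, G E /\ (mu ((F k `\` E) `|` (E `\` F k)) < (e / 2 / n.+1%:R)%:E)%E.
    by move=> k; have [E ? ?] := PF k _ e2n; exists E.
  move=> /choice[E EP]; exists (\big[setU/set0]_(k < n) E k).
    apply: big_ind => //; last by move=> i _; have [] := EP i.
    by rewrite -(setCK set0) setC0; exact: GC.
  have mE k : measurable (E k) by apply: mG; have [] := EP k.
  pose D k := (F k `\` E k) `|` (E k `\` F k).
  have mD k : measurable (D k) by apply: measurableU; apply: measurableD.
  apply: (@le_lt_trans _ _ (mu (B n `|` \big[setU/set0]_(k < n) D k))).
    rewrite le_measure ?inE//.
    + by apply: measurableU; apply: measurableD => //; exact: bigsetU_measurable.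
    + by apply: measurableU => //; exact: bigsetU_measurable.
    + rewrite -!bigcup_mkord /B -bigcup_mkord => x [|].
      * move=> [[k _ Fkx] nE]; have [kn|nk] := pselect (exists2 j, (j < n)%N & F j x).
          case: kn => j jn Fjx; right; exists j => //=; left; split => //.
          by move=> Ejx; apply: nE; exists j.
        by left; split; [exists k|move=> [j ? ?]; apply: nk; exists j].
      * move=> [[k kn Ekx] nF]; right; exists k => //; right; split => // Fkx.
        by apply: nF; exists k.
  rewrite (le_lt_trans (measureU2 _ _ _))//; first exact: bigsetU_measurable.
  rewrite (splitr e) EFinD lteD//.
    rewrite -[ltLHS]fineK ?lte_fin; first by rewrite (le_lt_trans (ler_norm _)).
    rewrite ge0_fin_numE// (le_lt_trans _ muT)// le_measure ?inE//.
  apply: (le_lt_trans (Boole_inequality _ _)) => //.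
  apply: (@le_lt_trans _ _ (\sum_(i < n) (e / 2 / n.+1%:R)%:E)%E).
    by apply: lee_sum => i _; apply: ltW; have [] := EP i.
  rewrite sumEFin lte_fin sumr_const card_ord -[ltLHS]mulr_natr.
  by rewrite -(mulrA (e / 2)) gtr_pMr ?divr_gt0// mulrC ltr_pdivrMr// mul1r ltr_nat.
- by rewrite -measurableG.
Qed.

(** A member of [G] that is close to [A] for the measure [nu + mu] is close for both measures at
    once, so the comparison passes from it to [A] with an error below [e]. *)
Lemma le_measure_algebra (nu mu : {measure set T -> \bar R}) :
  (nu setT < +oo)%E -> (mu setT < +oo)%E ->
  (forall A, G A -> (nu A <= mu A)%E) ->
  forall A, measurable A -> (nu A <= mu A)%E.
Proof.
move=> nuT muT numu A mA.
have mufin : mu A \is a fin_num.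
  by rewrite ge0_fin_numE// (le_lt_trans _ muT)// le_measure ?inE.
apply/lee_addgt0Pr => e e0.
have lT : (measure_add nu mu setT < +oo)%E by rewrite measure_addE lte_add_pinfty.
have [E GE lE] := measure_algebra_approx lT mA e0.
have {}lE : (nu ((A `\` E) `|` (E `\` A)) + mu ((A `\` E) `|` (E `\` A)) < e%:E)%E.
  by rewrite -measure_addE.
have mE := mG GE.
have mD : measurable ((A `\` E) `|` (E `\` A)).
  by apply: measurableU; apply: measurableD.
apply: (@le_trans _ _ (nu E + nu (A `\` E))%E).
  apply: (le_trans _ (measureU2 _ _ _)) => //; last exact: measurableD.
  rewrite le_measure ?inE//; first by apply: measurableU => //; exact: measurableD.
  by move=> x Ax; have [|] := pselect (E x); [left|right].
apply: (@le_trans _ _ (mu A + mu (E `\` A) + nu (A `\` E))%E).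
  rewrite leeD2r// (le_trans (numu _ GE))//.
  apply: (le_trans _ (measureU2 _ _ _)) => //; last exact: measurableD.
  rewrite le_measure ?inE//; first by apply: measurableU => //; exact: measurableD.
  by move=> x Ax; have [|] := pselect (A x); [left|right].
rewrite -addeA leeD2l// (le_trans _ (ltW lE))// addeC leeD//.
  by rewrite le_measure ?inE//; exact: measurableD.
by rewrite le_measure ?inE//; exact: measurableD.
Qed.

End algebra_approximation.

Section lebesgue_boxes.
Context (R : realType).
Implicit Types (A B C : set R).

Lemma leb2X A B : measurable A -> measurable B ->
  @leb2 R (A `*` B) = (lebesgue_measure A * lebesgue_measure B)%E.
Proof. by move=> mA mB; rewrite /leb2 product_measure1E. Qed.

Lemma leb3X (A : set (pt2 R)) B : measurable A -> measurable B ->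
  @leb3 R (A `*` B) = (@leb2 R A * lebesgue_measure B)%E.
Proof. by move=> mA mB; rewrite /leb3 product_measure1E. Qed.

Lemma leb3XX A B C : measurable A -> measurable B -> measurable C ->
  @leb3 R (A `*` B `*` C) =
  (lebesgue_measure A * lebesgue_measure B * lebesgue_measure C)%E.
Proof. by move=> mA mB mC; rewrite leb3X ?leb2X//; exact: measurableX. Qed.

Definition cube (x : pt3 R) (r : R) : set (pt3 R) :=
  `[x.1.1 - r, x.1.1 + r]%classic `*` `[x.1.2 - r, x.1.2 + r]%classic
  `*` `[x.2 - r, x.2 + r]%classic.

Lemma measurable_cube x r : measurable (cube x r).
Proof. by apply: measurableX; first apply: measurableX. Qed.

Lemma leb3_cube x r : 0 <= r -> @leb3 R (cube x r) = ((2 * r) ^+ 3)%:E.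
Proof.
move=> r0; rewrite leb3XX// !lebesgue_measure_itv/= !lte_fin.
have E (y : R) : (if (y - r < y + r)%R then (y + r)%:E + (- (y - r))%:E else 0%E)%E = (2 * r)%:E.
  case: ifPn => [_|]; first by rewrite -EFinD; congr (_%:E); ring.
  by rewrite -leNgt => h; congr (_%:E); lra.
by rewrite !E -!EFinM; congr (_%:E); ring.
Qed.

Lemma cubeP x r y : cube x r y <-> `|y - x| <= r.
Proof.
rewrite /cube !prod_normE !ge_max /=.
rewrite -[y.1.1 + _]/(y.1.1 - x.1.1) -[y.1.2 + _]/(y.1.2 - x.1.2).
rewrite !in_itv/= !ler_norml; split.
  by move=> [[/andP[? ?] /andP[? ?]] /andP[? ?]]; do !(apply/andP; split); lra.
move=> /andP[/andP[/andP[? ?] /andP[? ?]] /andP[? ?]].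
by split; [split|]; apply/andP; split; lra.
Qed.

End lebesgue_boxes.

Section dyadic.
Context (R : realType).

(** Index of the half-open dyadic interval of length [2^-n] that contains [x]. *)
Definition dyad (n : nat) (x : R) : int := Num.floor (2 ^+ n * x).

(** Dyadic intervals refine each other: the integer part of [2 t] determines that of [t], because it
    lies between [2 k] and [2 k + 1] where [k] is the integer part of [t]. *)
Lemma dyadS n x y : dyad n.+1 x = dyad n.+1 y -> dyad n x = dyad n y.
Proof.
rewrite /dyad !exprS -!mulrA; move: (2 ^+ n * x) (2 ^+ n * y) => {}x {}y xy.
apply/esym; rewrite -(@floor_def _ y (Num.floor x)) //.
have [/andP[a b] /andP[c e]] := (floor_itv x, floor_itv (2 * x)).
have /andP[c' e'] := floor_itv (2 * y); rewrite -xy in c' e'.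
have h1 : (2 * (Num.floor x)%:~R : R) <= (Num.floor (2 * x))%:~R.
  rewrite (_ : 2 * _ = (2 * Num.floor x)%:~R); last by rewrite intrM.
  by rewrite ler_int floor_ge_int intrM ler_pM2l// floor_le.
have h1' := le_trans h1 c'.
have h2 : (Num.floor (2 * x) + 1)%:~R <= (2 * (Num.floor x + 1)%:~R : R).
  rewrite (_ : 2 * _ = (2 * (Num.floor x + 1))%:~R); last by rewrite intrM.
  by rewrite ler_int lezD1 floor_lt_int intrM ltr_pM2l// floorD1_gt.
have h2' := lt_le_trans e' h2; apply/andP; split; lra.
Qed.

Lemma dyad_le n m x y : (n <= m)%N -> dyad m x = dyad m y -> dyad n x = dyad n y.
Proof.
elim: m => [|m IH]; first by rewrite leqn0 => /eqP->.
rewrite leq_eqVlt => /predU1P[->//|]; rewrite ltnS => /IH nm /dyadS; exact: nm.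
Qed.

Lemma dyad_dist n x y : dyad n x = dyad n y -> `|x - y| <= (2 ^+ n)^-1.
Proof.
rewrite /dyad => xy.
have [/andP[a b] /andP[c e]] := (floor_itv (2 ^+ n * x), floor_itv (2 ^+ n * y)).
rewrite xy in a b; rewrite intrD in b e.
have p : (0 : R) < 2 ^+ n by rewrite exprn_gt0.
rewrite -(ler_pM2l p) mulfV ?gt_eqF// -[X in X * _](gtr0_norm p) -normrM mulrBr.
rewrite ler_norml; apply/andP; split; lra.
Qed.

Lemma dyad_preimage n k : dyad n @^-1` [set k] =
  `[k%:~R / 2 ^+ n, (k + 1)%:~R / 2 ^+ n[%classic.
Proof.
have p : (0 : R) < 2 ^+ n by rewrite exprn_gt0.
apply/seteqP; split => x /=; rewrite in_itv/=.
  by move=> <-; rewrite ler_pdivrMr// ltr_pdivlMr// ![x * _]mulrC; exact: floor_itv.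
rewrite ler_pdivrMr// ltr_pdivlMr// ![x * _]mulrC => h; exact: floor_def.
Qed.

(** The condition on the right says that the whole dyadic interval of [x] lies to the left of [a];
    this holds for some [n] as soon as [2^-n] is below [a - x]. Half-lines thus become countable
    unions of dyadic sets. *)
Lemma dyad_lt (a : R) : `]-oo, a[%classic =
  \bigcup_n [set x : R | (dyad n x + 1)%:~R <= 2 ^+ n * a].
Proof.
apply/seteqP; split => x /=.
  rewrite in_itv/= -subr_gt0 => xa.
  have [n _ /(_ n (leqnn n))] := near_infty_natSinv_expn_lt (PosNum xa).
  rewrite /= => h; exists n => //=.
  have p : (0 : R) < 2 ^+ n by rewrite exprn_gt0.
  have := floor_itv (2 ^+ n * x) => /andP[]; rewrite -/(dyad n x) intrD => u v.
  move: h; rewrite ltr_pdivrMr//; lra.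
move=> [n _ /=]; rewrite in_itv/=.
have p : (0 : R) < 2 ^+ n by rewrite exprn_gt0.
have := floor_itv (2 ^+ n * x) => /andP[_]; rewrite -/(dyad n x) => u v.
by rewrite -(ltr_pM2l p) (lt_le_trans u).
Qed.

Definition dyad3 n (x : pt3 R) : int * int * int :=
  (dyad n x.1.1, dyad n x.1.2, dyad n x.2).

(** Arbitrary unions of cells of one generation. Fixing the generation for each set gives stability
    under complement, and refinement to a common generation gives stability under union, so this is
    an algebra. *)
Definition dyadic_sets : set (set (pt3 R)) :=
  [set A | exists n, forall x y, dyad3 n x = dyad3 n y -> A x -> A y].

Lemma dyad3_le n m x y : (n <= m)%N -> dyad3 m x = dyad3 m y -> dyad3 n x = dyad3 n y.
Proof.
move=> nm [h1 h2 h3]; rewrite /dyad3.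
by rewrite (dyad_le nm h1) (dyad_le nm h2) (dyad_le nm h3).
Qed.

Lemma dyad3_dist n x y : dyad3 n x = dyad3 n y -> `|x - y| <= (2 ^+ n)^-1.
Proof.
move=> [h1 h2 h3]; rewrite !prod_normE !ge_max /=.
by rewrite (dyad_dist h1) (dyad_dist h2) (dyad_dist h3).
Qed.

Lemma dyadic_setsC A : dyadic_sets A -> dyadic_sets (~` A).
Proof. by move=> [n An]; exists n => x y xy nAx Ay; apply/nAx/(An y). Qed.

Lemma dyadic_setsU A B : dyadic_sets A -> dyadic_sets B -> dyadic_sets (A `|` B).
Proof.
move=> [n An] [m Bm]; exists (maxn n m) => x y xy [Ax|Bx]; [left|right].
  by apply: An Ax; apply: dyad3_le xy; rewrite leq_maxl.
by apply: Bm Bx; apply: dyad3_le xy; rewrite leq_maxr.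
Qed.

Lemma measurable_dyad3 n k : measurable (dyad3 n @^-1` [set k]).
Proof.
case: k => [[a b] c].
rewrite (_ : _ @^-1` _ = (dyad n @^-1` [set a]) `*` (dyad n @^-1` [set b]) `*` (dyad n @^-1` [set c])).
  by rewrite !dyad_preimage; apply: measurableX => //; exact: measurableX.
by apply/seteqP; split => x /=; rewrite /dyad3; [case=> <- <- <-|move=> [[<- <-] <-]].
Qed.

(** Cells enumerated by [nat] through the encoding of their integer indices, to be used in countable
    unions. A number that encodes no triple gives the empty set. *)
Definition dyad_cell n (k : nat) : set (pt3 R) := (pickle \o dyad3 n) @^-1` [set k].

Lemma dyad_cell_or n k : dyad_cell n k = set0 \/
  exists x, dyad_cell n k = dyad3 n @^-1` [set dyad3 n x].
Proof.
have [[x xk]|nk] := pselect (dyad_cell n k !=set0); [right|left]; last exact/nonemptyPn.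
exists x; apply/seteqP; split => y /=; rewrite /dyad_cell/= -xk.
  by move/(pcan_inj pickleK).
by move=> ->.
Qed.

Lemma measurable_dyad_cell n k : measurable (dyad_cell n k).
Proof.
have [->|[x ->]] := dyad_cell_or n k; first exact: measurable0.
exact: measurable_dyad3.
Qed.

Lemma trivIset_dyad_cell n D : trivIset D (dyad_cell n).
Proof. by move=> i j _ _ [x [<- <-]]. Qed.

Lemma bigcup_dyad_cell n : \bigcup_k dyad_cell n k = setT.
Proof. by apply/seteqP; split => // x _; exists (pickle (dyad3 n x)). Qed.

Lemma dyadic_set_bigcup A : dyadic_sets A ->
  exists n (D : set nat), A = \bigcup_(k in D) dyad_cell n k.
Proof.
move=> [n An]; exists n, ((pickle \o dyad3 n) @` A).
apply/seteqP; split => [x Ax|x [k [y Ay <-]]].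
  by exists (pickle (dyad3 n x)) => //; exists x.
by rewrite /dyad_cell/= => /(pcan_inj pickleK)/esym h; exact: An Ay.
Qed.

Lemma measurable_dyadic_set A : dyadic_sets A -> measurable A.
Proof.
move=> /dyadic_set_bigcup[n [D ->]].
by apply: bigcup_measurable => k _; exact: measurable_dyad_cell.
Qed.

Let coord_dyadic (p : pt3 R -> R) : (forall n x y, dyad3 n x = dyad3 n y ->
    dyad n (p x) = dyad n (p y)) ->
  @measurable_fun _ _ (g_sigma_algebraType dyadic_sets) R setT p.
Proof.
move=> pP; apply: (@measurability _ _ (g_sigma_algebraType dyadic_sets) (measurableTypeR R) setT p _ (RGenInftyO.measurableE R)).
move=> _ [_ [a ->] <-]; rewrite setTI dyad_lt preimage_bigcup.
apply: bigcupT_measurable => n; apply: sub_sigma_algebra.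
by exists n => x y /pP xy /=; rewrite xy.
Qed.

Lemma measurable_dyadic_gen :
  (measurable : set (set (pt3 R))) = <<s dyadic_sets >>.
Proof.
apply/seteqP; split; last first.
  apply: smallest_sub; first exact: sigma_algebra_measurable.
  exact: measurable_dyadic_set.
move=> A mA.
(* The identity map, rebuilt from its coordinates, is measurable from the dyadic sigma-algebra to
   the product one; its preimages give the inclusion. *)
have : @measurable_fun _ _ (g_sigma_algebraType dyadic_sets) (pt3 R) setT
    (fun x => ((x.1.1, x.1.2), x.2)).
  apply: measurable_fun_pair; first apply: measurable_fun_pair.
  - by apply: coord_dyadic => n x y [].
  - by apply: coord_dyadic => n x y [].
  - by apply: coord_dyadic => n x y [].
move=> /(_ measurableT A mA); rewrite setTI.
by rewrite (_ : _ @^-1` _ = A)//; apply/seteqP; split => -[[]].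
Qed.

(* Comparing two measures on dyadic cells suffices: every Borel set is approximated
   in measure by finite unions of cells. *)
Lemma le_measure_dyadic (nu mu : {measure set (pt3 (measurableTypeR R)) -> \bar R}) :
  (nu setT < +oo)%E -> (mu setT < +oo)%E ->
  (forall n x, (nu (dyad3 n @^-1` [set dyad3 n x]) <=
                mu (dyad3 n @^-1` [set dyad3 n x]))%E) ->
  forall A, measurable A -> (nu A <= mu A)%E.
Proof.
move=> nuT muT numu; apply: (@le_measure_algebra _ (pt3 (measurableTypeR R)) R (@dyadic_sets) measurable_dyadic_gen) => //.
- by exists 0%N.
- exact: dyadic_setsC.
- exact: dyadic_setsU.
move=> A /dyadic_set_bigcup[n [D ->]].
rewrite !measure_bigcup//; try by move=> i _; exact: measurable_dyad_cell.
- by apply: lee_nneseries => // i _; have [->|[x ->]] := dyad_cell_or n i;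
    rewrite ?measure0//; exact: numu.
- exact: trivIset_dyad_cell.
- exact: trivIset_dyad_cell.
Qed.

End dyadic.

Section leb_sigma_finite.
Context (R : realType).

Let leb2_sigma_finite : sigma_finite setT (@leb2 R).
Proof.
have /sigma_finiteP[F [TF ndF Foo]] := sigma_finiteT (@lebesgue_measure R).
exists (fun n => F n `*` F n).
  rewrite -setXTT TF predeqE => -[x y]; split.
    move=> [/= [n _ Fnx] [k _ Gky]]; exists (maxn n k) => //; split.
    - by move: x Fnx; exact/subsetPset/ndF/leq_maxl.
    - by move: y Gky; exact/subsetPset/ndF/leq_maxr.
  by move=> [n _ []/= ? ?]; split; exists n.
move=> k; have [? ?] := Foo k.
by split; [exact: measurableX|rewrite leb2X// lte_mul_pinfty// ge0_fin_numE].
Qed.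

HB.instance Definition _ := Measure.on (@leb2 R).
HB.instance Definition _ :=
  Measure_isSigmaFinite.Build _ _ _ (@leb2 R) leb2_sigma_finite.

Lemma leb3_tonelli (f : pt3 R -> \bar R) : measurable_fun setT f ->
  (forall x, (0 <= f x)%E) ->
  (\int[@leb3 R]_x f x =
   \int[@leb2 R]_y \int[@lebesgue_measure R]_z f (y, z))%E.
Proof.
by move=> mf f0; exact: (@fubini_tonelli1 _ _ _ _ _ (@leb2 R) (@lebesgue_measure R) f mf f0).
Qed.

End leb_sigma_finite.

Section open_measurable.
Context (R : realType).

Lemma exists_dyad (e : R) : 0 < e -> exists n, (2 ^+ n)^-1 < e.
Proof.
move=> e0; have [n _ /(_ n (leqnn n))] := near_infty_natSinv_expn_lt (PosNum e0).
by rewrite /= div1r; exists n.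
Qed.

Lemma open_dyadic (U : set (pt3 R)) : open U -> forall x, U x ->
  exists n, dyad3 n @^-1` [set dyad3 n x] `<=` U.
Proof.
move=> oU x Ux; have /nbhs_ballP[e /= e0 eU] := open_nbhs_nbhs (conj oU Ux).
have [n ne] := exists_dyad e0; exists n => y /= xy; apply: eU.
by rewrite -ball_normE /= distrC (le_lt_trans _ ne)// dyad3_dist.
Qed.

(** Measurability refers to the product sigma-algebra whereas openness refers to the topology. Every
    point of [U] lies in a cell contained in [U], and there are countably many cells. *)
Lemma open_measurable3 (U : set (pt3 R)) : open U -> measurable U.
Proof.
move=> oU.
rewrite (_ : U = \bigcup_n \bigcup_(k in [set k | dyad_cell n k `<=` U]) dyad_cell n k).
  apply: bigcupT_measurable => n; apply: bigcup_measurable => k _.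
  exact: measurable_dyad_cell.
apply/seteqP; split=> [x Ux|x [n _ [k /= kU /kU]]]//.
have [n nU] := open_dyadic oU Ux; exists n => //.
by exists (pickle (dyad3 n x)) => //= y /(pcan_inj pickleK)/nU.
Qed.

Lemma closed_measurable3 (U : set (pt3 R)) : closed U -> measurable U.
Proof. by move=> /closed_openC/open_measurable3/measurableC; rewrite setCK. Qed.

(** [U] is a slice of an open cylinder in dimension three. *)
Lemma open_measurable2 (U : set (pt2 R)) : open U -> measurable U.
Proof.
move=> oU; have oU' : open ((fst : pt3 R -> pt2 R) @^-1` U).
  by apply: open_comp => // x _; exact: cvg_fst.
have := @pair2_measurable _ _ (pt2 R) R 0 measurableT _ (open_measurable3 oU').
by rewrite setTI.
Qed.

Lemma closed_measurable2 (U : set (pt2 R)) : closed U -> measurable U.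
Proof. by move=> /closed_openC/open_measurable2/measurableC; rewrite setCK. Qed.

Lemma continuous_measurable3 (f : pt3 R -> R) : continuous f -> measurable_fun setT f.
Proof.
move=> cf; apply: (@measurability _ _ _ (measurableTypeR R) setT f _ (RGenInftyO.measurableE R)).
move=> _ [_ [a ->] <-]; rewrite setTI; apply: open_measurable3.
by apply: open_comp => //; exact: interval_open.
Qed.

Lemma continuous_measurable2 (f : pt2 R -> R) : continuous f -> measurable_fun setT f.
Proof.
move=> cf; apply: (@measurability _ _ _ (measurableTypeR R) setT f _ (RGenInftyO.measurableE R)).
move=> _ [_ [a ->] <-]; rewrite setTI; apply: open_measurable2.
by apply: open_comp => //; exact: interval_open.
Qed.

Lemma continuous_coord (i : 'I_3) : continuous (@coord R i).
Proof.
case: i => -[|[|[|//]]] ? x; rewrite /coord/=.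
- by apply: (@continuous_comp _ _ _ fst fst); exact: cvg_fst.
- by apply: (@continuous_comp _ _ _ fst snd); [exact: cvg_fst|exact: cvg_snd].
- exact: cvg_snd.
Qed.

End open_measurable.

(** * Integrals along maps with a Lipschitz inverse *)

Section domination.
Context d d' (X : measurableType d) (Y : measurableType d') (R : realType).
Variables (mu : {measure set X -> \bar R}) (nu : {measure set Y -> \bar R}).
Variables (D : set X) (T : X -> Y) (c : R).
Hypotheses (mD : measurable D) (mT : measurable_fun setT T) (c0 : 0 <= c).
Hypothesis muD : forall B, measurable B -> (mu (D `&` T @^-1` B) <= c%:E * nu B)%E.

Lemma integral_mrestr (f : X -> \bar R) : measurable_fun setT f ->
  (forall x, (0 <= f x)%E) ->
  (\int[mrestr mu mD]_x f x = \int[mu]_(x in D) f x)%E.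
Proof.
move=> mf f0.
have mC : measurable (~` D) by exact: measurableC.
rewrite [LHS](@ge0_negligible_integral _ _ _ _ _ (~` D))//; last first.
  by rewrite -[LHS]/(mu (~` D `&` D)) setICl measure0.
rewrite setTD setCK; apply: eq_measure_integral => A mA AD.
by rewrite -[LHS]/(mu (A `&` D)) setIidl.
Qed.

Lemma exists_pushforward_restr : exists m : {measure set Y -> \bar R},
  forall S, m S = mu (T @^-1` S `&` D).
Proof. by unshelve eexists (pushforward (mrestr mu mD) T). Qed.

Lemma exists_scale_restr : exists m : {measure set X -> \bar R},
  forall S, m S = (c%:E * mu (S `&` D))%E.
Proof. by exists (mscale (NngNum c0) (mrestr mu mD)). Qed.

(** The hypothesis says that the image under [T] of [mu] restricted to [D] is at most [c] times
    [nu]; integrals of nonnegative functions inherit this order. *)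
Lemma ge0_integral_dominated (f : Y -> \bar R) : measurable_fun setT f ->
  (forall y, (0 <= f y)%E) ->
  (\int[mu]_(x in D) f (T x) <= c%:E * \int[nu]_y f y)%E.
Proof.
move=> mf f0; rewrite -integral_mrestr//; last exact: measurableT_comp.
rewrite -(@ge0_integral_mscale _ _ _ nu setT measurableT (NngNum c0))//.
rewrite -[leLHS]/(\int[mrestr mu mD]_(x in T @^-1` setT) (f \o T) x)%E.
rewrite -ge0_integral_pushforward//.
apply: ge0_le_measure_integral => // S mS.
rewrite -[leLHS]/(mu (T @^-1` S `&` D)) -[leRHS]/(c%:E * nu S)%E setIC; exact: muD.
Qed.

End domination.

Section lipschitz_pullback.
Context (R : realType).

Lemma leb3_le (A B : set (pt3 R)) : measurable A -> measurable B ->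
  A `<=` B -> (@leb3 R A <= @leb3 R B)%E.
Proof. by move=> mA mB AB; apply: le_measure => //; rewrite inE. Qed.

Lemma leb3_dyad3 n (x : pt3 R) :
  @leb3 R (dyad3 n @^-1` [set dyad3 n x]) = ((2 ^+ n)^-1 ^+ 3)%:E.
Proof.
rewrite (_ : _ @^-1` _ = (dyad n @^-1` [set dyad n x.1.1]) `*`
    (dyad n @^-1` [set dyad n x.1.2]) `*` (dyad n @^-1` [set dyad n x.2])).
  have E k : lebesgue_measure (@dyad R n @^-1` [set k]) = ((2 ^+ n)^-1)%:E.
    have p : (0 : R) < (2 ^+ n)^-1 by rewrite invr_gt0 exprn_gt0.
    rewrite dyad_preimage lebesgue_measure_itv/= lte_fin ltr_pM2r// ltr_int.
    by rewrite ltrDl ltr01 -EFinD intrD -mulrBl addrAC subrr add0r mul1r.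
  rewrite leb3XX ?E -?EFinM; first by congr (_%:E); ring.
  - by rewrite dyad_preimage.
  - by rewrite dyad_preimage.
  - by rewrite dyad_preimage.
by apply/seteqP; split => y /=; rewrite /dyad3; [case=> <- <- <-|move=> [[<- <-] <-]].
Qed.

Variables (D : set (pt3 R)) (T : pt3 R -> pt3 R) (L : R).
Hypotheses (mD : measurable D) (mT : measurable_fun setT T) (L0 : 0 <= L).
Hypothesis TL : forall x y, D x -> D y -> `|x - y| <= L * `|T x - T y|.

(** The comparison on cells needs finite measures, so the target is exhausted by bounded sets. They
    are unions of cells of generation 0, hence a cell of any generation lies inside one of them or
    outside. *)
Let dbox (M : nat) : set (pt3 R) := [set x | [/\ `|dyad 0 x.1.1| <= M%:Z,
   `|dyad 0 x.1.2| <= M%:Z & `|dyad 0 x.2| <= M%:Z]].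

Let dboxP M n x y : dyad3 n x = dyad3 n y -> dbox M x -> dbox M y.
Proof. by move=> /(dyad3_le (leq0n n)) [h1 h2 h3]; rewrite /dbox /= h1 h2 h3. Qed.

Let mdbox M : measurable (dbox M).
Proof. by apply: measurable_dyadic_set; exists 0%N; exact: dboxP. Qed.

Let dbox_norm M x : dbox M x -> `|x| <= M.+1%:R.
Proof.
have E (t : R) : `|dyad 0 t| <= M%:Z -> `|t| <= M.+1%:R.
  rewrite /dyad expr0 mul1r; have /andP[] := floor_itv t.
  rewrite ler_norml => a b /andP[c e].
  have c' : - M%:R <= (Num.floor t)%:~R :> R.
    by rewrite -[X in - X]/((M%:Z)%:~R) -mulrNz ler_int.
  have e' : (Num.floor t)%:~R <= M%:R :> R by rewrite -[leRHS]/((M%:Z)%:~R) ler_int.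
  rewrite intrD in b; rewrite -natr1.
  rewrite ler_norml; apply/andP; split; lra.
by move=> [h1 h2 h3]; rewrite !prod_normE !ge_max !E.
Qed.

Let bigcup_dbox : \bigcup_M dbox M = setT.
Proof.
apply/seteqP; split => // x _.
exists (`|dyad 0 x.1.1| + `|dyad 0 x.1.2| + `|dyad 0 x.2|)%N => //.
by split; rewrite -abszE lez_nat ?leq_addl//; [rewrite -addnA leq_addr|rewrite addnAC leq_addl].
Qed.

Let DM M := D `&` T @^-1` (dbox M).

Let mDM M : measurable (DM M).
Proof. by apply: measurableI => //; rewrite -[X in measurable X]setTI; exact: mT. Qed.

Let pull_le M B : measurable B ->
  (@leb3 R (DM M `&` T @^-1` B) <= ((2 * L) ^+ 3)%:E * @leb3 R B)%E.
Proof.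
move=> mB; have L30 : 0 <= (2 * L) ^+ 3 by rewrite exprn_ge0// mulr_ge0.
apply: (@le_trans _ _ (((2 * L) ^+ 3)%:E * @leb3 R (B `&` dbox M))%E); last first.
  apply: lee_wpmul2l => //; apply: leb3_le; last exact: subIsetl.
    exact: (measurableI _ _ mB (mdbox M)).
  exact: mB.
have [nu nuE] := @exists_pushforward_restr _ _ (pt3 (measurableTypeR R))
  (pt3 (measurableTypeR R)) R (@leb3 R) _ T (mDM M) mT.
have [mu muE] := @exists_scale_restr _ (pt3 (measurableTypeR R)) R (@leb3 R)
  _ _ (mdbox M) L30.
rewrite -muE (setIC (DM M)) -[leLHS]nuE; apply: le_measure_dyadic => //.
- rewrite nuE preimage_setT setTI.
  have [->|/set0P[x0 [Dx0 Tx0]]] := eqVneq (DM M) set0; first by rewrite measure0.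
  apply: (@le_lt_trans _ _ (@leb3 R (cube x0 (L * (2 * M.+1%:R))))).
    apply: leb3_le => //; first exact: measurable_cube.
    move=> y [Dy Ty]; apply/cubeP; rewrite (le_trans (TL Dy Dx0))// ler_wpM2l//.
    rewrite (le_trans (ler_normB _ _))//.
    by have := dbox_norm Tx0; have := dbox_norm Ty; lra.
  by rewrite leb3_cube ?ltry// !mulr_ge0.
- rewrite muE setTI lte_mul_pinfty//.
  apply: (@le_lt_trans _ _ (@leb3 R (cube 0 M.+1%:R))).
    apply: leb3_le => //; first exact: measurable_cube.
    by move=> y /dbox_norm yM; apply/cubeP; rewrite subr0.
  by rewrite leb3_cube ?ltry.
- move=> n x; pose c : set (pt3 R) := @dyad3 R n @^-1` [set @dyad3 R n x]; rewrite -/c nuE muE.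
  have mc : measurable c by exact: measurable_dyad3.
  have [->|/set0P[x0 [cx0 [Dx0 Tx0]]]] := eqVneq (T @^-1` c `&` DM M) set0.
    by rewrite measure0 mule_ge0.
  have -> : c `&` dbox M = c.
    apply/seteqP; split => [y []//|y cy]; split => //.
    exact: (dboxP (etrans cx0 (esym cy)) Tx0).
  rewrite [X in (_ <= _ * X)%E](_ : _ = ((2 ^+ n)^-1 ^+ 3)%:E); last exact: leb3_dyad3.
  (* The preimage of a cell of side [2^-n] has diameter at most [L 2^-n]. The cube around it is
     centred at one of its points, so this bound is its half-side: this is the origin of the factor
     2 in [(2 L)^3]. *)
  apply: (@le_trans _ _ (@leb3 R (cube x0 (L * (2 ^+ n)^-1)))).
    apply: leb3_le.
    + by apply: measurableI => //; rewrite -[X in measurable X]setTI; exact: mT.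
    + exact: measurable_cube.
    + move=> y [cy [Dy _]]; apply/cubeP; rewrite (le_trans (TL Dy Dx0))// ler_wpM2l//.
      exact: dyad3_dist (etrans cy (esym cx0)).
  rewrite leb3_cube ?mulr_ge0// ?invr_ge0 ?exprn_ge0//.
  by rewrite -EFinM lee_fin -exprMn mulrA.
Qed.

(* Replaces the change of variables formula: an expanding map increases volumes up to
   a constant, because the part of [D] mapped into a cell lies in a comparable cube. *)
Lemma leb3_lipschitz_pullback B : measurable B ->
  (@leb3 R (D `&` T @^-1` B) <= ((2 * L) ^+ 3)%:E * @leb3 R B)%E.
Proof.
move=> mB.
have mTB : measurable (T @^-1` B) by rewrite -[X in measurable X]setTI; exact: mT.
have E : \bigcup_M (DM M `&` T @^-1` B) = D `&` T @^-1` B.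
  rewrite -setI_bigcupl /DM -setI_bigcupr -preimage_bigcup bigcup_dbox.
  by rewrite preimage_setT setIT.
have mF i : measurable (DM i `&` T @^-1` B) by exact: measurableI.
have := @nondecreasing_cvg_mu _ _ _ (@leb3 R) (fun M => DM M `&` T @^-1` B) mF.
rewrite E => /(_ (measurableI _ _ mD mTB)) cvgM.
have {}cvgM : (fun M => @leb3 R (DM M `&` T @^-1` B)) x @[x --> \oo] --> @leb3 R (D `&` T @^-1` B).
  apply: cvgM => n m nm; apply/subsetPset => x [[Dx [h1 h2 h3]] Bx]; split => //.
  by split => //; split; apply: (le_trans _ (_ : n%:Z <= m%:Z)) => //.
rewrite -(cvg_lim _ cvgM)//; apply: lime_le; first by apply/cvg_ex; eexists; exact: cvgM.
by near=> n; exact: pull_le.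
Unshelve. all: by end_near. Qed.

Lemma ge0_integral_lipschitz3 (f : pt3 R -> \bar R) : measurable_fun setT f ->
  (forall x, (0 <= f x)%E) ->
  (\int[@leb3 R]_(x in D) f (T x) <= ((2 * L) ^+ 3)%:E * \int[@leb3 R]_x f x)%E.
Proof.
move=> mf f0; apply: ge0_integral_dominated => //.
- by rewrite exprn_ge0// mulr_ge0.
- exact: leb3_lipschitz_pullback.
Qed.

End lipschitz_pullback.

Section lipschitz_pullback2.
Context (R : realType).
Variables (D : set (pt2 R)) (T : pt2 R -> pt2 R) (L : R).
Hypotheses (mD : measurable D) (mT : measurable_fun setT T) (L1 : 1 <= L).
Hypothesis TL : forall x y, D x -> D y -> `|x - y| <= L * `|T x - T y|.

(** The statement in dimension three is applied to [T] times the identity on [D] times [[0, 1]]. The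
    identity factor obeys the same bound because [1 <= L], and the exponent 3 is inherited from
    there. *)
Lemma leb2_lipschitz_pullback B : measurable B ->
  (@leb2 R (D `&` T @^-1` B) <= ((2 * L) ^+ 3)%:E * @leb2 R B)%E.
Proof.
move=> mB; have mTB : measurable (T @^-1` B) by rewrite -[X in measurable X]setTI; exact: mT.
have l01 : lebesgue_measure (`[0, 1]%classic : set R) = 1%E.
  by rewrite lebesgue_measure_itv/= lte_fin ltr01 oppr0 adde0.
have mI : measurable (`[0, 1]%classic : set R) by [].
rewrite -[X in (X <= _)%E]mule1 -[X in (_ <= _ * X)%E]mule1 -l01.
rewrite -leb3X//; last exact: measurableI.
rewrite -leb3X//.
pose T3 (x : pt3 R) : pt3 R := (T x.1, x.2).
have mT3 : measurable_fun setT T3.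
  by apply: measurable_fun_pair => //; exact: measurableT_comp.
have L0 : 0 <= L by rewrite (le_trans _ L1).
have E : (D `&` T @^-1` B) `*` `[0, 1]%classic =
    (D `*` `[0, 1]%classic) `&` T3 @^-1` (B `*` `[0, 1]%classic).
  by apply/seteqP; split => x /=; [move=> [[? ?] ?]|move=> [[? ?] [? ?]]].
have TL3 x y : (D `*` `[0, 1]%classic) x -> (D `*` `[0, 1]%classic) y ->
    `|x - y| <= L * `|T3 x - T3 y|.
  move=> [Dx _] [Dy _]; rewrite prod_normE [X in L * X]prod_normE /= ge_max.
  apply/andP; split.
    by rewrite (le_trans (TL Dx Dy))// ler_wpM2l// le_max lexx.
  by rewrite -[leLHS]mul1r ler_pM// le_max lexx orbT.
rewrite E.
exact: (@leb3_lipschitz_pullback R _ T3 L (measurableX mD mI) mT3 L0 TL3 _ (measurableX mB mI)).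
Qed.

Lemma ge0_integral_lipschitz2 (f : pt2 R -> \bar R) : measurable_fun setT f ->
  (forall x, (0 <= f x)%E) ->
  (\int[@leb2 R]_(x in D) f (T x) <= ((2 * L) ^+ 3)%:E * \int[@leb2 R]_x f x)%E.
Proof.
move=> mf f0; apply: ge0_integral_dominated => //.
- by rewrite exprn_ge0// mulr_ge0// (le_trans _ L1).
- exact: leb2_lipschitz_pullback.
Qed.

Lemma negligible_lipschitz2 N : (@leb2 R).-negligible N ->
  (@leb2 R).-negligible (D `&` T @^-1` N).
Proof.
move=> [B [mB B0 NB]]; exists (D `&` T @^-1` B); split.
- by apply: measurableI => //; rewrite -[X in measurable X]setTI; exact: mT.
- apply/eqP; rewrite eq_le measure_ge0 andbT.
  by rewrite (le_trans (leb2_lipschitz_pullback mB))// B0 mule0.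
- by move=> x [Dx Tx]; split => //; exact: NB.
Qed.

End lipschitz_pullback2.

Section translation.
Context (R : realType).

Lemma lebesgue_measure_translate (a : R) (A : set R) : measurable A ->
  lebesgue_measure ((+%R^~ a) @^-1` A) = lebesgue_measure A.
Proof.
move=> mA.
have mt : measurable_fun setT (+%R^~ a : R -> R) by exact: measurable_funD.
have [m mE] := @exists_pushforward_restr _ _ (measurableTypeR R)
  (measurableTypeR R) R (@lebesgue_measure R) setT _ measurableT mt.
have {}mE S : m S = lebesgue_measure ((+%R^~ a) @^-1` S) by rewrite mE setIT.
rewrite -mE; apply/esym/lebesgue_measure_unique => //.
move=> X [[x y] xy <-]; rewrite [RHS]mE.
rewrite (_ : _ @^-1` _ = `]x - a, y - a]%classic).
  by rewrite !lebesgue_measure_itv/= !lte_fin ltrD2r; case: ifP => // _;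
    rewrite -!EFinD; congr (_%:E); ring.
by apply/seteqP; split => z /=; rewrite !in_itv/= ltrBlDr lerBrDr.
Qed.

Lemma leb2_translate (a : pt2 R) (A : set (pt2 R)) : measurable A ->
  @leb2 R ((+%R^~ a) @^-1` A) = @leb2 R A.
Proof.
move=> mA.
have mt : measurable_fun setT (+%R^~ a : pt2 R -> pt2 R).
  by apply: measurable_fun_pair; apply: measurable_funD => //.
have [m mE] := @exists_pushforward_restr _ _ (pt2 (measurableTypeR R))
  (pt2 (measurableTypeR R)) R (@leb2 R) setT _ measurableT mt.
have {}mE S : m S = @leb2 R ((+%R^~ a) @^-1` S) by rewrite mE setIT.
rewrite -mE; apply/esym.
apply: (@product_measure_unique _ _ _ _ _ (@lebesgue_measure R) (@lebesgue_measure R) m) => //.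
move=> X Y mX mY; rewrite [LHS]mE.
rewrite (_ : _ @^-1` _ = (+%R^~ a.1 @^-1` X) `*` (+%R^~ a.2 @^-1` Y))//.
rewrite leb2X ?lebesgue_measure_translate//.
- by rewrite -[X in measurable X]setTI; apply: measurable_funD.
- by rewrite -[X in measurable X]setTI; apply: measurable_funD.
Qed.

Lemma leb3_translate (a : pt3 R) (A : set (pt3 R)) : measurable A ->
  @leb3 R ((+%R^~ a) @^-1` A) = @leb3 R A.
Proof.
move=> mA.
have mt2 b : measurable_fun setT (+%R^~ b : pt2 R -> pt2 R).
  by apply: measurable_fun_pair; apply: measurable_funD => //.
have mt : measurable_fun setT (+%R^~ a : pt3 R -> pt3 R).
  apply: measurable_fun_pair; last by apply: measurable_funD.
  exact: (measurableT_comp (mt2 a.1)).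
have [m mE] := @exists_pushforward_restr _ _ (pt3 (measurableTypeR R))
  (pt3 (measurableTypeR R)) R (@leb3 R) setT _ measurableT mt.
have {}mE S : m S = @leb3 R ((+%R^~ a) @^-1` S) by rewrite mE setIT.
rewrite -mE; apply/esym.
apply: (@product_measure_unique _ _ _ _ _ (@leb2 R) (@lebesgue_measure R) m) => //.
move=> X Y mX mY; rewrite [LHS]mE.
rewrite (_ : _ @^-1` _ = (+%R^~ a.1 @^-1` X) `*` (+%R^~ a.2 @^-1` Y))//.
rewrite leb3X ?lebesgue_measure_translate ?leb2_translate//.
- by rewrite -[X in measurable X]setTI; exact: mt2.
- by rewrite -[X in measurable X]setTI; apply: measurable_funD.
Qed.

End translation.

(** * Square integrable functions *)

Section ereal_cvg0.
Context (R : realType).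
Implicit Types (a b : nat -> \bar R).

Lemma ge0_cvge0P a : (forall n, 0 <= a n)%E ->
  (a @ \oo --> 0%E) <-> (forall e : R, 0 < e -> \forall n \near \oo, (a n < e%:E)%E).
Proof.
move=> a0; split.
  move=> /fine_cvgP[fin /cvgrPdist_lt a_ e e0]; near=> n.
  have fn : a n \is a fin_num by near: n.
  rewrite -(fineK fn) lte_fin (le_lt_trans (ler_norm _))//.
  by rewrite -normrN -sub0r; near: n; exact: a_.
move=> H; apply/fine_cvgP; split.
  have := H _ ltr01; apply: filterS => n an.
  by rewrite ge0_fin_numE// (lt_trans an)// ltry.
apply/cvgrPdist_lt => e e0; have := H _ e0; apply: filterS => n an /=.
rewrite sub0r normrN ger0_norm ?fine_ge0//.
by rewrite -lte_fin fineK// ge0_fin_numE// (lt_trans an)// ltry.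
Unshelve. all: by end_near. Qed.

Lemma ge0_cvge0_le a b (c : R) : (forall n, 0 <= a n)%E ->
  (forall n, (a n <= c%:E * b n)%E) -> (b @ \oo --> 0%E) -> (a @ \oo --> 0%E).
Proof.
move=> a0 ab b0.
apply: (@squeeze_cvge _ _ _ _ (fun=> 0%E) a (fun n => c%:E * b n)%E).
- by apply: nearW => n; rewrite a0 ab.
- exact: cvg_cst.
- by rewrite -(mule0 c%:E); apply: cvgeZl.
Qed.

Lemma ge0_cvge0_leD a b b' (c : R) : (forall n, 0 <= a n)%E ->
  (forall n, (a n <= c%:E * b n + c%:E * b' n)%E) ->
  (b @ \oo --> 0%E) -> (b' @ \oo --> 0%E) -> (a @ \oo --> 0%E).
Proof.
move=> a0 ab b0 b'0.
apply: (@squeeze_cvge _ _ _ _ (fun=> 0%E) a (fun n => c%:E * b n + c%:E * b' n)%E).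
- by apply: nearW => n; rewrite a0 ab.
- exact: cvg_cst.
- have cz (u : nat -> \bar R) : u @ \oo --> 0%E -> (fun n => c%:E * u n)%E @ \oo --> 0%E.
    by move=> u0; rewrite -(mule0 c%:E); apply: cvgeZl.
  by rewrite -(adde0 0%E); apply: cvgeD => //; exact: cz.
Qed.

Lemma poweR2_lt (x : \bar R) (e : R) : (0 <= x)%E -> 0 < e ->
  (x `^ 2 < (e ^+ 2)%:E)%E = (x < e%:E)%E.
Proof.
case: x => [x| |]//= x0 e0.
  by rewrite -powR_mulrn ?ltW// !lte_fin !powR_mulrn ?(ltW e0)// ltr_pXn2r// ?nnegrE// ltW.
by rewrite gt_eqF ?ltr0n// !ltNge !leey.
Qed.

End ereal_cvg0.

Section L2_facts.
Context d (T : measurableType d) (R : realType) (mu : {measure set T -> \bar R}).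
Implicit Types (D : set T) (f g h : T -> R).

(* The squared norm is easier to manipulate than the norm: sums and products are
   bounded by [2 |ab| <= a^2 + b^2], without the inequalities of Hoelder and Minkowski. *)
Definition L2sq D f : \bar R := (\int[mu]_(x in D) (f x ^+ 2)%:E)%E.

Lemma L2sq_ge0 D f : (0 <= L2sq D f)%E.
Proof. by apply: integral_ge0 => x _; rewrite lee_fin sqr_ge0. Qed.

Lemma L2norm_ge0 D f : (0 <= L2norm mu D f)%E.
Proof. exact: Lnorm_ge0. Qed.

Lemma L2norm_sq D f : (L2norm mu D f `^ 2 = L2sq D f)%E.
Proof.
rewrite /L2norm powR_Lnorm// /L2sq [RHS]integral_mkcond; apply: eq_integral => x _.
rewrite /= /patch; case: ifPn => _; last by rewrite normr0 powR0.
by rewrite powR_mulrn// real_normK// num_real.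
Qed.

Lemma L2norm_cvg0 D (f : nat -> T -> R) :
  ((fun n => L2norm mu D (f n)) @ \oo --> 0%E) <->
  ((fun n => L2sq D (f n)) @ \oo --> 0%E).
Proof.
split=> /ge0_cvge0P H; apply/ge0_cvge0P.
- by move=> n; exact: L2sq_ge0.
- move=> e e0; have se0 : 0 < Num.sqrt e by rewrite sqrtr_gt0.
  have := H (fun=> L2norm_ge0 _ _) _ se0; apply: filterS => n.
  by rewrite -poweR2_lt ?L2norm_ge0// L2norm_sq sqr_sqrtr// ltW.
- by move=> n; exact: L2norm_ge0.
- move=> e e0; have := H (fun=> L2sq_ge0 _ _) _ (exprn_gt0 2 e0); apply: filterS => n.
  by rewrite -L2norm_sq poweR2_lt ?L2norm_ge0.
Qed.

Lemma L2P D f : measurable D ->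
  L2 mu D f <-> measurable_fun D f /\ (L2sq D f < +oo)%E.
Proof.
move=> mD; rewrite /L2; split.
  rewrite inE => /andP[]; rewrite !inE/= => mf; rewrite /finite_norm => fin.
  split; first exact: (proj2 (measurable_restrictT f mD) mf).
  by rewrite -L2norm_sq poweR_lty.
move=> [mf fin]; rewrite inE; apply/andP; split; rewrite inE/=.
  exact: (proj1 (measurable_restrictT f mD) mf).
rewrite /finite_norm; apply: (@lty_poweRy _ _ 2) => //.
by rewrite -[X in (X < _)%E]/(L2norm mu D f `^ 2)%E L2norm_sq.
Qed.

Lemma L2_measurable D f : measurable D -> L2 mu D f -> measurable_fun D f.
Proof. by move=> mD /(L2P _ mD)[]. Qed.

Lemma L2_lty D f : measurable D -> L2 mu D f -> (L2sq D f < +oo)%E.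
Proof. by move=> mD /(L2P _ mD)[]. Qed.

Lemma measurable_sqr D f : measurable_fun D f ->
  measurable_fun D (fun x => (f x ^+ 2)%:E).
Proof. by move=> mf; apply/measurable_EFinP; exact: measurable_funX. Qed.

Lemma L2sq_lec D f g (c : R) : measurable D -> 0 <= c -> measurable_fun D f ->
  measurable_fun D g -> (forall x, D x -> f x ^+ 2 <= c * g x ^+ 2) ->
  (L2sq D f <= c%:E * L2sq D g)%E.
Proof.
move=> mD c0 mf mg fg; rewrite /L2sq -ge0_integralZl_EFin//.
- apply: ge0_le_integral => //.
  + by move=> x _; rewrite lee_fin sqr_ge0.
  + exact: measurable_sqr.
  + by apply/measurable_EFinP; apply: measurable_funM => //; exact: measurable_funX.
- by move=> x _; rewrite lee_fin sqr_ge0.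
- exact: measurable_sqr.
Qed.

Lemma L2sq_leD D f g h : measurable D -> measurable_fun D f ->
  measurable_fun D g -> measurable_fun D h ->
  (forall x, D x -> f x ^+ 2 <= 2 * g x ^+ 2 + 2 * h x ^+ 2) ->
  (L2sq D f <= 2%:E * L2sq D g + 2%:E * L2sq D h)%E.
Proof.
move=> mD mf mg mh fgh; rewrite /L2sq.
rewrite -!ge0_integralZl_EFin//; try by
  [move=> x _; rewrite lee_fin sqr_ge0 | exact: measurable_sqr].
rewrite -ge0_integralD//; last 4 first.
- by move=> x _; rewrite -EFinM lee_fin mulr_ge0// sqr_ge0.
- by apply/measurable_EFinP; apply: measurable_funM => //; exact: measurable_funX.
- by move=> x _; rewrite -EFinM lee_fin mulr_ge0// sqr_ge0.
- by apply/measurable_EFinP; apply: measurable_funM => //; exact: measurable_funX.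
apply: ge0_le_integral => //.
- by move=> x _; rewrite lee_fin sqr_ge0.
- exact: measurable_sqr.
- by apply/measurable_EFinP; apply: measurable_funD => //; apply: measurable_funM => //; exact: measurable_funX.
Qed.

Lemma L2D D f g : measurable D -> L2 mu D f -> L2 mu D g -> L2 mu D (f \+ g).
Proof.
move=> mD /(L2P _ mD)[mf ff] /(L2P _ mD)[mg gg]; apply/(L2P _ mD).
have mfg : measurable_fun D (f \+ g) by exact: measurable_funD.
split => //; apply: (le_lt_trans (L2sq_leD mD mfg mf mg _)).
  by move=> x _ /=; have := sqr_ge0 (f x - g x); nra.
by rewrite lte_add_pinfty// lte_mul_pinfty.
Qed.

Lemma L2Z D f (c : R) : measurable D -> L2 mu D f -> L2 mu D (fun x => c * f x).
Proof.
move=> mD /(L2P _ mD)[mf ff]; apply/(L2P _ mD).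
have mfg : measurable_fun D (fun x => c * f x) by exact: measurable_funM.
split => //; apply: (le_lt_trans (L2sq_lec mD (sqr_ge0 c) mfg mf _)).
  by move=> x _ /=; rewrite exprMn.
by rewrite lte_mul_pinfty// lee_fin sqr_ge0.
Qed.

Lemma L2B D f g : measurable D -> L2 mu D f -> L2 mu D g -> L2 mu D (f \- g).
Proof.
move=> mD Lf Lg.
rewrite (_ : f \- g = f \+ (fun x => -1 * g x)).
  exact: L2D (L2Z _ _ _).
by apply/funext => x /=; rewrite mulN1r.
Qed.

Lemma L2S D E f : measurable D -> measurable E -> E `<=` D ->
  L2 mu D f -> L2 mu E f.
Proof.
move=> mD mE ED /(L2P _ mD)[mf ff]; apply/(L2P _ mE); split.
  exact: (measurable_funS mD ED mf).
apply: le_lt_trans ff; apply: ge0_subset_integral => //.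
- exact: measurable_sqr.
- by move=> x _; rewrite lee_fin sqr_ge0.
Qed.

Lemma L2sqS D E f : measurable D -> measurable E -> E `<=` D ->
  measurable_fun D f -> (L2sq E f <= L2sq D f)%E.
Proof.
move=> mD mE ED mf; apply: ge0_subset_integral => //.
- exact: measurable_sqr.
- by move=> x _; rewrite lee_fin sqr_ge0.
Qed.

Lemma L2_bounded D f (M : R) : measurable D -> (mu D < +oo)%E ->
  measurable_fun D f -> (forall x, D x -> `|f x| <= M) -> L2 mu D f.
Proof.
move=> mD muD mf fM; apply/(L2P _ mD); split => //.
have [M0|M0] := leP 0 M; last first.
  rewrite /L2sq (_ : D = set0) ?integral_set0//.
  by rewrite -subset0 => x /fM; rewrite leNgt (lt_le_trans M0).
apply: (@le_lt_trans _ _ (\int[mu]_(x in D) (M ^+ 2)%:E)%E); last first.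
  by rewrite integral_cst// lte_mul_pinfty// lee_fin sqr_ge0.
apply: ge0_le_integral => //.
- by move=> x _; rewrite lee_fin sqr_ge0.
- exact: measurable_sqr.
- move=> x /fM; rewrite lee_fin => h.
  by rewrite -[leLHS]real_normK ?num_real// lerXn2r// nnegrE.
Qed.

Lemma L2M_integrable D f g : measurable D -> L2 mu D f -> L2 mu D g ->
  mu.-integrable D (EFin \o (fun x => f x * g x)).
Proof.
move=> mD /(L2P _ mD)[mf ff] /(L2P _ mD)[mg gg].
have i2 h : measurable_fun D h -> (L2sq D h < +oo)%E ->
    mu.-integrable D (EFin \o (fun x => h x ^+ 2)).
  move=> mh hh; apply/integrableP; split; first exact: measurable_sqr.
  apply: le_lt_trans hh; rewrite /L2sq le_eqVlt; apply/predU1P; left.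
  by apply: eq_integral => x _ /=; rewrite ger0_norm ?sqr_ge0.
apply: (@le_integrable _ _ _ mu D mD _ (fun x => ((f x ^+ 2)%:E + (g x ^+ 2)%:E)%E)).
- by apply/measurable_EFinP; exact: measurable_funM.
- move=> x Dx /=; rewrite lee_fin [leRHS]ger0_norm ?addr_ge0 ?sqr_ge0// normrM.
  have := sqr_ge0 (`|f x| - `|g x|); rewrite sqrrB !real_normK ?num_real//.
  by have := mulr_ge0 (normr_ge0 (f x)) (normr_ge0 (g x)); lra.
- by apply: integrableD => //; exact: i2.
Qed.

Lemma L2_bounded_integrable D f g (M : R) : measurable D -> L2 mu D f ->
  measurable_fun D g -> (forall x, D x -> `|g x| <= M) ->
  L2 mu D (fun x => f x * g x).
Proof.
move=> mD /(L2P _ mD)[mf ff] mg gM; apply/(L2P _ mD).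
have mfg : measurable_fun D (fun x => f x * g x) by exact: measurable_funM.
split => //; apply: (le_lt_trans (L2sq_lec mD (sqr_ge0 M) mfg mf _)).
  move=> x Dx /=; rewrite exprMn mulrC ler_wpM2r ?sqr_ge0//.
  rewrite -real_normK ?num_real// -[leRHS]real_normK ?num_real//.
  by rewrite lerXn2r ?nnegrE// (le_trans (gM _ Dx))// ler_norm.
by rewrite lte_mul_pinfty// lee_fin sqr_ge0.
Qed.

Lemma L2_integrable D f : measurable D -> (mu D < +oo)%E -> L2 mu D f ->
  mu.-integrable D (EFin \o f).
Proof.
move=> mD muD Lf.
have L1 : L2 mu D (cst 1) by apply: (L2_bounded (M := 1)) => // x _; rewrite normr1.
rewrite (_ : EFin \o f = EFin \o (fun x => f x * cst 1 x)).
  exact: L2M_integrable.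
by apply/funext => x /=; rewrite mulr1.
Qed.

(** Cauchy-Schwarz is replaced by [|f| <= c / 2 + f^2 / (2 c)]. With [c = e / (2 m)] and [m] the
    measure of [D] plus 1, the constant part integrates to at most [e / 4], and the other part to
    less than [e / 2] once the squared norm is below [c e]. Adding 1 keeps [m] positive on null
    sets. *)
Lemma L2_cvg_L1 D (f : nat -> T -> R) : measurable D -> (mu D < +oo)%E ->
  (forall n, measurable_fun D (f n)) ->
  ((fun n => L2sq D (f n)) @ \oo --> 0%E) ->
  ((fun n => \int[mu]_(x in D) `|f n x|%:E)%E @ \oo --> 0%E).
Proof.
move=> mD muD mf f0.
have i0 n : (0 <= \int[mu]_(x in D) `|f n x|%:E)%E.
  by apply: integral_ge0 => x _; rewrite lee_fin.
apply/ge0_cvge0P => // e e0.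
have fD : mu D \is a fin_num by rewrite ge0_fin_numE.
pose m := fine (mu D) + 1; have m0 : 0 < m by rewrite ltr_wpDl// fine_ge0.
pose c := e / m / 2; have c0 : 0 < c by rewrite !divr_gt0.
have /ge0_cvge0P := f0; move=> /(_ (fun n => L2sq_ge0 D (f n)) _ (mulr_gt0 c0 e0)).
apply: filterS => n fn.
have cV : 0 <= c^-1 by rewrite invr_ge0 ltW.
apply: (@le_lt_trans _ _ (\int[mu]_(x in D) ((c / 2)%:E + (c^-1 / 2 * f n x ^+ 2)%:E))%E).
  apply: ge0_le_integral => //.
  - by apply/measurable_EFinP; exact: measurableT_comp.
  - by apply/measurable_EFinP; apply: measurable_funD => //;
      apply: measurable_funM => //; exact: measurable_funX.
  - move=> x _; rewrite lee_fin -[f n x ^+ 2]real_normK ?num_real//.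
    have : 0 <= (c - `|f n x|) ^+ 2 / c by rewrite mulr_ge0// sqr_ge0.
    have -> : (c - `|f n x|) ^+ 2 / c = c - 2 * `|f n x| + c^-1 * `|f n x| ^+ 2.
      by field; rewrite gt_eqF.
    lra.
rewrite ge0_integralD//; last 3 first.
- by move=> x _; rewrite lee_fin divr_ge0// ltW.
- by move=> x _; rewrite lee_fin mulr_ge0 ?sqr_ge0// divr_ge0.
- by apply/measurable_EFinP; apply: measurable_funM => //; exact: measurable_funX.
rewrite integral_cst//.
have -> : (\int[mu]_(x in D) (c^-1 / 2 * f n x ^+ 2)%:E = (c^-1 / 2)%:E * L2sq D (f n))%E.
  rewrite /L2sq -ge0_integralZl_EFin//.
  - by move=> x _; rewrite lee_fin sqr_ge0.
  - exact: measurable_sqr.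
  - by rewrite divr_ge0.
have Lfin : L2sq D (f n) \is a fin_num.
  by rewrite ge0_fin_numE ?L2sq_ge0// (lt_trans fn)// ltry.
rewrite -(fineK Lfin) -(fineK fD) -!EFinM -EFinD lte_fin.
have {fn} : fine (L2sq D (f n)) < c * e by rewrite -lte_fin fineK.
have : fine (mu D) < m by rewrite ltrDl.
move: (fine (mu D)) (fine (L2sq D (f n))) => s t sm tc.
have h1 : c / 2 * s <= e / 4.
  have -> : e / 4 = c / 2 * m by rewrite /c; field; rewrite gt_eqF.
  by rewrite ler_wpM2l ?divr_ge0 ?ltW.
have h2 : c^-1 / 2 * t < e / 2.
  have -> : e / 2 = c^-1 / 2 * (c * e) by field; rewrite gt_eqF.
  by rewrite ltr_pM2l// divr_gt0// invr_gt0.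
lra.
Qed.

End L2_facts.

(** * Smooth functions and test functions *)

Section smooth_line.
Context (R : realType).
Implicit Types (f g : R -> R).

(** The derivative of highest order need not be continuous; this is harmless in [smooth1], where all
    orders are required. *)
Fixpoint C1n (n : nat) f : Prop :=
  if n is n'.+1 then
    exists2 f', (forall x : R, is_derive x 1 f (f' x)) & C1n n' f'
  else True.

Definition smooth1 f := forall n, C1n n f.

Lemma C1nW n f : C1n n.+1 f -> C1n n f.
Proof.
by elim: n f => [//|n IH] f [f' ff' /IH Cf']; exists f'.
Qed.

Lemma C1nD n f g : C1n n f -> C1n n g -> C1n n (fun x => f x + g x).
Proof.
elim: n f g => [//|n IH] f g [f' ff' Cf'] [g' gg' Cg'].
exists (fun x => f' x + g' x); last exact: IH.
by move=> x; exact: is_deriveD.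
Qed.

Lemma C1nM n f g : C1n n f -> C1n n g -> C1n n (fun x => f x * g x).
Proof.
elim: n f g => [//|n IH] f g /[dup] /C1nW Cf [f' ff' Cf'] /[dup] /C1nW Cg [g' gg' Cg'].
exists (fun x => f x * g' x + g x * f' x); last by apply: C1nD; exact: IH.
by move=> x; exact: is_deriveM.
Qed.

Lemma C1n_cst n (c : R) : C1n n (fun=> c).
Proof.
elim: n c => [//|n IH] c; exists (fun=> 0) => // x.
exact: is_derive_cst.
Qed.

Lemma C1nZ n f (c : R) : C1n n f -> C1n n (fun x => c * f x).
Proof. by move=> Cf; apply: C1nM => //; exact: C1n_cst. Qed.

Lemma is_derive_affine (a b x : R) : is_derive x 1 (fun t => a * t + b) a.
Proof.
have h1 : is_derive x 1 (fun t : R => a * t) a.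
  rewrite -[X in is_derive _ _ _ X]mulr1.
  exact: (@is_deriveZ _ _ _ id a x 1 1 (is_derive_id _ _)).
rewrite -[X in is_derive _ _ _ X]addr0.
exact: (is_deriveD h1 (is_derive_cst _ _ _)).
Qed.

Lemma C1n_affine n f (a b : R) : C1n n f -> C1n n (fun t => f (a * t + b)).
Proof.
elim: n f => [//|n IH] f [f' ff' Cf'].
exists (fun t => a * f' (a * t + b)); last by apply: C1nZ; exact: IH.
move=> x; rewrite mulrC.
exact: (@is_derive1_comp _ f (fun t => a * t + b) x _ _ (ff' _) (is_derive_affine _ _ _)).
Qed.

Lemma smooth1_antiderivative f f' : (forall x : R, is_derive x 1 f (f' x)) -> smooth1 f' ->
  smooth1 f.
Proof. by move=> ff' sf' [//|n]; exists f'. Qed.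

Lemma is_derive_continuous f f' : (forall x : R, is_derive x 1 f (f' x)) -> continuous f.
Proof.
by move=> ff' x; apply: differentiable_continuous; apply/derivable1_diffP; have [] := ff' x.
Qed.

Lemma smooth1_continuous f : smooth1 f -> continuous f.
Proof. by move=> /(_ 1%N)[f' + _]; exact: is_derive_continuous. Qed.

End smooth_line.

Section bump.
Context (R : realType).

(* These functions are closed under derivation up to linear combinations, which gives
   the smoothness of [exp (-1/t)] at [0]. *)
Definition flat_exp (k : nat) (t : R) : R :=
  if 0 < t then t^-1 ^+ k * expR (- t^-1) else 0.

(** This is [expR s >= s^(k+1) / (k+1)!] at [s = 1 / t]. The linear bound makes the difference
    quotient at 0 vanish in [is_derive_flat_exp]. *)
Lemma flat_exp_le (k : nat) (t : R) : `|flat_exp k t| <= (k.+1)`!%:R * `|t|.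
Proof.
rewrite /flat_exp; case: ifPn => [t0|_]; last by rewrite normr0 mulr_ge0.
have tV : 0 < t^-1 by rewrite invr_gt0.
rewrite ger0_norm ?mulr_ge0 ?expR_ge0 ?exprn_ge0 ?(ltW tV)// gtr0_norm//.
rewrite expRN ler_pdivrMr ?expR_gt0//.
have := @expR_ge1Dxn R t^-1 k (ltW tV).
have kp : (0 : R) < (k.+1)`!%:R by rewrite ltr0n fact_gt0.
move=> h; have {}h : t^-1 ^+ k.+1 / (k.+1)`!%:R <= expR t^-1 by lra.
rewrite ler_pdivrMr// in h.
rewrite -mulrA [t * _]mulrC mulrA -ler_pdivrMr//.
by rewrite mulrC -exprS [leRHS]mulrC.
Qed.

Lemma flat_exp_le0 k t : t <= 0 -> flat_exp k t = 0.
Proof. by move=> t0; rewrite /flat_exp ltNge t0. Qed.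

Lemma flat_exp_gt0 k t : 0 < t -> flat_exp k t = t^-1 ^+ k * expR (- t^-1).
Proof. by move=> t0; rewrite /flat_exp t0. Qed.

Lemma is_derive_flat_exp (k : nat) (t : R) :
  is_derive t 1 (flat_exp k) (flat_exp k.+2 t - k%:R * flat_exp k.+1 t).
Proof.
have [t0|t0|->] := ltgtP t 0.
- rewrite !flat_exp_le0 ?(ltW t0)// mulr0 subr0.
  apply: (@near_eq_is_derive _ _ _ (cst 0)).
  by near=> s; rewrite flat_exp_le0//; apply: ltW; near: s; exact: lt_nbhsl.
- rewrite !(flat_exp_gt0 _ t0).
  suff D : is_derive t 1 (fun s => s^-1 ^+ k * expR (- s^-1))
      (t^-1 ^+ k.+2 * expR (- t^-1) - k%:R * (t^-1 ^+ k.+1 * expR (- t^-1))).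
    apply: (near_eq_is_derive _ D).
    by near=> s; rewrite flat_exp_gt0//; near: s; exact: lt_nbhsr.
  have tn : t != 0 by rewrite gt_eqF.
  have dV : is_derive t 1 (fun s : R => s^-1) (- t ^- 2).
    rewrite -[X in is_derive _ _ _ X]mulr1.
    exact: (@is_deriveV _ id t 1 1 tn (is_derive_id _ _)).
  have dX : is_derive t 1 (fun s : R => s^-1 ^+ k) ((k%:R * t^-1 ^+ k.-1) *: (- t ^- 2)).
    rewrite (_ : (fun s : R => s^-1 ^+ k) = (fun s : R => s^-1) ^+ k).
      exact: (is_deriveX k dV).
    by apply/funext => s; rewrite exprfctE.
  have dE : is_derive t 1 (fun s : R => expR (- s^-1)) (expR (- t^-1) * t ^- 2).
    have dN : is_derive t 1 (fun s : R => - s^-1) (t ^- 2).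
      by rewrite -[X in is_derive _ _ _ X]opprK; exact: is_deriveN.
    exact: (@is_derive1_comp _ expR (fun s => - s^-1) t _ _ (is_derive_expR _) dN).
  have D := is_deriveM dX dE.
  rewrite [X in is_derive _ _ _ X](_ : _ = t^-1 ^+ k *: (expR (- t^-1) * t ^- 2) +
      expR (- t^-1) *: ((k%:R * t^-1 ^+ k.-1) *: (- t ^- 2))); first exact: D.
  rewrite /GRing.scale/= !exprS expr0 mulr1 invfM.
  case: k {dX D} => [|k] /=; first by rewrite !expr0 !mul0r !mulr0 addr0 subr0; ring.
  by rewrite !exprS; ring.
(* At 0, dividing by the increment only raises the index from [k] to [k.+1], and [flat_exp_le] sends
   the quotient to 0. *)
- rewrite (@flat_exp_le0 k.+2)// (@flat_exp_le0 k.+1)// mulr0 subr0.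
  have lim0 : h^-1 *: ((flat_exp k \o shift 0) (h *: (1 : R)) - flat_exp k 0) @[h --> 0^'] --> (0 : R).
    apply/cvgrPdist_le => e e0; near=> h => /=.
    rewrite /shift/= addr0 [_ *: 1]mulr1 (@flat_exp_le0 k 0)// subr0 sub0r normrN.
    have h0 : h != 0 by near: h; exact: nbhs_dnbhs_neq.
    have -> : h^-1 *: flat_exp k h = flat_exp k.+1 h.
      by rewrite /flat_exp; case: ifP => _; rewrite ?scaler0// exprS -mulrA.
    rewrite (le_trans (flat_exp_le _ _))// -ler_pdivlMl ?ltr0n ?fact_gt0//.
    near: h; apply: dnbhs0_le; by rewrite mulr_gt0 ?invr_gt0 ?ltr0n ?fact_gt0.
  by split; [apply/cvg_ex; exists 0|exact: cvg_lim].
Unshelve. all: by end_near. Qed.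

Lemma C1n_flat_exp n k : C1n n (flat_exp k).
Proof.
elim: n k => [//|n IH] k.
exists (fun t => flat_exp k.+2 t + - k%:R * flat_exp k.+1 t).
  by move=> x; rewrite mulNr; exact: is_derive_flat_exp.
by apply: C1nD => //; exact: C1nZ.
Qed.

Definition bump (t : R) : R := flat_exp 0 t * flat_exp 0 (1 - t).

Lemma smooth1_bump : smooth1 bump.
Proof.
move=> n; apply: C1nM; first exact: C1n_flat_exp.
have := @C1n_affine _ n (flat_exp 0) (-1) 1 (C1n_flat_exp n 0).
by congr C1n; apply/funext => t; rewrite mulN1r addrC.
Qed.

Lemma bump_ge0 t : 0 <= bump t.
Proof.
rewrite /bump /flat_exp !expr0 !mul1r.
by case: ifP => _; case: ifP => _; rewrite ?mulr0 ?mul0r// mulr_ge0// expR_ge0.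
Qed.

Lemma bump_gt0 t : 0 < t < 1 -> 0 < bump t.
Proof.
move=> /andP[t0 t1]; rewrite /bump /flat_exp subr_gt0 t0 t1 !expr0 !mul1r.
by rewrite mulr_gt0// expR_gt0.
Qed.

Lemma bump_le0 t : t <= 0 -> bump t = 0.
Proof. by move=> t0; rewrite /bump /flat_exp ltNge t0 mul0r. Qed.

Lemma bump_ge1 t : 1 <= t -> bump t = 0.
Proof. by move=> t0; rewrite /bump /flat_exp subr_gt0 (ltNge t) t0 mulr0. Qed.

End bump.

Section antiderivative.
Context (R : realType).
Variables (f : R -> R) (a : R).
Hypotheses (cf : continuous f) (f0 : forall x, x <= a -> f x = 0).

(** [f] vanishes up to [a], so the starting point is immaterial there; [a - 1] makes the fundamental
    theorem applicable at [x = a] as well. *)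
Definition antider (x : R) : R := \int[lebesgue_measure]_(t in `[a - 1, x]) f t.

Lemma antider_integrable x : lebesgue_measure.-integrable `[a - 1, x] (EFin \o f).
Proof.
apply: continuous_compact_integrable; first exact: segment_compact.
exact: continuous_subspaceT.
Qed.

Lemma antider_le x : x <= a -> antider x = 0.
Proof.
move=> xa; rewrite /antider /Rintegral (eq_integral (cst 0%E)) ?integral0//.
by move=> t; rewrite inE/= in_itv/= => /andP[_ tx]; rewrite f0// (le_trans tx).
Qed.

Lemma is_derive_antider (x : R) : is_derive x 1 antider (f x).
Proof.
have [xa|ax] := ltP x a.
  rewrite f0 ?ltW//; apply: (@near_eq_is_derive _ _ _ (cst 0)).
  near=> s; rewrite antider_le//; apply: ltW; near: s; exact: lt_nbhsl.
have cfx : {for x, continuous f} by exact: cf.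
have [] := @continuous_FTC1 R f (BLeft (a - 1)) x (x + 1) _ (antider_integrable _) _ cfx.
- by rewrite ltrDl.
- by rewrite lte_fin; lra.
by move=> df <-; rewrite derive1E; exact: derivableP.
Unshelve. all: by end_near. Qed.

Lemma antider_ge0 x : (forall t, 0 <= f t) -> 0 <= antider x.
Proof. by move=> fp; apply: Rintegral_ge0 => t _. Qed.

Lemma antider_cst b x : (forall t, b <= t -> f t = 0) -> b <= x -> antider x = antider b.
Proof.
move=> fb; rewrite le_eqVlt => /predU1P[->//|bx].
have [||c] := @MVT R antider f b x bx.
- by move=> y _; exact: is_derive_antider.
- by apply: continuous_subspaceT; exact: is_derive_continuous is_derive_antider.
by rewrite in_itv/= => /andP[bc _] /eqP; rewrite fb ?ltW// mul0r subr_eq0 => /eqP.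
Qed.

Lemma antider_homo x y : (forall t, 0 <= f t) -> x <= y -> antider x <= antider y.
Proof.
move=> fp; rewrite le_eqVlt => /predU1P[->//|xy].
have [||c _] := @MVT R antider f x y xy.
- by move=> z _; exact: is_derive_antider.
- by apply: continuous_subspaceT; exact: is_derive_continuous is_derive_antider.
by rewrite -subr_ge0 => ->; rewrite mulr_ge0// subr_ge0 ltW.
Qed.

End antiderivative.

Section smooth_step.
Context (R : realType).

Let B := antider (@bump R) 0.

Let bump_cont : continuous (@bump R).
Proof. exact/smooth1_continuous/smooth1_bump. Qed.

Let B_derive (x : R) : is_derive x 1 B (bump x).
Proof. by apply: is_derive_antider => // t; exact: bump_le0. Qed.

Lemma bump_mass_gt0 : 0 < antider (@bump R) 0 1.
Proof.
have [||c] := @MVT R B (@bump R) 0 1 ltr01.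
- by move=> z _; exact: B_derive.
- by apply: continuous_subspaceT; exact: is_derive_continuous B_derive.
rewrite in_itv/= /B (@antider_le _ _ 0 _ 0)// => [|x]; last exact: bump_le0.
by rewrite !subr0 mulr1 => c01 ->; exact: bump_gt0.
Qed.

Definition step (t : R) : R := antider (@bump R) 0 t / antider (@bump R) 0 1.

Lemma smooth1_step : smooth1 step.
Proof.
move=> n; rewrite (_ : step = fun t => (B 1)^-1 * B t); last first.
  by apply/funext => t; rewrite /step mulrC.
apply: C1nZ; apply: (smooth1_antiderivative B_derive); exact: smooth1_bump.
Qed.

Lemma step_le0 t : t <= 0 -> step t = 0.
Proof.
by move=> t0; rewrite /step antider_le ?mul0r// => x; exact: bump_le0.
Qed.

Lemma step_ge1 t : 1 <= t -> step t = 1.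
Proof.
move=> t1; rewrite /step (@antider_cst _ _ 0 bump_cont _ 1)// => [|x|x].
- by rewrite divff// gt_eqF// bump_mass_gt0.
- exact: bump_le0.
- exact: bump_ge1.
Qed.

Lemma step_ge0 t : 0 <= step t.
Proof.
rewrite /step divr_ge0 ?(ltW bump_mass_gt0)//.
by apply: antider_ge0; exact: bump_ge0.
Qed.

Lemma step_le1 t : step t <= 1.
Proof.
have [t1|/step_ge1->//] := ltP t 1.
rewrite -(step_ge1 (lexx 1)) /step ler_pM2r ?invr_gt0 ?bump_mass_gt0//.
apply: antider_homo (ltW t1) => //; first exact: bump_le0.
exact: bump_ge0.
Qed.

End smooth_step.

Section smooth_space.
Context (R : realType).
Implicit Types (f g phi : pt3 R -> R) (i j : 'I_3).
Local Notation e := (@basis R).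

Lemma coordD i (x y : pt3 R) : coord i (x + y) = coord i x + coord i y.
Proof. by case: i => -[|[|[|//]]] ?. Qed.

Lemma coordZ i (c : R) (x : pt3 R) : coord i (c *: x) = c * coord i x.
Proof. by case: i => -[|[|[|//]]] ?. Qed.

Lemma coordN i (x : pt3 R) : coord i (- x) = - coord i x.
Proof. by case: i => -[|[|[|//]]] ?. Qed.

Lemma coord_basis i j : coord i (e j) = (i == j)%:R.
Proof. by case: i => -[|[|[|//]]] ?; case: j => -[|[|[|//]]] ?. Qed.

Lemma coord_inj (x y : pt3 R) : (forall i, coord i x = coord i y) -> x = y.
Proof.
move=> xy; have := xy ord0; have := xy (@Ordinal 3 1 isT); have := xy (@Ordinal 3 2 isT).
by rewrite /coord/=; case: x {xy} => -[? ?] ?; case: y => -[? ?] ? /= -> -> ->.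
Qed.

Lemma coord_sum (I : Type) (r : seq I) (P : pred I) (F : I -> pt3 R) i :
  coord i (\sum_(k <- r | P k) F k) = \sum_(k <- r | P k) coord i (F k).
Proof.
elim/big_rec2: _ => [|k y1 y2 _ <-]; last exact: coordD.
by case: i => -[|[|[|//]]] ?.
Qed.

Lemma coord_norm i (x : pt3 R) : `|coord i x| <= `|x|.
Proof.
by rewrite !prod_normE; case: i => -[|[|[|//]]] ?; rewrite /coord/= !le_max lexx ?orbT.
Qed.

Lemma norm_coord_le (x : pt3 R) (c : R) : (forall i, `|coord i x| <= c) -> `|x| <= c.
Proof.
move=> xc; have := xc ord0; have := xc (@Ordinal 3 1 isT); have := xc (@Ordinal 3 2 isT).
by rewrite /coord/= !prod_normE !ge_max => -> -> ->.
Qed.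

Lemma is_derive_line f (v x : pt3 R) (s : R) : derivable f (x + s *: v) v ->
  is_derive s 1 (fun t : R => f (x + t *: v)) ('D_v f (x + s *: v)).
Proof.
move=> df.
have E : (fun h : R => h^-1 *: (((fun t : R => f (x + t *: v)) \o shift s) (h *: (1 : R)) - f (x + s *: v))) =
   (fun h : R => h^-1 *: ((f \o shift (x + s *: v)) (h *: v) - f (x + s *: v))).
  apply/funext => h /=; congr (_ *: (f _ - _)).
  by rewrite /shift/= [_ *: 1]mulr1 scalerDl addrCA.
by split; rewrite /derivable /derive E.
Qed.

Lemma is_derive_coord (h h' : R -> R) i j (x : pt3 R) :
  (forall t : R, is_derive t 1 h (h' t)) ->
  is_derive x (e j) (h \o coord i) ((i == j)%:R * h' (coord i x)).
Proof.
move=> dh; have [<-|ij] := eqVneq i j.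
  have E : (fun t : R => t^-1 *: (((h \o coord i) \o shift x) (t *: e i) - (h \o coord i) x)) =
     (fun t : R => t^-1 *: ((h \o shift (coord i x)) (t *: (1 : R)) - h (coord i x))).
    apply/funext => t /=; congr (_ *: (h _ - _)).
    by rewrite /shift/= coordD coordZ coord_basis eqxx.
  by rewrite mul1r; have [d1 d2] := dh (coord i x); split;
    rewrite ?/derivable ?/derive E.
have E : (fun t : R => t^-1 *: (((h \o coord i) \o shift x) (t *: e j) - (h \o coord i) x)) =
    (fun=> 0).
  apply/funext => t /=.
  by rewrite /shift/= coordD coordZ coord_basis (negbTE ij) mulr0 add0r subrr scaler0.
rewrite mul0r; split; rewrite ?/derivable ?/derive E; first exact: is_cvg_cst.
exact: lim_cst.
Qed.

(** [iter_partial] peels off the derivative applied last, which does not suit the Leibniz rule. This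
    variant peels off the one applied first, so sums and products go through by induction on the
    order; [smoothP] identifies the two. *)
Fixpoint CCn (n : nat) f : Prop :=
  continuous f /\
  if n is n'.+1 then
    forall i, (forall x, derivable f x (e i)) /\ CCn n' ('D_(e i) f)
  else True.

Lemma CCnW n f : CCn n.+1 f -> CCn n f.
Proof.
elim: n f => [|n IH] f [cf df]; first by split.
by split => // i; have [? ?] := df i; split => //; exact: IH.
Qed.

Lemma iter_partial_rcons s i f :
  iter_partial (rcons s i) f = iter_partial s ('D_(e i) f).
Proof. by elim: s => [//|j s /= ->]. Qed.

Lemma smooth_derive f i : smooth f -> smooth ('D_(e i) f).
Proof. by move=> sf s; rewrite -iter_partial_rcons; exact: sf. Qed.

Lemma smooth_continuous f : smooth f -> continuous f.
Proof. by move=> /(_ [::])[]. Qed.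

Lemma smooth_derivable f i x : smooth f -> derivable f x (e i).
Proof. by move=> /(_ [::])[_]; exact. Qed.

Lemma smoothP f : smooth f <-> forall n, CCn n f.
Proof.
split=> [sf n|Cf].
  elim: n f sf => [|n IH] f sf; first by split => //; exact: smooth_continuous.
  split; first exact: smooth_continuous.
  by move=> i; split=> [x|]; [exact: smooth_derivable|apply: IH; exact: smooth_derive].
move=> s; elim/last_ind: s f Cf => [|s i IH] f Cf.
  by have [cf df] := Cf 1%N; split => //= i; have [] := df i.
rewrite iter_partial_rcons; apply: IH => n.
by have [_ /(_ i)[]] := Cf n.+1.
Qed.

Lemma CCnD n f g : CCn n f -> CCn n g -> CCn n (fun x => f x + g x).
Proof.
elim: n f g => [|n IH] f g [cf df] [cg dg]; split => //; try by
  move=> x; apply: cvgD; [exact: cf|exact: cg].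
move=> i; have [df1 df2] := df i; have [dg1 dg2] := dg i; split.
  by move=> x; apply: derivableD.
rewrite (_ : 'D_(e i) _ = fun x => 'D_(e i) f x + 'D_(e i) g x); first exact: IH.
by apply/funext => x; rewrite -deriveD.
Qed.

Lemma CCnM n f g : CCn n f -> CCn n g -> CCn n (fun x => f x * g x).
Proof.
elim: n f g => [|n IH] f g /[dup] Cf [cf df] /[dup] Cg [cg dg]; split => //; try by
  move=> x; apply: cvgM; [exact: cf|exact: cg].
move=> i; have [df1 df2] := df i; have [dg1 dg2] := dg i; split.
  by move=> x; apply: derivableM.
rewrite (_ : 'D_(e i) _ = fun x => f x * 'D_(e i) g x + g x * 'D_(e i) f x).
  by apply: CCnD; apply: IH => //; exact: CCnW.
by apply/funext => x; rewrite -[LHS]/('D_(e i) (f * g) x) deriveM.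
Qed.

Lemma CCn_cst n (c : R) : CCn n (fun=> c).
Proof.
elim: n c => [|n IH] c; (split; first by move=> x; exact: cvg_cst) => // i.
split; first by move=> x; exact: derivable_cst.
rewrite (_ : 'D_(e i) _ = fun=> 0); first exact: IH.
by apply/funext => x; exact: derive_cst.
Qed.

Lemma CCn_coord n (h : R -> R) i : C1n n.+1 h -> CCn n (h \o coord i).
Proof.
elim: n h => [|n IH] h [h' dh Ch'].
  split => // x; apply: continuous_comp; first exact: continuous_coord.
  exact: is_derive_continuous dh _.
split.
  move=> x; apply: continuous_comp; first exact: continuous_coord.
  exact: is_derive_continuous dh _.
move=> j; split; first by move=> x; have [] := is_derive_coord i j x dh.
rewrite (_ : 'D_(e j) _ = fun x => (i == j)%:R * (h' \o coord i) x).
  by apply: CCnM; [exact: CCn_cst|exact: IH].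
by apply/funext => x; have [_ ->] := is_derive_coord i j x dh.
Qed.

Lemma smoothD f g : smooth f -> smooth g -> smooth (fun x => f x + g x).
Proof. by move=> /smoothP Cf /smoothP Cg; apply/smoothP => n; exact: CCnD. Qed.

Lemma smoothM f g : smooth f -> smooth g -> smooth (fun x => f x * g x).
Proof. by move=> /smoothP Cf /smoothP Cg; apply/smoothP => n; exact: CCnM. Qed.

Lemma smooth_cst (c : R) : smooth (fun _ : pt3 R => c).
Proof. by apply/smoothP => n; exact: CCn_cst. Qed.

Lemma smoothZ (c : R) f : smooth f -> smooth (fun x => c * f x).
Proof. by apply: smoothM; exact: smooth_cst. Qed.

Lemma smoothB f g : smooth f -> smooth g -> smooth (f \- g).
Proof.
move=> sf sg; rewrite (_ : f \- g = fun x => f x + -1 * g x).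
  by apply: smoothD => //; exact: smoothZ.
by apply/funext => x /=; rewrite mulN1r.
Qed.

Lemma smooth_coord (h : R -> R) i : smooth1 h -> smooth (h \o coord i).
Proof. by move=> sh; apply/smoothP => n; exact: CCn_coord (sh n.+1). Qed.

Lemma deriveM_smooth f g i x : smooth f -> smooth g ->
  'D_(e i) (fun y => f y * g y) x = f x * 'D_(e i) g x + g x * 'D_(e i) f x.
Proof.
move=> sf sg; rewrite -[LHS]/('D_(e i) (f * g) x) deriveM//; exact: smooth_derivable.
Qed.

Lemma deriveD_smooth f g i x : smooth f -> smooth g ->
  'D_(e i) (fun y => f y + g y) x = 'D_(e i) f x + 'D_(e i) g x.
Proof. by move=> sf sg; rewrite -deriveD//; exact: smooth_derivable. Qed.

Lemma deriveB_smooth f g i x : smooth f -> smooth g ->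
  'D_(e i) (f \- g) x = 'D_(e i) f x - 'D_(e i) g x.
Proof.
move=> sf sg; rewrite -[LHS]/('D_(e i) (f - g) x) deriveB//; exact: smooth_derivable.
Qed.

Lemma derive_zero_out f (v : pt3 R) (U : set (pt3 R)) x : open U -> U x ->
  (forall y, U y -> f y = 0) -> 'D_v f x = 0.
Proof.
move=> oU Ux f0; rewrite -(@derive_cst R (pt3 R) R 0 x v); apply: near_eq_derive.
near=> y; rewrite f0//; near: y; exact: open_nbhs_nbhs.
Unshelve. all: by end_near. Qed.

End smooth_space.

Section test_functions.
Context (R : realType).
Implicit Types (f g phi : pt3 R -> R) (i j : 'I_3) (D : set (pt3 R)).
Local Notation e := (@basis R).

Lemma compact_closed3 (K : set (pt3 R)) : compact K -> closed K.
Proof. by apply: compact_closed; exact: norm_hausdorff. Qed.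

Lemma test_smooth D phi : test_function D phi -> smooth phi.
Proof. by case. Qed.

Lemma test_derive_out phi (K : set (pt3 R)) i x : closed K ->
  (forall x, ~ K x -> phi x = 0) -> ~ K x -> 'D_(e i) phi x = 0.
Proof.
move=> cK phi0 nKx; apply: (@derive_zero_out _ _ _ (~` K)) => //.
exact: closed_openC.
Qed.

Lemma test_derive D phi i : test_function D phi -> test_function D ('D_(e i) phi).
Proof.
move=> [sphi [K [cK KD phi0]]]; split; first exact: smooth_derive.
exists K; split => // x nKx.
exact: (test_derive_out _ (compact_closed3 cK) phi0).
Qed.

Lemma test_zero D phi x : test_function D phi -> ~ D x -> phi x = 0.
Proof. by move=> [_ [K [_ KD phi0]]] nDx; apply: phi0 => /KD. Qed.

Lemma test_subset D E phi : D `<=` E -> test_function D phi -> test_function E phi.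
Proof.
move=> DE [sphi [K [cK KD phi0]]]; split => //; exists K; split => //.
exact: subset_trans KD DE.
Qed.

Lemma test_bounded D phi : test_function D phi -> exists M, forall x, `|phi x| <= M.
Proof.
move=> [sphi [K [cK KD phi0]]].
have : compact (phi @` K).
  apply: continuous_compact => //; apply: continuous_subspaceT.
  exact: smooth_continuous.
move=> /compact_bounded[M [Mr bM]].
exists (Num.max 0 (M + 1)) => x.
have [Kx|/phi0->] := pselect (K x); last by rewrite normr0 le_max lexx.
by rewrite le_max (bM (M + 1)) ?ltrDl ?orbT//; exists x.
Qed.

Lemma testM_smooth D phi f : smooth f -> test_function D phi ->
  test_function D (fun x => f x * phi x).
Proof.
move=> sf [sphi [K [cK KD phi0]]]; split; first exact: smoothM.
by exists K; split => // x /phi0 ->; rewrite mulr0.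
Qed.

Lemma test_continuous D phi : test_function D phi -> continuous phi.
Proof. by move=> /test_smooth/smooth_continuous. Qed.

Lemma test_measurable D E phi : test_function D phi -> measurable E ->
  measurable_fun E phi.
Proof.
move=> /test_continuous/continuous_measurable3 mphi mE.
exact: (measurable_funS measurableT (@subsetT _ E) mphi).
Qed.

Lemma compact_cube (x : pt3 R) (r : R) : compact (cube x r).
Proof.
apply: compact_setX; last exact: segment_compact.
by apply: compact_setX; exact: segment_compact.
Qed.

Lemma bounded_cube D : bounded_set D -> exists2 M : R, 0 <= M & D `<=` cube 0 M.
Proof.
move=> [M [Mr bM]]; exists (Num.max 0 (M + 1)); first by rewrite le_max lexx.
move=> x Dx; apply/cubeP; rewrite subr0 le_max (bM (M + 1)) ?orbT// ltrDl//.
Qed.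

Lemma leb3_bounded D : measurable D -> bounded_set D -> (@leb3 R D < +oo)%E.
Proof.
move=> mD /bounded_cube[M M0 DM]; apply: (@le_lt_trans _ _ (@leb3 R (cube 0 M))).
  by apply: leb3_le => //; exact: measurable_cube.
by rewrite leb3_cube// ltry.
Qed.

Lemma test_L2 D E phi : test_function D phi -> measurable E -> L2 (@leb3 R) E phi.
Proof.
move=> tphi mE; have [M phiM] := test_bounded tphi.
have [K0 [cK KD phi0]] := tphi.2.
have mK : measurable K0 by apply: closed_measurable3; exact: compact_closed3.
have KT : (@leb3 R K0 < +oo)%E.
  by apply: leb3_bounded => //; exact: compact_bounded.
have mp := test_measurable tphi mE.
have LK : L2 (@leb3 R) K0 phi.
  exact: (@L2_bounded _ _ _ (@leb3 R) K0 phi M mK KT (test_measurable tphi mK) (fun x _ => phiM x)).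
apply/(L2P _ _ mE); split; first exact: mp.
apply: le_lt_trans (@L2_lty _ _ _ (@leb3 R) K0 phi mK LK).
rewrite /L2sq integral_mkcond [leRHS]integral_mkcond; apply: ge0_le_integral => //.
- by move=> x _; rewrite /patch; case: ifP => // _; rewrite lee_fin sqr_ge0.
- by apply/(measurable_restrictT _ mE); exact: measurable_sqr.
- by apply/(measurable_restrictT _ mK); apply: measurable_sqr; exact: (test_measurable tphi mK).
- move=> x _; rewrite /patch; case: ifPn => xE; case: ifPn => xK //.
  + by move: xK => /negP; rewrite inE => nK; rewrite phi0 ?expr0n.
  + by rewrite lee_fin sqr_ge0.
Qed.

End test_functions.

Section windows.
Context (R : realType).
Implicit Types (a b m t : R).

Definition window a b m t : R := step (m * (t - a)) * step (m * (b - t)).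

Lemma smooth1_window a b m : smooth1 (window a b m).
Proof.
move=> n; apply: C1nM.
  have := @C1n_affine _ n _ m (- (m * a)) (@smooth1_step R n).
  by congr C1n; apply/funext => t; rewrite mulrBr.
have := @C1n_affine _ n _ (- m) (m * b) (@smooth1_step R n).
by congr C1n; apply/funext => t; rewrite mulrBr mulNr addrC.
Qed.

Lemma window_ge0 a b m t : 0 <= window a b m t.
Proof. by rewrite /window mulr_ge0// step_ge0. Qed.

Lemma window_le1 a b m t : window a b m t <= 1.
Proof. by rewrite /window -[leRHS]mulr1 ler_pM ?step_ge0 ?step_le1. Qed.

Lemma window_out a b m t : 0 <= m -> t <= a \/ b <= t -> window a b m t = 0.
Proof.
move=> m0 [h|h]; rewrite /window.
  by rewrite step_le0 ?mul0r// mulr_ge0_le0// subr_le0.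
by rewrite [X in _ * X]step_le0 ?mulr0// mulr_ge0_le0// subr_le0.
Qed.

Lemma window_in a b m t : 0 < m -> a + m^-1 <= t -> t <= b - m^-1 -> window a b m t = 1.
Proof.
move=> m0 h1 h2; rewrite /window !step_ge1 ?mulr1//.
  by rewrite -ler_pdivrMl// mulr1; lra.
by rewrite -ler_pdivrMl// mulr1; lra.
Qed.

End windows.

(** * The fundamental lemma of the calculus of variations *)

Section locally_ae.
Context (R : realType).

Lemma ae3S (P Q : pt3 R -> Prop) : (forall x, P x -> Q x) ->
  {ae (@leb3 R), forall x, P x} -> {ae (@leb3 R), forall x, Q x}.
Proof. by move=> PQ; apply: negligibleS => x /= nQ Px; apply/nQ/PQ. Qed.

Lemma ae3I (P Q : pt3 R -> Prop) : {ae (@leb3 R), forall x, P x} ->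
  {ae (@leb3 R), forall x, Q x} -> {ae (@leb3 R), forall x, P x /\ Q x}.
Proof.
move=> nP nQ; have := negligibleU nP nQ; apply: negligibleS => x /=.
by move=> /not_andP[]; [left|right].
Qed.

Lemma ae2S (P Q : pt2 R -> Prop) : (forall x, P x -> Q x) ->
  {ae (@leb2 R), forall x, P x} -> {ae (@leb2 R), forall x, Q x}.
Proof. by move=> PQ; apply: negligibleS => x /= nQ Px; apply/nQ/PQ. Qed.

(* There are only countably many dyadic cells, so a local null set is null. *)
Lemma ae_local (D : set (pt3 R)) (P : pt3 R -> Prop) :
  (forall x, D x -> exists n, {ae (@leb3 R), forall y, dyad3 n y = dyad3 n x -> P y}) ->
  {ae (@leb3 R), forall y, D y -> P y}.
Proof.
move=> DP.
pose N n k := if `[< {ae (@leb3 R), forall y, dyad_cell n k y -> P y} >]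
  then ~` [set y | dyad_cell n k y -> P y] else set0.
have : (@leb3 R).-negligible (\bigcup_n \bigcup_k N n k).
  apply: negligible_bigcup => n; apply: negligible_bigcup => k.
  by rewrite /N; case: asboolP => // _; exact: negligible_set0.
apply: negligibleS => y /= nDPy.
have Dy : D y by apply: contrapT => nDy; apply: nDPy.
have [n nP] := DP y Dy; exists n => //; exists (pickle (dyad3 n y)) => //.
rewrite /N; case: asboolP => [_ /=|[]]; last first.
  apply: ae3S nP => z zP; rewrite /dyad_cell/= => /(pcan_inj pickleK); exact: zP.
by move=> yP; apply: nDPy => _; apply: yP.
Qed.

Lemma ae_openP (D : set (pt3 R)) (P : pt3 R -> Prop) :
  (forall x, D x -> exists2 U : set (pt3 R), open U /\ U x &
     {ae (@leb3 R), forall y, U y -> P y}) ->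
  {ae (@leb3 R), forall y, D y -> P y}.
Proof.
move=> DP; apply: ae_local => x /DP[U [oU Ux] UP].
have [n nU] := open_dyadic oU Ux; exists n.
by apply: ae3S UP => y yP yx; apply: yP; apply: nU.
Qed.

End locally_ae.

Section tensors.
Context (R : realType).
Implicit Types (th : 'I_3 -> R -> R) (D : set (pt3 R)).
Local Notation e := (@basis R).

Definition tens th (x : pt3 R) : R := \prod_i th i (coord i x).

(** Tensor products are the only test functions that the fundamental lemma requires. If some [b i]
    is below [a i], the box is empty and the product is identically zero, which is consistent. *)
Definition box_supported D th : Prop := exists a b : 'I_3 -> R,
  [/\ forall i, smooth1 (th i),
      forall i t, t <= a i \/ b i <= t -> th i t = 0 &
      [set x | forall i, a i <= coord i x <= b i] `<=` D].

Lemma smooth_tens th : (forall i, smooth1 (th i)) -> smooth (tens th).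
Proof.
move=> sth.
rewrite (_ : tens th = fun x => th ord0 (coord ord0 x) *
  (th (@Ordinal 3 1 isT) (coord (@Ordinal 3 1 isT) x) *
   th (@Ordinal 3 2 isT) (coord (@Ordinal 3 2 isT) x))).
  by do !apply: smoothM; exact: (smooth_coord _ (sth _)).
apply/funext => x; rewrite /tens !big_ord_recl big_ord0 mulr1.
by congr (_ * (_ * _)); congr (th _ (coord _ _)); exact/val_inj.
Qed.

Lemma box_supported_test D th : box_supported D th -> test_function D (tens th).
Proof.
move=> [a [b [sth th0 abD]]]; split; first exact: smooth_tens.
exists [set x | forall i, a i <= coord i x <= b i]; split => //.
  rewrite (_ : [set x | _] = `[a ord0, b ord0]%classic `*`
      `[a (@Ordinal 3 1 isT), b (@Ordinal 3 1 isT)]%classic `*`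
      `[a (@Ordinal 3 2 isT), b (@Ordinal 3 2 isT)]%classic).
    apply: compact_setX; last exact: segment_compact.
    by apply: compact_setX; exact: segment_compact.
  apply/seteqP; split => x /=; rewrite !in_itv/=.
    by move=> h; split; [split|]; exact: h.
  move=> [[h0 h1] h2] [[|[|[|//]]] i].
  - by rewrite (_ : Ordinal i = ord0)//; exact/val_inj.
  - by rewrite (_ : Ordinal i = @Ordinal 3 1 isT)//; exact/val_inj.
  - by rewrite (_ : Ordinal i = @Ordinal 3 2 isT)//; exact/val_inj.
move=> x /existsNP[i] /negP; rewrite negb_and -!ltNge => h.
rewrite /tens (bigD1 i)//= th0 ?mul0r//.
by case/orP: h => /ltW; [left|right].
Qed.

Definition upd th i (h : R -> R) : 'I_3 -> R -> R :=
  fun j => if j == i then h else th j.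

Lemma tens_upd th i h x :
  tens (upd th i h) x = h (coord i x) * \prod_(j | j != i) th j (coord j x).
Proof.
rewrite /tens (bigD1 i)//= /upd eqxx; congr (_ * _).
by apply: eq_bigr => j /negbTE ->.
Qed.

Lemma is_derive_tens th i h' (x : pt3 R) : (forall t : R, is_derive t 1 (th i) (h' t)) ->
  is_derive x (e i) (tens th) (tens (upd th i h') x).
Proof.
move=> dh.
have E : (fun s : R => s^-1 *: ((tens th \o shift x) (s *: e i) - tens th x)) =
   (fun s : R => (\prod_(j | j != i) th j (coord j x)) *:
     (s^-1 *: ((th i \o shift (coord i x)) (s *: (1 : R)) - th i (coord i x)))).
  apply/funext => s /=; rewrite /tens (bigD1 i)//= [X in _ - X](bigD1 i)//=.
  rewrite (eq_bigr (fun j => th j (coord j x))); last first.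
    move=> j ji; rewrite /shift/= coordD coordZ coord_basis (negbTE ji).
    by rewrite mulr0 add0r.
  rewrite -mulrBl /shift/= coordD coordZ coord_basis eqxx mulr1 [_ *: 1]mulr1.
  by rewrite /GRing.scale/=; ring.
have [d1 d2] := dh (coord i x).
have cv : (fun s : R => (\prod_(j | j != i) th j (coord j x)) *:
     (s^-1 *: ((th i \o shift (coord i x)) (s *: (1 : R)) - th i (coord i x)))) @ 0^' -->
   tens (upd th i h') x.
  rewrite tens_upd mulrC; apply: cvgZr.
  by rewrite -d2; exact: d1.
split; rewrite ?/derivable ?/derive E; last exact: cvg_lim cv.
by apply/cvg_ex; eexists; exact: cv.
Qed.

Lemma derive_tens th i h' (x : pt3 R) : (forall t : R, is_derive t 1 (th i) (h' t)) ->
  'D_(e i) (tens th) x = tens (upd th i h') x.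
Proof. by move=> /(is_derive_tens x)[_ ->]. Qed.

End tensors.

Section dominated3.
Context (R : realType).

Lemma dominated3 (D : set (pt3 R)) (f_ : nat -> pt3 R -> R) (f g : pt3 R -> R) :
  measurable D -> (forall n, measurable_fun D (f_ n)) -> measurable_fun D f ->
  (forall x, D x -> (fun n => f_ n x) @ \oo --> f x) ->
  (@leb3 R).-integrable D (EFin \o g) ->
  (forall n x, D x -> `|f_ n x| <= g x) ->
  (@leb3 R).-integrable D (EFin \o f) /\
  (fun n => \int[@leb3 R]_(x in D) f_ n x) @ \oo --> \int[@leb3 R]_(x in D) f x.
Proof.
move=> mD mf_ mf f_f ig f_g.
have h3 : {ae (@leb3 R), forall x, D x -> (fun n => (f_ n x)%:E) @ \oo --> (f x)%:E}.
  by apply: aeW => x Dx; apply: cvg_EFin; [exact: nearW|exact: f_f].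
have h5 : {ae (@leb3 R), forall x n, D x -> (`|(f_ n x)%:E| <= (g x)%:E)%E}.
  by apply: aeW => x n Dx; rewrite lee_fin f_g.
have h1 n : measurable_fun D (EFin \o f_ n) by exact/measurable_EFinP.
have h2 : measurable_fun D (EFin \o f) by exact/measurable_EFinP.
have [iF _ cv] := @dominated_convergence _ _ _ (@leb3 R) D mD _ _ _ h1 h2 h3 ig h5.
split; first exact: iF.
rewrite -(fineK (@integrable_fin_num _ _ _ (@leb3 R) D mD _ iF)) in cv.
exact: (fine_cvg cv).
Qed.

Lemma integrableS3 (D E : set (pt3 R)) (f : pt3 R -> R) : measurable D ->
  measurable E -> E `<=` D -> (@leb3 R).-integrable D (EFin \o f) ->
  (@leb3 R).-integrable E (EFin \o f).
Proof. by move=> mD mE ED; exact: (@integrableS _ _ _ (@leb3 R) D E _ mD mE ED). Qed.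

Lemma integral_Rintegral3 (D : set (pt3 R)) (f : pt3 R -> R) : measurable D ->
  (@leb3 R).-integrable D (EFin \o f) ->
  (\int[@leb3 R]_(x in D) (f x)%:E = (\int[@leb3 R]_(x in D) f x)%:E)%E.
Proof. by move=> mD iF; rewrite /Rintegral fineK//; exact: (@integrable_fin_num _ _ _ (@leb3 R) D mD _ iF). Qed.

End dominated3.

Section fundamental_lemma.
Context (R : realType).
Local Notation mu := (@leb3 R).

(** Unlike [window], the left transition lies outside of the interval, on [[a - 1/m, a]], and the
    right one inside, on [[b - 1/m, b]]. The limit as [m] grows is therefore the indicator of the
    half-open interval, exactly the shape of a dyadic cell. *)
Definition hwindow (a b m t : R) : R := step (m * (t - a) + 1) * step (m * (b - t)).

Lemma smooth1_hwindow a b m : smooth1 (hwindow a b m).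
Proof.
move=> n; apply: C1nM.
  have := @C1n_affine _ n _ m (- (m * a) + 1) (@smooth1_step R n).
  by congr C1n; apply/funext => t; rewrite mulrBr addrA.
have := @C1n_affine _ n _ (- m) (m * b) (@smooth1_step R n).
by congr C1n; apply/funext => t; rewrite mulrBr mulNr addrC.
Qed.

Lemma hwindow_ge0 a b m t : 0 <= hwindow a b m t.
Proof. by rewrite /hwindow mulr_ge0// step_ge0. Qed.

Lemma hwindow_le1 a b m t : hwindow a b m t <= 1.
Proof. by rewrite /hwindow -[leRHS]mulr1 ler_pM ?step_ge0 ?step_le1. Qed.

Lemma hwindow_out a b m t : 0 < m -> t <= a - m^-1 \/ b <= t -> hwindow a b m t = 0.
Proof.
move=> m0 [h|h]; rewrite /hwindow.
  rewrite step_le0 ?mul0r//.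
  have : m * (t - a) <= m * (- m^-1) by rewrite ler_pM2l//; lra.
  by rewrite mulrN mulfV ?gt_eqF//; lra.
by rewrite [X in _ * X]step_le0 ?mulr0// mulr_ge0_le0 ?subr_le0// ltW.
Qed.

Lemma hwindow_cvg a b t :
  (fun n => hwindow a b n.+1%:R t) @ \oo --> ((a <= t < b)%R%:R : R).
Proof.
have inv_lt (z : R) : 0 < z -> \forall n \near \oo, n.+1%:R^-1 < z.
  by move=> z0; exact: near_infty_natSinv_lt (PosNum z0).
have m0 n : (0 : R) < n.+1%:R by [].
apply/cvgrPdist_le => e e0.
have [at_|ta] := leP a t; last first.
  have := inv_lt (a - t); rewrite subr_gt0 => /(_ ta); apply: filterS => n h.
  rewrite /= hwindow_out ?subr0 ?normr0 ?(ltW e0)//; left.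
  by move: h; move: (n.+1%:R^-1) => c; lra.
have [tb|bt] := ltP t b; last first.
  by apply: nearW => n; rewrite /= hwindow_out ?subr0 ?normr0 ?(ltW e0)//; right.
have := inv_lt (b - t); rewrite subr_gt0 => /(_ tb); apply: filterS => n h.
rewrite /= /hwindow !step_ge1 ?mulr1 ?subrr ?normr0 ?(ltW e0)//.
  by rewrite -ler_pdivrMl// mulr1 ltW.
by rewrite lerDr mulr_ge0// subr_ge0.
Qed.

Variables (D : set (pt3 R)) (F : pt3 R -> R).
Hypotheses (oD : open D) (iF : mu.-integrable D (EFin \o F)).
Hypothesis F0 : forall th, box_supported D th -> \int[mu]_(x in D) (F x * tens th x) = 0.

Let mD : measurable D. Proof. exact: open_measurable3. Qed.

Let mF : measurable_fun D F.
Proof. by apply/measurable_EFinP; exact: (@measurable_int _ _ _ mu _ _ iF). Qed.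

Lemma dyadic_box n (x y : pt3 R) : dyad3 n y = dyad3 n x <->
  forall i, (dyad n (coord i x))%:~R / 2 ^+ n <= coord i y
            < (dyad n (coord i x) + 1)%:~R / 2 ^+ n.
Proof.
have E i : (dyad n (coord i y) = dyad n (coord i x)) <->
   (dyad n (coord i x))%:~R / 2 ^+ n <= coord i y < (dyad n (coord i x) + 1)%:~R / 2 ^+ n.
  have /seteqP[h1 h2] := @dyad_preimage R n (dyad n (coord i x)).
  by split=> [/h1|h]; [rewrite /= in_itv|apply: h2; rewrite /= in_itv].
split.
  move=> [h0 h1 h2] i; apply/E.
  by case: i => -[|[|[|//]]] ?; [exact: h0|exact: h1|exact: h2].
move=> h; rewrite /dyad3.
have := h ord0; move/E => h0.
have := h (@Ordinal 3 1 isT); move/E => h1.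
have := h (@Ordinal 3 2 isT); move/E => h2.
by rewrite /coord/= in h0 h1 h2; rewrite h0 h1 h2.
Qed.

(** Products of [hwindow] converge pointwise to the indicator of the cell and are dominated by 1.
    They are admissible tests once [1/m] is below [2^-n]: one [2^-n] in the radius of the cube
    accounts for the cell, the other for the overhang on the left. *)
Lemma integral_cell0 n x : cube x ((2 ^+ n)^-1 + (2 ^+ n)^-1) `<=` D ->
  (\int[mu]_(y in dyad3 n @^-1` [set dyad3 n x]) (F y)%:E = 0)%E.
Proof.
move=> QD; pose c : set (pt3 R) := dyad3 n @^-1` [set dyad3 n x].
have p2 : (0 : R) < (2 ^+ n)^-1 by rewrite invr_gt0 exprn_gt0.
have cD : c `<=` D.
  move=> y xy; apply: QD; apply/cubeP; rewrite (le_trans (dyad3_dist xy))//; lra.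
have mc : measurable c by exact: measurable_dyad3.
pose a i : R := (dyad n (coord i x))%:~R / 2 ^+ n.
pose b i : R := (dyad n (coord i x) + 1)%:~R / 2 ^+ n.
have bE i : b i = a i + (2 ^+ n)^-1 by rewrite /a /b intrD mulrDl mul1r.
have ax i : a i <= coord i x < b i by have /dyadic_box := erefl (dyad3 n x); exact.
pose th m i := hwindow (a i) (b i) m.+1%:R.
have supp : \forall m \near \oo, box_supported D (th m).
  near=> m.
  have hm : m.+1%:R^-1 < (2 ^+ n)^-1 :> R.
    by near: m; exact: near_infty_natSinv_lt (PosNum p2).
  exists (fun i => a i - m.+1%:R^-1), b; split.
  - by move=> i; exact: smooth1_hwindow.
  - by move=> i t; exact: hwindow_out.
  - move=> y yab; apply: QD; apply/cubeP; apply: norm_coord_le => i.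
    rewrite coordD coordN ler_norml.
    have := ax i; have := yab i; rewrite bE.
    by move: hm; move: (m.+1%:R^-1) => z; lra.
have mth m : measurable_fun D (tens (th m)).
  apply: (measurable_funS measurableT (@subsetT _ D)).
  apply: continuous_measurable3; apply: smooth_continuous; apply: smooth_tens => i.
  exact: smooth1_hwindow.
have th01 m y : 0 <= tens (th m) y <= 1.
  rewrite /tens; apply: (@big_ind _ (fun z : R => 0 <= z <= 1)).
  - by rewrite ler01 lexx.
  - by move=> u v /andP[? ?] /andP[? ?]; rewrite mulr_ge0//= -[leRHS]mulr1 ler_pM.
  - by move=> i _; rewrite hwindow_ge0 hwindow_le1.
have indE y : \1_c y = \prod_i ((a i <= coord i y < b i)%R%:R : R).
  rewrite indicE; have [yc|yc] := boolP (y \in c).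
    rewrite big1// => i _; rewrite inE in yc.
    by move/dyadic_box : yc => /(_ i) ->.
  have /existsNP[i /negP ni] : ~ (forall i, a i <= coord i y < b i).
    by move=> h; move/negP: yc; apply; rewrite inE; apply/dyadic_box.
  by rewrite (bigD1 i)//= (negbTE ni) mul0r.
have Fth0 m y : `|F y * tens (th m) y| <= `|F y|.
  by rewrite normrM ler_piMr//; have /andP[? ?] := th01 m y; rewrite ger0_norm.
have mFth m : measurable_fun D (fun y => F y * tens (th m) y) by exact: measurable_funM.
have [||||iFc cv] := @dominated3 R D (fun m y => F y * tens (th m) y)
    (fun y => F y * \1_c y) (fun y => `|F y|) mD mFth.
- by apply: measurable_funM => //; exact: measurable_indic.
- move=> y Dy; apply: cvgMr; rewrite indE.
  rewrite (_ : (fun m => tens (th m) y) = fun m => th m ord0 (coord ord0 y) *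
    (th m (lift ord0 ord0) (coord (lift ord0 ord0) y) *
     th m (lift ord0 (lift ord0 ord0)) (coord (lift ord0 (lift ord0 ord0)) y))); last first.
    by apply/funext => m; rewrite /tens !big_ord_recl big_ord0 mulr1.
  rewrite !big_ord_recl big_ord0 mulr1.
  by apply: cvgM; [exact: hwindow_cvg|apply: cvgM; exact: hwindow_cvg].
- exact: integrable_norm iF.
- by move=> m y _; exact: Fth0.
have cv0 : (fun m => \int[mu]_(y in D) (F y * tens (th m) y)) @ \oo --> (0 : R).
  by apply: cvg_near_cst; apply: filterS supp => m; exact: F0.
have {cv cv0} Z : \int[mu]_(y in D) (F y * \1_c y) = 0.
  by apply: (cvg_unique _ cv cv0).
have cE : c = D `&` c by rewrite setIidr.
rewrite -[RHS]/(0%:E) -Z -integral_Rintegral3// -/c [in LHS]cE integral_mkcondr.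
apply: eq_integral => y _.
by rewrite /patch indicE; case: ifP => _; rewrite ?mulr1 ?mulr0.
Unshelve. all: by end_near. Qed.

(** The integral of [F] vanishes on every small cell, then on every measurable part of a fixed cell
    [Q] by a Dynkin argument, so [F] is zero almost everywhere in [Q]. *)
Lemma fundamental_lemma : {ae mu, forall x, D x -> F x = 0}.
Proof.
apply: ae_local => x Dx.
(* Three times the cell size: two for [integral_cell0] around a point [y] of [Q], one for the
   distance from [y] to [x]. *)
have [n0 n0D] : exists n, cube x ((2 ^+ n)^-1 + (2 ^+ n)^-1 + (2 ^+ n)^-1) `<=` D.
  have /nbhs_ballP[r /= r0 rD] := open_nbhs_nbhs (conj oD Dx).
  have [n nr] := @exists_dyad R (r / 3) (divr_gt0 r0 (ltr0n _ 3)).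
  exists n => y /cubeP yx; apply: rD; rewrite -ball_normE /= distrC.
  by rewrite (le_lt_trans yx)//; lra.
exists n0; pose Q : set (pt3 R) := dyad3 n0 @^-1` [set dyad3 n0 x].
have mQ : measurable Q by exact: measurable_dyad3.
have p2 k : (0 : R) < (2 ^+ k)^-1 by rewrite invr_gt0 exprn_gt0.
have QD : Q `<=` D.
  move=> y xy; apply: n0D; apply/cubeP; rewrite (le_trans (dyad3_dist xy))//.
  by have := p2 n0; lra.
have iQ : mu.-integrable Q (EFin \o F) by exact: (integrableS3 mD mQ QD iF).
have Z n y : (n0 <= n)%N -> Q y -> (\int[mu]_(z in dyad3 n @^-1` [set dyad3 n y]) (F z)%:E = 0)%E.
  move=> nn Qy; apply: integral_cell0; apply: subset_trans n0D => z /cubeP zy.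
  apply/cubeP; rewrite -(subrKA y) (le_trans (ler_normD _ _))//.
  have := dyad3_dist Qy; have : (2 ^+ n)^-1 <= (2 ^+ n0)^-1 :> R.
    by rewrite lef_pV2 ?posrE ?exprn_gt0// ler_weXn2l// ler1n.
  by move: zy; lra.
have P A : measurable A -> (\int[mu]_(z in A `&` Q) (F z)%:E = 0)%E.
  rewrite measurable_dyadic_gen.
  apply: (@dynkin_induction _ (pt3 (measurableTypeR R)) (@dyadic_sets R)
    (fun A => (\int[mu]_(z in A `&` Q) (F z)%:E = 0)%E)).
  - exact: measurable_dyadic_gen.
  - move=> A1 B1 dA dB; rewrite -(setCK (A1 `&` B1)) setCI.
    by apply: dyadic_setsC; apply: dyadic_setsU; exact: dyadic_setsC.
  - by rewrite setTI; apply: Z.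
  - move=> {}A [n An].
    (* In this generation both [A] and [Q] are unions of cells. *)
    pose m := maxn n n0.
    have AQ y z : dyad3 m y = dyad3 m z -> (A `&` Q) y -> (A `&` Q) z.
      move=> yz [Ay Qy]; split.
        by apply: An Ay; apply: dyad3_le yz; rewrite leq_maxl.
      by apply: etrans Qy; apply/esym; apply: dyad3_le yz; rewrite leq_maxr.
    have mAQ : measurable (A `&` Q).
      by apply: measurableI => //; apply: measurable_dyadic_set; exists n.
    have E : \bigcup_k (dyad_cell m k `&` (A `&` Q)) = A `&` Q.
      by rewrite -setI_bigcupl bigcup_dyad_cell setTI.
    have iAQ : mu.-integrable (A `&` Q) (EFin \o F).
      by apply: (integrableS3 mQ mAQ _ iQ); exact: subIsetr.
    rewrite -E integral_bigcup//.
    + apply: eseries0 => k _ _.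
      have [->|/set0P[y [yk [Ay Qy]]]] := eqVneq (dyad_cell m k `&` (A `&` Q)) set0.
        by rewrite integral_set0.
      rewrite (_ : _ `&` _ = dyad3 m @^-1` [set dyad3 m y]).
        by apply: Z => //; rewrite leq_maxr.
      apply/seteqP; split => z /=.
        by move=> [zk _]; apply: (pcan_inj pickleK); exact: (etrans zk (esym yk)).
      move=> zy; split; first by rewrite /dyad_cell/= zy; exact: yk.
      exact: AQ (esym zy) (conj Ay Qy).
    + by apply: trivIset_setIr; exact: trivIset_dyad_cell.
    + by move=> k; apply: measurableI => //; exact: measurable_dyad_cell.
    + by rewrite E.
  - move=> S mS PS.
    have QE : Q = (S `&` Q) `|` (~` S `&` Q) by rewrite -setIUl setUv setTI.
    have mSQ : measurable (S `&` Q) by exact: (measurableI _ _ mS mQ).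
    have mCQ : measurable (~` S `&` Q) by exact: (measurableI _ _ (measurableC mS) mQ).
    have : (\int[mu]_(z in Q) (F z)%:E = 0)%E by apply: Z.
    rewrite {1}QE (@integral_setU _ _ _ mu (S `&` Q) (~` S `&` Q) _ mSQ mCQ).
    + by rewrite PS add0e.
    + by rewrite -QE; apply/measurable_EFinP; exact: (measurable_funS mD QD mF).
    + by apply/disj_setPS => z [[Sz _] [nSz _]]; exact: nSz.
  - move=> G mG tG PG.
    have mGQ k : measurable (G k `&` Q) by exact: (measurableI _ _ (mG k) mQ).
    rewrite setI_bigcupl (@integral_bigcup _ _ _ mu (fun k => G k `&` Q) _ _ mGQ).
    + by apply: eseries0 => k _ _; exact: PG.
    + exact: trivIset_setIr.
    + rewrite -setI_bigcupl; apply: (integrableS3 mQ _ _ iQ); last exact: subIsetr.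
      by apply: (measurableI _ _ _ mQ); exact: bigcupT_measurable.
have : ae_eq mu Q (EFin \o F) (cst 0%E).
  apply: (@integral_ae_eq _ _ _ mu Q mQ (cst 0%E) (EFin \o F) iQ) => // E EQ mE.
  by rewrite integral0 -[RHS](P E mE) setIidl.
by apply: ae3S => y yQ yx; have [] : (F y)%:E = 0%:E := yQ yx.
Qed.

End fundamental_lemma.

(** * Difference quotients and discrete integration by parts *)

Section difference_quotients.
Context (R : realType).
Implicit Types (phi : pt3 R -> R) (i : 'I_3).
Local Notation e := (@basis R).
Local Notation mu := (@leb3 R).

Lemma test_line_bound (D : set (pt3 R)) phi i (M : R) : test_function D phi ->
  (forall x, `|'D_(e i) phi x| <= M) ->
  forall x s, `|phi (x + s *: e i) - phi x| <= M * `|s|.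
Proof.
move=> tphi phiM.
have pos x s : 0 < s -> `|phi (x + s *: e i) - phi x| <= M * `|s|.
  move=> s0; pose h t := phi (x + t *: e i).
  have dh (t : R) : is_derive t 1 h ('D_(e i) phi (x + t *: e i)).
    by apply: is_derive_line; apply: smooth_derivable; case: tphi.
  have H1 t : t \in `]0, s[ -> is_derive t 1 h ('D_(e i) phi (x + t *: e i)).
    by move=> _; exact: dh.
  have H2 : {within `[0, s], continuous h}.
    by apply: continuous_subspaceT; exact: is_derive_continuous dh.
  have [c _] := MVT s0 H1 H2.
  by rewrite /h scale0r addr0 subr0 => ->; rewrite normrM ler_wpM2r.
move=> x s; have [s0|s0|<-] := ltgtP 0 s; first exact: pos.
  have := pos (x + s *: e i) (- s); rewrite oppr_gt0 => /(_ s0).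
  by rewrite scaleNr addrK distrC normrN.
by rewrite scale0r addr0 subrr normr0 mulr_ge0// (le_trans _ (phiM 0)).
Qed.

Lemma pt3_path (x y : pt3 R) : y = x + (y - x).1.1 *: e ord0 +
  (y - x).1.2 *: e (@Ordinal 3 1 isT) + (y - x).2 *: e (@Ordinal 3 2 isT).
Proof.
apply: coord_inj => k; rewrite !coordD !coordZ.
by case: k => -[|[|[|//]]] ?; rewrite /coord/= ?mulr1 ?mulr0 ?addr0 addrC subrK.
Qed.

(** Only derivatives along the axes are under control, so the two points are joined by a path of
    three segments parallel to the axes. *)
Lemma test_lipschitz (D : set (pt3 R)) phi : test_function D phi ->
  exists2 L, 0 <= L & forall x y, `|phi x - phi y| <= L * `|x - y|.
Proof.
move=> tphi.
have /choice[M phiM] : forall i, exists M, forall x, `|'D_(e i) phi x| <= M.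
  by move=> i; apply: (@test_bounded R D); exact: test_derive.
have M0 i : 0 <= M i by rewrite (le_trans _ (phiM i 0)).
exists (M ord0 + M (@Ordinal 3 1 isT) + M (@Ordinal 3 2 isT)); first by rewrite !addr_ge0.
move=> x y; rewrite distrC [X in _ * X]distrC.
pose z1 := x + (y - x).1.1 *: e ord0.
pose z2 := z1 + (y - x).1.2 *: e (@Ordinal 3 1 isT).
have -> : phi y - phi x = (phi y - phi z2) + (phi z2 - phi z1) + (phi z1 - phi x).
  by ring.
have b0 : `|phi z1 - phi x| <= M ord0 * `|y - x|.
  apply: le_trans (test_line_bound tphi (phiM _) _ _) _.
  by rewrite ler_wpM2l//; exact: (coord_norm ord0 (y - x)).
have b1 : `|phi z2 - phi z1| <= M (@Ordinal 3 1 isT) * `|y - x|.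
  apply: le_trans (test_line_bound tphi (phiM _) _ _) _.
  by rewrite ler_wpM2l//; exact: (coord_norm (@Ordinal 3 1 isT) (y - x)).
have b2 : `|phi y - phi z2| <= M (@Ordinal 3 2 isT) * `|y - x|.
  rewrite [in phi y](pt3_path x y).
  apply: le_trans (test_line_bound tphi (phiM _) _ _) _.
  by rewrite ler_wpM2l//; exact: (coord_norm (@Ordinal 3 2 isT) (y - x)).
rewrite !mulrDl.
have := ler_normD (phi y - phi z2 + (phi z2 - phi z1)) (phi z1 - phi x).
have := ler_normD (phi y - phi z2) (phi z2 - phi z1); lra.
Qed.

Lemma Rintegral_translate (a : pt3 R) (h : pt3 R -> R) :
  mu.-integrable setT (EFin \o (fun x => h (x + a))) -> measurable_fun setT h ->
  \int[mu]_x h (x + a) = \int[mu]_x h x.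
Proof.
move=> ih mh; rewrite /Rintegral; congr fine.
have mt2 b : measurable_fun setT (+%R^~ b : pt2 R -> pt2 R).
  by apply: measurable_fun_pair; apply: measurable_funD => //.
have mt : measurable_fun setT (+%R^~ a : pt3 R -> pt3 R).
  apply: measurable_fun_pair; last by apply: measurable_funD.
  exact: (measurableT_comp (mt2 a.1)).
have mh' : measurable_fun setT (EFin \o h) by exact/measurable_EFinP.
have := @integral_pushforward _ _ (pt3 (measurableTypeR R)) (pt3 (measurableTypeR R)) R _ mt mu
  setT (EFin \o h) mh' ih measurableT.
rewrite preimage_setT => <-; apply: eq_measure_integral => A mA _.
exact: leb3_translate.
Qed.

Lemma integrable_mkcond3 (D : set (pt3 R)) (f : pt3 R -> R) : measurable D ->
  mu.-integrable D (EFin \o f) <-> mu.-integrable setT (EFin \o (f \_ D)).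
Proof.
move=> mD; have := @integrable_mkcond _ _ _ mu D (EFin \o f) mD.
by rewrite (_ : (EFin \o f) \_ D = EFin \o (f \_ D)) ?restrict_EFin.
Qed.

Lemma integrable_cst_indic3 (C : set (pt3 R)) (M : R) : measurable C ->
  (mu C < +oo)%E -> mu.-integrable setT (EFin \o (fun x => M * \1_C x)).
Proof.
move=> mC Cfin.
have LC : L2 mu C (cst M).
  exact: (@L2_bounded _ _ _ mu C (cst M) `|M| mC Cfin (measurable_cst _) (fun x _ => lexx _)).
have := @L2_integrable _ _ _ mu C (cst M) mC Cfin LC.
move=> /(proj1 (integrable_mkcond3 _ mC)).
by congr (mu.-integrable _ _); apply/funext => x /=; rewrite /patch indicE;
  case: ifP => _; rewrite ?mulr1 ?mulr0.
Qed.

Lemma test_integrable (D A : set (pt3 R)) phi : test_function D phi -> measurable A ->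
  mu.-integrable A (EFin \o phi).
Proof.
move=> tphi mA; have [M phiM] := test_bounded tphi.
have [sphi [K [cK _ phi0]]] := tphi.
have mK : measurable K by apply: closed_measurable3; exact: compact_closed3.
have Kfin : (mu K < +oo)%E by apply: leb3_bounded => //; exact: compact_bounded.
apply: (integrableS3 measurableT mA (@subsetT _ A)).
apply: (@le_integrable _ _ _ mu setT measurableT _ _ _ _ (integrable_cst_indic3 M mK Kfin)).
  by apply/measurable_EFinP; exact: (test_measurable tphi).
move=> x _ /=; rewrite lee_fin indicE; have [xK|xK] := boolP (x \in K).
  by rewrite mulr1 (le_trans (phiM x))// ler_norm.
by rewrite phi0 ?normr0// => Kx; move/negP: xK; apply; rewrite inE.
Qed.

(** Discrete integration by parts: a translation moves the difference quotient of [phi] onto the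
    indicator of [A], and dominated convergence identifies the limit. No regularity of [A] is
    required, which makes this a substitute for the divergence theorem. *)
Lemma derive_shift_cvg (A : set (pt3 R)) phi i : measurable A ->
  test_function setT phi ->
  (fun n => n.+1%:R * \int[mu]_x ((\1_A (x - n.+1%:R^-1 *: e i) - \1_A x) * phi x)) @ \oo -->
  \int[mu]_(x in A) 'D_(e i) phi x.
Proof.
move=> mA tphi.
have [M phiM] := test_bounded (test_derive i tphi).
have M0 : 0 <= M by rewrite (le_trans _ (phiM 0)).
have [M' phiM'] := test_bounded tphi.
have M'0 : 0 <= M' by rewrite (le_trans _ (phiM' 0)).
have [sphi [K [cK _ phi0]]] := tphi.
have [N N0 KN] := bounded_cube (compact_bounded cK).
(* The steps are at most 1, so enlarging the cube around the support by 1 captures all translates of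
   [phi] that occur, and [M] times its indicator dominates the quotients. *)
pose C : set (pt3 R) := cube 0 (N + 1).
have mC : measurable C by exact: measurable_cube.
have Cfin : (mu C < +oo)%E by rewrite leb3_cube ?ltry// addr_ge0.
have phiC x : ~ C x -> forall s, `|s| <= 1 -> phi (x + s *: e i) = 0.
  move=> nCx s s1; apply: phi0 => /KN /cubeP h; apply: nCx; apply/cubeP.
  rewrite subr0 in h; rewrite subr0 -(addrK (s *: e i) x) (le_trans (ler_normB _ _))//.
  apply: lerD; first exact: h.
  apply: norm_coord_le => j.
  rewrite coordZ coord_basis normrM -[leRHS]mulr1 ler_pM//.
  by rewrite ger0_norm// lern1 leq_b1.
have tn n : `|n.+1%:R^-1 : R| <= 1 by rewrite ger0_norm// invf_le1// ler1n.
have np n : (0 : R) < n.+1%:R by [].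
pose f_ n x := n.+1%:R * (phi (x + n.+1%:R^-1 *: e i) - phi x).
have cphi : continuous phi by exact: smooth_continuous.
have mphi : measurable_fun setT phi by exact: continuous_measurable3.
have mtr (a : pt3 R) (h : pt3 R -> R) : measurable_fun setT h ->
    measurable_fun setT (fun x : pt3 R => h (x + a)).
  move=> mh; apply: measurableT_comp => //.
  apply: measurable_fun_pair; last by apply: measurable_funD.
  by apply: measurable_fun_pair; apply: measurable_funD => //; exact: measurableT_comp.
have mf_ n : measurable_fun A (f_ n).
  apply: (measurable_funS measurableT (@subsetT _ A)).
  by apply: measurable_funM => //; apply: measurable_funB => //; exact: mtr.
have mdphi : measurable_fun A ('D_(e i) phi).
  by apply: (test_measurable (test_derive i tphi)).
have iC : mu.-integrable setT (EFin \o (fun x => M * \1_C x)).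
  exact: integrable_cst_indic3.
have ig : mu.-integrable A (EFin \o (fun x => M * \1_C x)).
  exact: (integrableS3 measurableT mA (@subsetT _ A) iC).
have tnp n : (0 : R) < n.+1%:R^-1 by rewrite invr_gt0.
have f_le n x : `|f_ n x| <= M * \1_C x.
  rewrite /f_ indicE; have [xC|xC] := boolP (x \in C).
    rewrite mulr1 normrM gtr0_norm//.
    apply: (le_trans (ler_wpM2l (ltW (np n)) (test_line_bound tphi phiM _ _))).
    by rewrite mulrCA gtr0_norm// mulfV ?mulr1// gt_eqF.
  have nCx : ~ C x by move=> h; move/negP: xC; apply; rewrite inE.
  have -> : phi x = 0 by have := phiC x nCx 0; rewrite normr0 scale0r addr0; exact.
  by rewrite phiC ?subrr ?mulr0 ?normr0.
have [|||_ cv] := @dominated3 R A f_ ('D_(e i) phi) (fun x => M * \1_C x) mA mf_ mdphi.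
- move=> x _.
  have cvx : (fun s : R => s^-1 *: ((phi \o shift x) (s *: e i) - phi x)) @ 0^' --> 'D_(e i) phi x.
    have dx : derivable phi x (e i) by exact: smooth_derivable.
    exact: dx.
  have tn0 : (forall n : nat, n.+1%:R^-1 != 0 :> R) /\ (fun n : nat => n.+1%:R^-1 : R) @ \oo --> (0 : R).
    by split; [move=> n; rewrite gt_eqF|exact: cvg_harmonic].
  have := (cvgr_dnbhsP _ _ _).1 cvx _ tn0.
  apply: cvg_trans; apply: near_eq_cvg; apply: nearW => n.
  rewrite /f_ /= /shift/= invrK [x + _]addrC. by [].
- exact: ig.
- by move=> n x _; exact: f_le.
rewrite [X in X @ _ --> _](_ : _ = fun n => \int[mu]_(x in A) f_ n x); first exact: cv.
apply/funext => n.
pose t := n.+1%:R^-1 *: e i.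
pose h x := \1_A (x - t) * phi x.
have mh : measurable_fun setT h.
  by apply: measurable_funM => //; apply: mtr; exact: measurable_indic.
have b1 x : `|\1_A x * f_ n x| <= M * \1_C x.
  rewrite normrM -[leRHS]mul1r ler_pM//.
  by rewrite indicE ger0_norm// lern1 leq_b1.
have iphi : mu.-integrable setT (EFin \o phi) by exact: (test_integrable tphi).
have ih : mu.-integrable setT (EFin \o h).
  apply: (@le_integrable _ _ _ mu setT measurableT _ (EFin \o phi)) => //; first exact/measurable_EFinP.
  move=> x _ /=; rewrite lee_fin normrM -[leRHS]mul1r ler_wpM2r//.
  by rewrite indicE ger0_norm// lern1 leq_b1.
have iAphi : mu.-integrable setT (EFin \o (fun x => \1_A x * phi x)).
  apply: (@le_integrable _ _ _ mu setT measurableT _ (EFin \o phi)) => //.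
    by apply/measurable_EFinP; apply: measurable_funM => //; exact: measurable_indic.
  move=> x _ /=; rewrite lee_fin normrM -[leRHS]mul1r ler_wpM2r//.
  by rewrite indicE ger0_norm// lern1 leq_b1.
have ih' : mu.-integrable setT (EFin \o (fun x => h (x + t))).
  apply: (@le_integrable _ _ _ mu setT measurableT _ _ _ _ (integrable_cst_indic3 M' mC Cfin)).
    by apply/measurable_EFinP; exact: mtr.
  move=> x _ /=; rewrite lee_fin /h addrK normrM.
  have [xC|xC] := boolP (x \in C).
    rewrite [\1_C x]indicE xC mulr1 [leRHS]ger0_norm// -[leRHS]mul1r ler_pM//.
    by rewrite indicE ger0_norm// lern1 leq_b1.
  rewrite /t phiC ?normr0 ?mulr0// => Cx; move/negP: xC; apply; rewrite inE//.
rewrite /f_ [RHS]Rintegral_mkcond.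
transitivity (n.+1%:R * (\int[mu]_x h (x + t) - \int[mu]_x (\1_A x * phi x))).
  rewrite Rintegral_translate// -RintegralB//; congr (_ * _).
  by apply: eq_Rintegral => x _; rewrite /h mulrBl.
have ihB : mu.-integrable setT (EFin \o (fun x => h (x + t) - \1_A x * phi x)).
  exact: (@integrableB _ _ _ mu setT measurableT _ _ ih' iAphi).
rewrite -RintegralB// -RintegralZl//.
apply: eq_Rintegral => x _; rewrite /patch /h addrK indicE.
by case: ifP => _ /=; rewrite ?mul1r ?mul0r ?subr0 ?mulr0.
Qed.

(** For the whole space the two indicators in the difference quotient cancel. *)
Lemma Rintegral_derive0 phi i : test_function setT phi ->
  \int[mu]_x 'D_(e i) phi x = 0.
Proof.
move=> tphi; have := @derive_shift_cvg setT phi i measurableT tphi.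
rewrite (_ : (fun n => _) = fun=> 0); last first.
  apply/funext => n; rewrite /Rintegral (eq_integral (cst 0%E)) ?integral0 ?mulr0//.
  by move=> x _; rewrite !indicE !in_setT subrr mul0r.
by move=> /(cvg_unique _ (@cvg_cst _ _ _ _ _))/esym; apply.
Qed.

End difference_quotients.

(** * Weak derivatives *)

Section weak_partials.
Context (R : realType).
Implicit Types (D E : set (pt3 R)) (f w phi : pt3 R -> R) (i : 'I_3).
Local Notation e := (@basis R).
Local Notation mu := (@leb3 R).

Lemma Rintegral_supp D E f : E `<=` D -> (forall x, D x -> ~ E x -> f x = 0) ->
  \int[mu]_(x in D) f x = \int[mu]_(x in E) f x.
Proof.
move=> ED f0; rewrite Rintegral_mkcond [RHS]Rintegral_mkcond.
apply: eq_Rintegral => x _; rewrite /patch.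
have [xE|xE] := boolP (x \in E).
  by rewrite ifT// inE; apply: ED; rewrite inE in xE.
case: ifPn => // xD; rewrite inE in xD; apply: f0 => // Ex.
by move/negP: xE; apply; rewrite inE.
Qed.

Lemma L2M_test_integrable D E f phi : measurable D -> L2 mu D f -> test_function E phi ->
  mu.-integrable D (EFin \o (fun x => f x * phi x)).
Proof.
move=> mD Lf tphi; exact: (@L2M_integrable _ _ _ mu D f phi mD Lf (test_L2 tphi mD)).
Qed.

(* The defect in the integration by parts that defines weak derivatives. *)
Definition wgap D i f w phi : R :=
  \int[mu]_(x in D) (f x * 'D_(e i) phi x + w x * phi x).

Lemma wgap_integrable D E i f w phi : measurable D -> L2 mu D f -> L2 mu D w ->
  test_function E phi ->
  mu.-integrable D (EFin \o (fun x => f x * 'D_(e i) phi x + w x * phi x)).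
Proof.
move=> mD Lf Lw tphi.
exact: (@integrableD _ _ _ mu D mD _ _
  (L2M_test_integrable mD Lf (test_derive i tphi)) (L2M_test_integrable mD Lw tphi)).
Qed.

Lemma wgapE D E i f w phi : measurable D -> L2 mu D f -> L2 mu D w ->
  test_function E phi ->
  wgap D i f w phi = \int[mu]_(x in D) (f x * 'D_(e i) phi x) + \int[mu]_(x in D) (w x * phi x).
Proof.
move=> mD Lf Lw tphi; rewrite /wgap RintegralD//.
  exact: L2M_test_integrable (test_derive i tphi).
exact: L2M_test_integrable tphi.
Qed.

Lemma weak_partialP D i f w : open D -> L2 mu D f -> L2 mu D w ->
  is_weak_partial D i f w <-> (forall phi, test_function D phi -> wgap D i f w phi = 0).
Proof.
move=> oD Lf Lw; have mD := open_measurable3 oD; split=> H phi tphi.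
  by rewrite (wgapE _ mD Lf Lw tphi) H// addNr.
apply/eqP; rewrite -addr_eq0; apply/eqP.
by rewrite -(wgapE _ mD Lf Lw tphi); exact: H.
Qed.

Lemma wgap_supp D E i f w phi : E `<=` D -> test_function E phi ->
  wgap D i f w phi = wgap E i f w phi.
Proof.
move=> ED [sphi [K [cK KE phi0]]]; apply: Rintegral_supp => // x Dx nEx.
have nKx : ~ K x by move/KE.
by rewrite phi0// (test_derive_out _ (compact_closed3 cK) phi0)// !mulr0 addr0.
Qed.

Lemma wgapD D E i f w phi psi : measurable D -> L2 mu D f -> L2 mu D w ->
  test_function E phi -> test_function E psi ->
  wgap D i f w (fun x => phi x + psi x) = wgap D i f w phi + wgap D i f w psi.
Proof.
move=> mD Lf Lw tphi tpsi; rewrite /wgap -RintegralD//.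
- by apply: eq_Rintegral => x _; rewrite deriveD_smooth; [ring|case: tphi|case: tpsi].
- exact: wgap_integrable tphi.
- exact: wgap_integrable tpsi.
Qed.

Lemma wgapB D E i f g w v phi : measurable D -> L2 mu D f -> L2 mu D w ->
  L2 mu D g -> L2 mu D v -> test_function E phi ->
  wgap D i (f \- g) (w \- v) phi = wgap D i f w phi - wgap D i g v phi.
Proof.
move=> mD Lf Lw Lg Lv tphi; rewrite /wgap -RintegralB//.
- by apply: eq_Rintegral => x _ /=; ring.
- exact: wgap_integrable tphi.
- exact: wgap_integrable tphi.
Qed.

Lemma is_weak_partialS D E i f w : E `<=` D -> is_weak_partial D i f w ->
  is_weak_partial E i f w.
Proof.
move=> ED H phi tphi; have := H phi (test_subset ED tphi).
have [sphi [K [cK KE phi0]]] := tphi.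
have out x : ~ E x -> phi x = 0 by move=> nEx; apply: phi0 => /KE.
have dout x : ~ E x -> 'D_(e i) phi x = 0.
  by move=> nEx; apply: (test_derive_out _ (compact_closed3 cK) phi0) => /KE.
rewrite (Rintegral_supp ED); last by move=> x _ nEx; rewrite dout ?mulr0.
by rewrite (Rintegral_supp ED)// => x _ nEx; rewrite out ?mulr0.
Qed.

Lemma eq_is_weak_partial D i f g w v : (forall x, D x -> f x = g x) ->
  (forall x, D x -> w x = v x) -> is_weak_partial D i f w -> is_weak_partial D i g v.
Proof.
move=> fg wv H phi tphi; have := H phi tphi.
rewrite (@eq_Rintegral _ _ _ mu D (fun x => g x * 'D_(e i) phi x)); last first.
  by move=> x; rewrite inE => /fg ->.
rewrite [in X in _ = X](@eq_Rintegral _ _ _ mu D (fun x => v x * phi x))//.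
by move=> x; rewrite inE => /wv ->.
Qed.

Lemma is_weak_partialB D i f g w v : open D -> L2 mu D f -> L2 mu D w ->
  L2 mu D g -> L2 mu D v -> is_weak_partial D i f w -> is_weak_partial D i g v ->
  is_weak_partial D i (f \- g) (w \- v).
Proof.
move=> oD Lf Lw Lg Lv /(weak_partialP i oD Lf Lw) H1 /(weak_partialP i oD Lg Lv) H2.
have mD := open_measurable3 oD.
have LB := @L2B _ _ _ mu D f g mD Lf Lg.
have LB' := @L2B _ _ _ mu D w v mD Lw Lv.
apply/(weak_partialP i oD LB LB').
by move=> phi tphi; rewrite (wgapB _ mD Lf Lw Lg Lv tphi) H1// H2// subrr.
Qed.

Lemma weak_partial_unique D i f w v : open D -> (mu D < +oo)%E -> L2 mu D w ->
  L2 mu D v -> is_weak_partial D i f w -> is_weak_partial D i f v ->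
  {ae mu, forall x, D x -> w x = v x}.
Proof.
move=> oD Dfin Lw Lv Hw Hv; have mD := open_measurable3 oD.
have LB := @L2B _ _ _ mu D w v mD Lw Lv.
have iB := @L2_integrable _ _ _ mu D _ mD Dfin LB.
have := fundamental_lemma oD iB.
suff /[swap] /[apply] : forall th, box_supported D th ->
    \int[mu]_(x in D) ((w x - v x) * tens th x) = 0.
  by apply: ae3S => x wv Dx; apply/eqP; rewrite -subr_eq0; apply/eqP; exact: wv.
move=> th /box_supported_test tth.
have := Hw _ tth; rewrite (Hv _ tth) => /oppr_inj h.
rewrite (@eq_Rintegral _ _ _ mu D (fun x => w x * tens th x - v x * tens th x)); last first.
  by move=> x _; rewrite mulrBl.
rewrite RintegralB//.
- by rewrite h subrr.
- exact: L2M_test_integrable tth.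
- exact: L2M_test_integrable tth.
Qed.

Lemma weak_partial_spec D i f : H1 D f ->
  L2 mu D (weak_partial D i f) /\ is_weak_partial D i f (weak_partial D i f).
Proof. by move=> [_ /(_ i) H]; exact: (@getPex _ [set w | L2 mu D w /\ is_weak_partial D i f w] H). Qed.

End weak_partials.

(** * Localisation of weak derivatives *)

Section locality.
Context (R : realType).
Implicit Types (D : set (pt3 R)) (f w phi : pt3 R -> R) (i : 'I_3).
Local Notation mu := (@leb3 R).

Lemma compact_cover3 (K : set (pt3 R)) : compact K -> cover_compact K.
Proof. by move=> cK; rewrite -(@compact_cover (pt3 R : normedModType R)). Qed.

(** The transition takes place at distances between [r / 2] and [3 r / 4]: the value is 1 on the
    ball used in finite covers, and the support is a closed cube strictly inside the ball of radius
    [r]. *)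
Definition cutoff (x : pt3 R) (r : R) : pt3 R -> R :=
  tens (fun i => window (coord i x - 3 / 4 * r) (coord i x + 3 / 4 * r) (r / 4)^-1).

Lemma smooth_cutoff x r : smooth (cutoff x r).
Proof. by apply: smooth_tens => i; exact: smooth1_window. Qed.

Lemma cutoff_in x r y : 0 < r -> `|y - x| <= r / 2 -> cutoff x r y = 1.
Proof.
move=> r0 yx; rewrite /cutoff /tens big1// => i _.
have := le_trans (coord_norm i (y - x)) yx; rewrite coordD coordN ler_norml => /andP[h1 h2].
by rewrite window_in ?invr_gt0 ?divr_gt0 ?invrK//; lra.
Qed.

Lemma norm_coord_lt (x : pt3 R) (c : R) : (forall i, `|coord i x| < c) -> `|x| < c.
Proof.
move=> xc; have := xc ord0; have := xc (@Ordinal 3 1 isT); have := xc (@Ordinal 3 2 isT).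
by rewrite /coord/= !prod_normE !gt_max => -> -> ->.
Qed.

Lemma cutoff_out x r y : 0 < r -> 3 / 4 * r <= `|y - x| -> cutoff x r y = 0.
Proof.
move=> r0 ryx.
have /existsNP[i /negP] : ~ (forall i, `|coord i (y - x)| < 3 / 4 * r).
  by move=> /norm_coord_lt; rewrite ltNge ryx.
rewrite -leNgt coordD coordN ler_normr => /orP h.
rewrite /cutoff /tens (bigD1 i)//= window_out ?mul0r//.
  by rewrite invr_ge0 divr_ge0// ltW.
by case: h => h; [right|left]; lra.
Qed.

(* Partition of unity by telescoping: [phi = chi phi + (1 - chi) phi], where the second
   term vanishes near the center of the cutoff [chi]. *)
Lemma wgap_local D i f w : open D -> L2 mu D f -> L2 mu D w ->
  (forall x, D x -> exists2 r, 0 < r & forall phi,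
     test_function (D `&` ball x r) phi -> wgap D i f w phi = 0) ->
  is_weak_partial D i f w.
Proof.
move=> oD Lf Lw loc; apply/(weak_partialP i oD Lf Lw) => phi tphi.
have mD := open_measurable3 oD.
have [sphi [K [cK KD phi0]]] := tphi.
have /choice[r rP] : forall x, exists r, D x -> 0 < r /\ forall phi,
     test_function (D `&` ball x r) phi -> wgap D i f w phi = 0.
  move=> x; have [Dx|nDx] := pselect (D x); last by exists 0.
  by have [r r0 H] := loc x Dx; exists r.
pose U x := ball x (r x / 2).
have := compact_cover3 cK.
move=> /(_ _ K U) [x Kx|x Kx|s sK Ks].
- exact: ball_open.
- exists x => //; apply: ballxx; rewrite divr_gt0//.
  by have [] := rP x (KD _ Kx).
have {}Ks : K `<=` \bigcup_(x in [set` finmap.enum_fset s]) U x by [].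
have {}sK x : x \in finmap.enum_fset s -> D x by move=> xs; apply: KD; have := sK x xs; rewrite inE.
(* [phi] and [K] are generalised: each ball dropped from the cover is also removed from the support,
   so the remaining balls still cover it. Once the list is empty, [phi] is zero. *)
elim: (finmap.enum_fset s) phi K tphi sphi cK KD phi0 Ks sK => {s} [|x s IH] phi K tphi sphi cK KD phi0 Ks sK.
  have p0 y : phi y = 0 by apply: phi0 => /Ks[z].
  rewrite /wgap (_ : phi = fun=> 0); last exact/funext.
  rewrite (@eq_Rintegral _ _ _ mu D (fun=> 0)).
    by rewrite /Rintegral integral0.
  by move=> y _; rewrite -[fun=> 0]/(cst 0) derive_cst !mulr0 addr0.
have [rx Hx] := rP x (sK x (mem_head _ _)).
pose chi := cutoff x (r x).
have schi : smooth chi by exact: smooth_cutoff.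
have snchi : smooth (fun y => 1 + -1 * chi y).
  by apply: smoothD; [exact: smooth_cst|exact: smoothZ].
have t1 : test_function D (fun y => chi y * phi y) by exact: testM_smooth.
have t2 : test_function D (fun y => (1 + -1 * chi y) * phi y) by exact: testM_smooth.
rewrite (_ : phi = fun y => chi y * phi y + (1 + -1 * chi y) * phi y); last first.
  by apply/funext => y; ring.
rewrite (wgapD i mD Lf Lw t1 t2).
have -> : wgap D i f w (fun y => chi y * phi y) = 0.
  apply: Hx; split; first by case: t1.
  exists (K `&` cube x (3 / 4 * r x)); split.
  - apply: (subclosed_compact _ cK) => [|y []//].
    by apply: closedI; [exact: compact_closed3|exact: (compact_closed3 (@compact_cube R x (3 / 4 * r x)))].
  - move=> y [Ky /cubeP yx]; split; first exact: KD.
    by rewrite -ball_normE /ball_/= distrC (le_lt_trans yx)//; lra.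
  - move=> y nKy; have [Ky|/phi0->] := pselect (K y); last by rewrite mulr0.
    rewrite [chi y]cutoff_out ?mul0r// leNgt; apply/negP => yx.
    by apply: nKy; split => //; apply/cubeP; exact: ltW.
rewrite add0r; apply: (IH _ (K `\` U x)) => //.
- by case: t2.
- apply: (subclosed_compact _ cK) => [|y []//].
  apply: closedI; first exact: compact_closed3.
  by apply: open_closedC; exact: ball_open.
- by move=> y [/KD].
- move=> y nKy; have [Ky|/phi0->] := pselect (K y); last by rewrite mulr0.
  have yx : U x y by apply: contrapT => nU; exact: nKy.
  rewrite [chi y]cutoff_in ?mulr1 ?subrr ?mul0r//.
  by move: yx; rewrite /U -ball_normE /ball_/= distrC => /ltW.
- move=> y [Ky nUy]; have [z] := Ks y Ky; rewrite /= inE => /orP[/eqP->//|zs] Uz.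
  by exists z.
- by move=> y ys; apply: sK; rewrite inE ys orbT.
Qed.

End locality.

(** * Fields with vanishing gradient or strain *)

Section du_bois_reymond.
Context (R : realType).
Implicit Types (a b : 'I_3 -> R) (th : 'I_3 -> R -> R) (D : set (pt3 R)).
Local Notation e := (@basis R).
Local Notation mu := (@leb3 R).

Lemma is_derive_step (t : R) :
  is_derive t 1 (@step R) ((antider (@bump R) 0 1)^-1 * bump t).
Proof.
rewrite (_ : @step R = fun t => (antider (@bump R) 0 1)^-1 *: antider (@bump R) 0 t); last first.
  by apply/funext => s; rewrite /step mulrC.
apply: is_deriveZ; apply: is_derive_antider => [|s]; last exact: bump_le0.
exact/smooth1_continuous/smooth1_bump.
Qed.

Lemma integrableM_test D E (f g : pt3 R -> R) : measurable D ->
  mu.-integrable D (EFin \o f) -> test_function E g ->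
  mu.-integrable D (EFin \o (fun x => f x * g x)).
Proof.
move=> mD intf tg; have [M gM] := test_bounded tg.
have iM : mu.-integrable D (EFin \o (fun x => M * f x)) := @integrableZl _ _ _ mu D mD M _ intf.
rewrite (_ : _ \o _ = EFin \o (fun x => g x * f x)); last first.
  by apply/funext => x /=; rewrite mulrC.
apply: (@le_integrable _ _ _ mu D mD _ (EFin \o (fun x => M * f x))).
- apply/measurable_EFinP; apply: measurable_funM; first exact: (test_measurable tg mD).
  by apply/measurable_EFinP; exact: (@measurable_int _ _ _ mu _ _ intf).
- move=> x _ /=; rewrite lee_fin !normrM ler_wpM2r//.
  by rewrite (le_trans (gM x))// ler_norm.
- exact: iM.
Qed.

Lemma ae_open_ex (U : set (pt3 R)) (P : pt3 R -> Prop) x : open U -> U x ->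
  {ae mu, forall y, U y -> P y} -> exists y, U y /\ P y.
Proof.
move=> oU Ux [N [mN N0 UN]]; apply: contrapT => nP.
have /nbhs_ballP[r /= r0 rU] := open_nbhs_nbhs (conj oU Ux).
have cN : cube x (r / 2) `<=` N.
  move=> y /cubeP yx; apply: UN => /= H; apply: nP; exists y; split; last apply: H;
  by apply: rU; rewrite -ball_normE /ball_/= distrC (le_lt_trans yx)//; lra.
have := @leb3_le R _ _ (measurable_cube x (r / 2)) mN cN.
rewrite N0 leb3_cube ?divr_ge0 ?(ltW r0)// lee_fin leNgt exprn_gt0//; lra.
Qed.

Definition supported_in (a b : R) (h : R -> R) : Prop := smooth1 h /\
  exists s t : R, [/\ a < s, t < b & forall x, x <= s \/ t <= x -> h x = 0].

Definition open_box a b : set (pt3 R) := [set x | forall i, a i < coord i x < b i].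

Lemma open_open_box a b : open (open_box a b).
Proof.
have op i : open (coord i @^-1` `]a i, b i[%classic).
  by apply: open_comp => [x _|]; [exact: continuous_coord|exact: interval_open].
have -> : open_box a b = coord ord0 @^-1` `]a ord0, b ord0[%classic `&`
    (coord (@Ordinal 3 1 isT) @^-1` `]a (@Ordinal 3 1 isT), b (@Ordinal 3 1 isT)[%classic `&`
     coord (@Ordinal 3 2 isT) @^-1` `]a (@Ordinal 3 2 isT), b (@Ordinal 3 2 isT)[%classic).
  apply/seteqP; split=> x /=; rewrite !in_itv/=; first by move=> H; split; [|split]; exact: H.
  move=> [h0 [h1 h2]] [[|[|[|//]]] p].
  - by rewrite (_ : Ordinal p = ord0)//; exact: val_inj.
  - by rewrite (_ : Ordinal p = @Ordinal 3 1 isT)//; exact: val_inj.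
  - by rewrite (_ : Ordinal p = @Ordinal 3 2 isT)//; exact: val_inj.
by apply: openI => //; exact: openI.
Qed.

Lemma supported_tens a b th : (forall i, supported_in (a i) (b i) (th i)) ->
  box_supported (open_box a b) th.
Proof.
move=> H; have /choice[a' /choice[b' H']] : forall i, exists s t : R, [/\ a i < s, t < b i &
    forall x, x <= s \/ t <= x -> th i x = 0] by move=> i; have [] := H i.
exists a', b'; split => [i|i t|x /= ab i].
- by have [] := H i.
- by have [_ _] := H' i; exact.
- by have [h1 h2 _] := H' i; have /andP[h3 h4] := ab i; rewrite (lt_le_trans h1)//= (le_lt_trans h4).
Qed.

Lemma tens0 th i x : (forall t, th i t = 0) -> tens th x = 0.
Proof. by move=> th0; rewrite /tens (bigD1 i)//= th0 mul0r. Qed.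

(** If the inner closed box is not empty, its two extreme corners belong to [open_box a b], which
    forces the strict inequalities. If it is empty, some factor vanishes everywhere. *)
Lemma box_supported_supported a b th : box_supported (open_box a b) th ->
  (forall x, tens th x = 0) \/ forall i, supported_in (a i) (b i) (th i).
Proof.
move=> [a' [b' [sth th0 abD]]].
have [ab|/existsNP[i /negP]] := pselect (forall i, a' i <= b' i).
  right=> i; split => //; exists (a' i), (b' i); split; last exact: th0.
    pose x : pt3 R := (a' ord0, a' (@Ordinal 3 1 isT), a' (@Ordinal 3 2 isT)).
    have xE j : coord j x = a' j.
      by case: j => -[|[|[|//]]] p; rewrite /coord/=; congr a'; exact: val_inj.
    have /abD/(_ i) : forall j, a' j <= coord j x <= b' j by move=> j; rewrite xE lexx ab.
    by rewrite xE => /andP[].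
  pose x : pt3 R := (b' ord0, b' (@Ordinal 3 1 isT), b' (@Ordinal 3 2 isT)).
  have xE j : coord j x = b' j.
    by case: j => -[|[|[|//]]] p; rewrite /coord/=; congr b'; exact: val_inj.
  have /abD/(_ i) : forall j, a' j <= coord j x <= b' j by move=> j; rewrite xE lexx ab.
by rewrite xE => /andP[].
rewrite -ltNge => ba; left=> x; apply: (@tens0 _ i) => t; apply: th0.
by have [|h] := leP t (a' i); [left|right; rewrite ltW// (lt_trans ba)].
Qed.

Section box.
Variables (a b : 'I_3 -> R).
Hypothesis ab : forall i, a i < b i.
Let B := open_box a b.

(** The affine map sends the middle half of [[a i, b i]] onto [[0, 1]]. Hence [ramp i] rises from 0
    to 1 well inside the interval, and its derivative [rho i] is a bump of mass one supported
    there. *)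
Let slope i := 2 / (b i - a i).
Let offset i := - (slope i * ((3 * a i + b i) / 4)).
Let ramp i t := step (slope i * t + offset i).
Let rho i t := slope i * ((antider (@bump R) 0 1)^-1 * bump (slope i * t + offset i)).

Let slope_gt0 i : 0 < slope i.
Proof. by rewrite /slope divr_gt0// subr_gt0. Qed.

Let slopeM i : slope i * (b i - a i) = 2.
Proof. by rewrite /slope divfK// subr_eq0 gt_eqF. Qed.

Let ramp_derive i (t : R) : is_derive t 1 (ramp i) (rho i t).
Proof.
rewrite /rho mulrC.
exact: (@is_derive1_comp _ (@step R) (fun t => slope i * t + offset i) t _ _
  (is_derive_step _) (is_derive_affine _ _ _)).
Qed.

Let low i t : t <= (3 * a i + b i) / 4 -> slope i * t + offset i <= 0.
Proof. by move=> h; rewrite /offset -mulrBr pmulr_rle0// subr_le0. Qed.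

Let high i t : (a i + 3 * b i) / 4 <= t -> 1 <= slope i * t + offset i.
Proof.
move=> h; rewrite /offset -mulrBr.
have h2 : 1 = slope i * ((b i - a i) / 2) by rewrite mulrA slopeM divff.
by rewrite [leLHS]h2 ler_pM2l//; lra.
Qed.

Let rho_supported i : supported_in (a i) (b i) (rho i).
Proof.
split=> [n|].
  by apply: C1nZ; apply: C1nZ; apply: C1n_affine; exact: smooth1_bump.
have abi := ab i; exists ((3 * a i + b i) / 4), ((a i + 3 * b i) / 4); split; [lra|lra|].
by move=> t; rewrite /rho => -[/low/bump_le0 ->|/high/bump_ge1 ->]; rewrite !mulr0.
Qed.

Let mass i (h : R -> R) := antider h (a i) (b i).

(* Up to its mass times a fixed bump [rho i], the factor [th i] is the derivative of a
   compactly supported function. *)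
Lemma tens_reduce (f : pt3 R -> R) i th : mu.-integrable B (EFin \o f) ->
  (forall i th, (forall j, supported_in (a j) (b j) (th j)) ->
    \int[mu]_(x in B) (f x * 'D_(e i) (tens th) x) = 0) ->
  (forall j, supported_in (a j) (b j) (th j)) ->
  \int[mu]_(x in B) (f x * tens th x) =
  mass i (th i) * \int[mu]_(x in B) (f x * tens (upd th i (rho i)) x).
Proof.
move=> intf H sth; have [sthi [a' [b' [aa bb th0]]]] := sth i.
have cthi := smooth1_continuous sthi.
have thia t : t <= a i -> th i t = 0 by move=> ta; apply: th0; left; rewrite (le_trans ta)// ltW.
pose m := mass i (th i).
pose eta t := antider (th i) (a i) t - m * ramp i t.
pose h t := th i t - m * rho i t.
have deta (t : R) : is_derive t 1 eta (h t).
  apply: is_deriveB; first exact: is_derive_antider.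
  exact: (@is_deriveZ _ _ _ (ramp i) m t 1 _ (ramp_derive i t)).
have sh : smooth1 h.
  move=> n; rewrite (_ : h = fun t => th i t + (- m) * rho i t); last first.
    by apply/funext => t; rewrite /h mulNr.
  by apply: C1nD => //; apply: C1nZ; have [] := rho_supported i.
have supp_upd g : supported_in (a i) (b i) g -> forall j, supported_in (a j) (b j) (upd th i g j).
  by move=> sg j; rewrite /upd; case: eqP => [->|].
have seta : supported_in (a i) (b i) eta.
  have abi := ab i.
  split; first exact: smooth1_antiderivative deta sh.
  exists (Num.min a' ((3 * a i + b i) / 4)), (Num.max b' ((a i + 3 * b i) / 4)); split.
  - by rewrite lt_min aa/=; lra.
  - by rewrite gt_max bb/=; lra.
  move=> t; rewrite le_min ge_max => -[] /andP[h1 h2]; rewrite /eta.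
    rewrite /ramp (step_le0 (low h2)) mulr0 subr0.
    have fa s : s <= a' -> th i s = 0 by move=> sa; apply: th0; left.
    have [] := pselect (t <= a i) => [/(antider_le thia)//|/negP]; rewrite -ltNge => at_.
    have [||c] := @MVT R (antider (th i) (a i)) (th i) (a i) t at_.
    - by move=> y _; exact: is_derive_antider.
    - apply: continuous_subspaceT; exact: is_derive_continuous (is_derive_antider cthi thia).
    rewrite in_itv/= => /andP[_ ct]; rewrite fa ?(ltW (lt_le_trans ct h1))// mul0r.
    by rewrite (antider_le thia (lexx _)) subr0.
  have fb s : b' <= s -> th i s = 0 by move=> sa; apply: th0; right.
  rewrite /ramp (step_ge1 (high h2)) mulr1 /m /mass.
  by rewrite (antider_cst cthi thia fb h1) (antider_cst cthi thia fb (ltW bb)) subrr.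
have := H i _ (supp_upd _ seta).
have Deta x : 'D_(e i) (tens (upd th i eta)) x = tens th x - m * tens (upd th i (rho i)) x.
  have du (t : R) : is_derive t 1 (upd th i eta i) (h t) by rewrite /upd eqxx; exact: deta.
  rewrite (derive_tens x du).
  rewrite (tens_upd _ _ (rho i)) tens_upd /h /tens [X in _ = X - _](bigD1 i)//=.
  rewrite (eq_bigr (fun j => th j (coord j x))); last by move=> j /negbTE ji; rewrite /upd ji.
  by ring.
have oB : open B by exact: open_open_box.
have mB := open_measurable3 oB.
rewrite (@eq_Rintegral _ _ _ mu B (fun x => f x * tens th x -
    m * (f x * tens (upd th i (rho i)) x))); last first.
  by move=> x _; rewrite Deta; ring.
have i1 := integrableM_test mB intf (box_supported_test (supported_tens sth)).
have i2 := integrableM_test mB intf (box_supported_test (supported_tens (supp_upd _ (rho_supported i)))).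
rewrite RintegralB//; last exact: (@integrableZl _ _ _ mu B mB m _ i2).
by rewrite RintegralZl// => /eqP; rewrite subr_eq0 => /eqP.
Qed.

Lemma tens_mean (f : pt3 R -> R) th : mu.-integrable B (EFin \o f) ->
  (forall i th, (forall j, supported_in (a j) (b j) (th j)) ->
    \int[mu]_(x in B) (f x * 'D_(e i) (tens th) x) = 0) ->
  (forall j, supported_in (a j) (b j) (th j)) ->
  \int[mu]_(x in B) (f x * tens th x) =
  (\prod_i mass i (th i)) * \int[mu]_(x in B) (f x * tens rho x).
Proof.
move=> intf H sth.
have supp_upd th' i : (forall j, supported_in (a j) (b j) (th' j)) ->
    forall j, supported_in (a j) (b j) (upd th' i (rho i) j).
  by move=> sg j; rewrite /upd; case: eqP => [->|].
rewrite (tens_reduce ord0 intf H sth).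
rewrite (tens_reduce (@Ordinal 3 1 isT) intf H (supp_upd _ _ sth)).
rewrite (tens_reduce (@Ordinal 3 2 isT) intf H (supp_upd _ _ (supp_upd _ _ sth))).
rewrite !big_ord_recl big_ord0 mulr1 !mulrA; congr (_ * _ * _ * _).
- by rewrite /upd/=; congr (mass _ (th _)); exact: val_inj.
- by rewrite /upd/=; congr (mass _ (th _)); exact: val_inj.
apply: eq_Rintegral => x _; congr (_ * _); apply: eq_bigr => i _; rewrite /upd.
case: i => -[|[|[|//]]] p /=; first by rewrite /=; congr rho; exact: val_inj.
  by congr rho; exact: val_inj.
by congr rho; exact: val_inj.
Qed.

Lemma open_box_neq0 : exists x, B x.
Proof.
exists ((a ord0 + b ord0) / 2, (a (@Ordinal 3 1 isT) + b (@Ordinal 3 1 isT)) / 2,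
  (a (@Ordinal 3 2 isT) + b (@Ordinal 3 2 isT)) / 2).
move=> i; have := ab i; have -> : coord i ((a ord0 + b ord0) / 2, (a (@Ordinal 3 1 isT) + b (@Ordinal 3 1 isT)) / 2,
  (a (@Ordinal 3 2 isT) + b (@Ordinal 3 2 isT)) / 2) = (a i + b i) / 2.
  by case: i => -[|[|[|//]]] p; rewrite /coord/=; congr ((a _ + b _) / 2); exact: val_inj.
by move=> abi; apply/andP; split; lra.
Qed.

Lemma leb3_open_box_fin : (mu B < +oo)%E.
Proof.
apply: leb3_bounded; first exact: open_measurable3 (@open_open_box a b).
pose M := \sum_i (`|a i| + `|b i|).
exists M; split; first exact: num_real.
move=> M' MM' x Bx; apply: le_trans (ltW MM'); apply: norm_coord_le => i.
rewrite /M (bigD1 i)//=.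
apply: (@le_trans _ _ (`|a i| + `|b i|)); last by rewrite lerDl sumr_ge0// => j _; rewrite addr_ge0.
have /andP[h1 h2] := Bx i.
have := ler_norm (b i); have := ler_norm (- a i); rewrite normrN.
have := normr_ge0 (a i); have := normr_ge0 (b i).
by move: `|a i| `|b i| => p q; rewrite ler_norml; lra.
Qed.

(** By [tens_mean], a function with zero weak gradient is determined on tensor products by its
    integral against [tens rho]. The constant [c] is chosen so that this integral vanishes for
    [f - c], and the fundamental lemma applies. *)
Theorem du_bois_reymond (f : pt3 R -> R) : mu.-integrable B (EFin \o f) ->
  (forall i th, (forall j, supported_in (a j) (b j) (th j)) ->
    \int[mu]_(x in B) (f x * 'D_(e i) (tens th) x) = 0) ->
  exists c, {ae mu, forall x, B x -> f x = c}.
Proof.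
move=> intf H.
have oB : open B by exact: open_open_box.
have mB := open_measurable3 oB.
have int1 : mu.-integrable B (EFin \o cst 1).
  have c1 : measurable_fun B (cst 1 : pt3 R -> R) by exact: measurable_cst.
  have L1 := @L2_bounded _ _ _ mu B (cst 1) 1 mB leb3_open_box_fin c1.
  apply: (@L2_integrable _ _ _ mu B _ mB leb3_open_box_fin); apply: L1 => x _.
  by rewrite /cst normr1.
have H1 i th : (forall j, supported_in (a j) (b j) (th j)) ->
    \int[mu]_(x in B) (cst 1 x * 'D_(e i) (tens th) x) = 0.
  move=> /supported_tens/box_supported_test tth.
  rewrite -(Rintegral_derive0 i (test_subset (@subsetT _ _) tth)).
  rewrite [RHS](@Rintegral_supp _ setT B)//; last first.
    by move=> x _ nBx; exact: (test_zero (test_derive i tth) nBx).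
  by apply: eq_Rintegral => x _; rewrite mul1r.
pose J := \int[mu]_(x in B) (cst 1 x * tens rho x).
have zero_case th x0 : (forall x, tens th x = 0) -> \int[mu]_(x in B) (x0 x * tens th x) = 0.
  move=> th0; rewrite (@eq_Rintegral _ _ _ mu B (fun=> 0)).
    by rewrite /Rintegral integral0.
  by move=> x _; rewrite th0 mulr0.
(* If [J] were zero, the constant function 1, whose weak gradient also vanishes, would be orthogonal
   to all tests and hence zero. *)
have J0 : J != 0.
  apply/eqP => J0; have := @fundamental_lemma R B (cst 1) oB int1.
  have F th : box_supported B th -> \int[mu]_(x in B) (cst 1 x * tens th x) = 0.
    move=> /box_supported_supported[|sth]; first exact: zero_case.
    by rewrite (tens_mean int1 H1 sth) -/J J0 mulr0.
  move=> /(_ F); have [x Bx] := open_box_neq0.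
  by move=> /(ae_open_ex oB Bx)[y [_ /eqP]]; rewrite /cst oner_eq0.
pose c := (\int[mu]_(x in B) (f x * tens rho x)) / J.
exists c.
have intc : mu.-integrable B (EFin \o (fun x => f x - c * cst 1 x)).
  exact: (@integrableB _ _ _ mu B mB _ _ intf (@integrableZl _ _ _ mu B mB c _ int1)).
have lin g : test_function B g -> \int[mu]_(x in B) ((f x - c * cst 1 x) * g x) =
    \int[mu]_(x in B) (f x * g x) - c * \int[mu]_(x in B) (cst 1 x * g x).
  move=> tg; have i1 := integrableM_test mB intf tg; have i2 := integrableM_test mB int1 tg.
  rewrite -(RintegralZl _ _ i2)// -RintegralB//; last exact: (@integrableZl _ _ _ mu B mB c _ i2).
  by apply: eq_Rintegral => x _; rewrite /cst; ring.
have Hc i th : (forall j, supported_in (a j) (b j) (th j)) ->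
    \int[mu]_(x in B) ((f x - c * cst 1 x) * 'D_(e i) (tens th) x) = 0.
  move=> sth; have tth := test_derive i (box_supported_test (supported_tens sth)).
  by rewrite (lin _ tth) H// H1// mulr0 subrr.
suff : {ae mu, forall x, B x -> f x - c * cst 1 x = 0}.
  by apply: ae3S => x fc /fc/eqP; rewrite mulr1 subr_eq0 => /eqP.
apply: fundamental_lemma => // th.
move=> /box_supported_supported[|sth]; first exact: zero_case.
rewrite (tens_mean intc Hc sth) (lin _ (box_supported_test (supported_tens rho_supported))).
by rewrite -/J /c divfK// subrr mulr0.
Qed.

End box.
End du_bois_reymond.

Lemma ae_eq_Rintegral d (T : measurableType d) (R : realType)
    (mu : {measure set T -> \bar R}) (D : set T) (f g : T -> R) :
  measurable D -> measurable_fun D f -> measurable_fun D g ->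
  {ae mu, forall x, D x -> f x = g x} ->
  \int[mu]_(x in D) f x = \int[mu]_(x in D) g x.
Proof.
move=> mD mf mg fg; congr fine; apply: ae_eq_integral => //; try exact/measurable_EFinP.
by apply: filterS fg => x fg Dx; rewrite fg.
Qed.

(** * Rigidity of fields with zero strain *)

Section rigidity.
Context (R : realType).
Implicit Types (D U : set (pt3 R)) (i j k l : 'I_3) (b : 'I_3 -> R).
Local Notation e := (@basis R).
Local Notation mu := (@leb3 R).

Definition lin b (x : pt3 R) : R := \sum_k b k * coord k x.

Lemma smooth_lin b : smooth (lin b).
Proof.
have sc k : smooth (@coord R k).
  apply: (@smooth_coord R id k) => n; have -> : id = (fun t : R => 1 * t + 0).
    by apply/funext => t; rewrite mul1r addr0.
  case: n => [//|n].
  by exists (fun=> 1) => [x|]; [exact: is_derive_affine|exact: C1n_cst].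
rewrite (_ : lin b = fun x => b ord0 * coord ord0 x +
   (b (lift ord0 ord0) * coord (lift ord0 ord0) x +
    (b (lift ord0 (lift ord0 ord0)) * coord (lift ord0 (lift ord0 ord0)) x))).
  by apply: smoothD; [|apply: smoothD]; exact: smoothZ.
by apply/funext => x; rewrite /lin !big_ord_recl big_ord0 addr0.
Qed.

Lemma linD_basis b (x : pt3 R) (s : R) l : lin b (x + s *: e l) = lin b x + s * b l.
Proof.
rewrite /lin (eq_bigr (fun k => b k * coord k x + s * b k * (k == l)%:R)); last first.
  by move=> k _; rewrite coordD coordZ coord_basis; ring.
rewrite big_split/=; congr (_ + _); rewrite (bigD1 l)//= eqxx mulr1.
by rewrite big1 ?addr0// => k /negbTE ->; rewrite mulr0.
Qed.

Lemma derive_lin b l (x : pt3 R) : 'D_(e l) (lin b) x = b l.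
Proof.
apply: cvg_lim => //; apply: cvg_near_cst; near=> s.
have s0 : s != 0 by near: s; exact: nbhs_dnbhs_neq.
by rewrite /= [X in lin b X - _]addrC linD_basis addrAC subrr add0r /GRing.scale/= mulKf.
Unshelve. all: by end_near. Qed.

Lemma affine_eq0 U b (c : R) (x : pt3 R) : open U -> U x ->
  {ae mu, forall y, U y -> lin b y + c = 0} -> c = 0 /\ forall k, b k = 0.
Proof.
move=> oU Ux aeU.
have cl : continuous (fun y => lin b y + c).
  by move=> y; apply: cvgD; [exact: (smooth_continuous (smooth_lin b))|exact: cvg_cst].
have H y : U y -> lin b y + c = 0.
  move=> Uy; apply/eqP; apply: contrapT => /negP ny.
  have oV : open (U `&` (fun y => lin b y + c) @^-1` [set~ 0]).
    by apply: openI => //; apply: open_comp => [z _|]; [exact: cl|exact: (closed_openC (@closed_eq R 0))].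
  have /(ae_open_ex oV) : {ae mu, forall y, (U `&` (fun y => lin b y + c) @^-1` [set~ 0]) y -> lin b y + c = 0}.
    by apply: ae3S aeU => z H [/H].
  by move=> /(_ y)[|z [[_ /=]]]//; split => //; apply/eqP.
have b0 k : b k = 0.
  have /nbhs_ballP[r /= r0 rU] := open_nbhs_nbhs (conj oU Ux).
  have : U (x + (r / 2) *: e k).
    apply: rU; rewrite -ball_normE /ball_/= opprD addrA subrr add0r normrN.
    apply: (@le_lt_trans _ _ (r / 2)); last lra.
    apply: norm_coord_le => j; rewrite coordZ coord_basis normrM (ger0_norm (divr_ge0 (ltW r0) _))//.
    by rewrite ger0_norm ?ler0n// ler_piMr ?divr_ge0 ?(ltW r0)// lern1 leq_b1.
  move=> /H; rewrite linD_basis addrAC H// add0r => /eqP.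
  by rewrite mulf_eq0 gt_eqF ?divr_gt0//= => /eqP.
split => //; have := H x Ux; rewrite /lin big1 ?add0r// => k _; by rewrite b0 mul0r.
Qed.

(** Derivatives in two distinct directions act on different factors of the product, so their
    commutation is a matter of rewriting. *)
Lemma derive_tens_comm (th : 'I_3 -> R -> R) k l : (forall i, smooth1 (th i)) ->
  'D_(e k) ('D_(e l) (tens th)) = 'D_(e l) ('D_(e k) (tens th)).
Proof.
move=> sth; have [->//|kl] := eqVneq k l.
have /choice[h dh] : forall i, exists h : R -> R, forall t : R, is_derive t 1 (th i) (h t).
  by move=> i; have [h ? _] := sth i 1%N; exists h.
have E i : 'D_(e i) (tens th) = tens (upd th i (h i)).
  by apply/funext => x; exact: derive_tens.
have F i j : i != j -> 'D_(e i) (tens (upd th j (h j))) = tens (upd (upd th j (h j)) i (h i)).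
  move=> ij; apply/funext => x; apply: derive_tens => t.
  by rewrite /upd (negbTE ij).
rewrite (E k) (E l) (F k l)// (F l k) 1?eq_sym//.
congr tens; apply/funext => i; rewrite /upd.
by case: eqP => // ->; rewrite (negbTE kl).
Qed.

Section local.
Variables (a b : 'I_3 -> R) (v : 'I_3 -> pt3 R -> R) (W : 'I_3 -> 'I_3 -> pt3 R -> R).
Hypothesis ab : forall i, a i < b i.
Let B := open_box a b.
Hypotheses (Lv : forall i, L2 mu B (v i)) (LW : forall i j, L2 mu B (W i j)).
Hypothesis vW : forall i j, is_weak_partial B j (v i) (W i j).
Hypothesis W0 : forall i j, {ae mu, forall x, B x -> W i j x + W j i x = 0}.

Let oB : open B. Proof. exact: open_open_box. Qed.
Let mB : measurable B. Proof. exact: open_measurable3. Qed.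
Let Bfin : (mu B < +oo)%E. Proof. exact: leb3_open_box_fin. Qed.

(* [A j k l] is symmetric in [(k, l)] by commutation of derivatives and antisymmetric in
   [(j, k)] since the strain is zero, so it vanishes. *)
Lemma rigid_gradient_cst j k : exists c, {ae mu, forall x, B x -> W j k x = c}.
Proof.
apply: du_bois_reymond => // [|l th sth].
  exact: (@L2_integrable _ _ _ mu B _ mB Bfin (LW j k)).
pose A j k l := \int[mu]_(x in B) (W j k x * 'D_(e l) (tens th) x).
have tth := box_supported_test (supported_tens sth).
have Asym p q r : A p q r = A p r q.
  rewrite /A.
  have h1 := vW p q (test_derive r tth); have h2 := vW p r (test_derive q tth).
  have sth' i : smooth1 (th i) by have [] := sth i.
  have h x : 'D_(e r) ('D_(e q) (tens th)) x = 'D_(e q) ('D_(e r) (tens th)) x.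
    exact: (congr1 (fun f => f x) (derive_tens_comm r q sth')).
  have E : \int[mu]_(x in B) (v p x * 'D_(e q) ('D_(e r) (tens th)) x) =
      \int[mu]_(x in B) (v p x * 'D_(e r) ('D_(e q) (tens th)) x).
    by apply: eq_Rintegral => x _; rewrite h.
  exact: (oppr_inj (etrans (esym h1) (etrans E h2))).
have Aanti p q r : A p q r = - A q p r.
  apply/eqP; rewrite -addr_eq0 /A -RintegralD//.
  - have mt := test_measurable (test_derive r tth) mB.
    have m1 := measurable_funM (@L2_measurable _ _ _ mu B _ mB (LW p q)) mt.
    have m2 := measurable_funM (@L2_measurable _ _ _ mu B _ mB (LW q p)) mt.
    have ae0 : {ae mu, forall x, B x ->
        W p q x * 'D_(e r) (tens th) x + W q p x * 'D_(e r) (tens th) x = 0}.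
      by apply: ae3S (W0 p q) => x + Bx => /(_ Bx) h; rewrite -mulrDl h mul0r.
    rewrite (@ae_eq_Rintegral _ _ _ mu B _ (fun=> 0) mB (measurable_funD m1 m2) (measurable_cst _) ae0).
    by rewrite /Rintegral integral0.
  - exact: (L2M_test_integrable mB (LW p q) (test_derive r tth)).
  - exact: (L2M_test_integrable mB (LW q p) (test_derive r tth)).
(* The chain is [A j k l = - A k j l = - A k l j = A l k j = A l j k = - A j l k = - A j k l]. *)
have : A j k l = - A j k l.
  by rewrite {1}Aanti {1}Asym {1}Aanti opprK {1}Asym {1}Aanti {1}Asym.
by rewrite /A; lra.
Qed.

(** Once the gradient of [v j] is a constant vector [c], the field [v j - lin c] has zero weak
    gradient and [du_bois_reymond] applies to it. Testing [lin c] amounts to the Leibniz rule and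
    the vanishing integral of a derivative. *)
Lemma rigid_affine j : exists c, exists d,
  {ae mu, forall x, B x -> v j x = lin c x + d}.
Proof.
have /choice[c cP] : forall k, exists c, {ae mu, forall x, B x -> W j k x = c}.
  by move=> k; exact: rigid_gradient_cst.
exists c.
have Llin : L2 mu B (lin c).
  pose M := \sum_k `|c k| * (`|a k| + `|b k|).
  apply: (@L2_bounded _ _ _ mu B _ M mB Bfin).
    exact: (measurable_funS measurableT (@subsetT _ _) (continuous_measurable3 (smooth_continuous (smooth_lin c)))).
  move=> x Bx; rewrite /lin (le_trans (ler_norm_sum _ _ _))//; apply: ler_sum => k _.
  rewrite normrM ler_wpM2l//; have /andP[h1 h2] := Bx k.
  have := ler_norm (b k); have := ler_norm (- a k); rewrite normrN.
  have := normr_ge0 (a k); have := normr_ge0 (b k).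
  by move: `|a k| `|b k| => p q; rewrite ler_norml; lra.
have LB := @L2B _ _ _ mu B (v j) (lin c) mB (Lv j) Llin.
have [||d dP] := @du_bois_reymond R a b ab (v j \- lin c).
- exact: (@L2_integrable _ _ _ mu B _ mB Bfin LB).
- move=> l th sth; have tth := box_supported_test (supported_tens sth).
  rewrite (@eq_Rintegral _ _ _ mu B (fun x => v j x * 'D_(e l) (tens th) x - lin c x * 'D_(e l) (tens th) x)); last first.
    by move=> x _ /=; ring.
  rewrite RintegralB//.
  + rewrite (vW j l tth).
    have -> : \int[mu]_(x in B) (W j l x * tens th x) = \int[mu]_(x in B) (c l * tens th x).
      have mt := test_measurable tth mB.
      have m1 := measurable_funM (@L2_measurable _ _ _ mu B _ mB (LW j l)) mt.
      have m2 : measurable_fun B (fun x => c l * tens th x).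
        exact: (measurable_funM (measurable_cst (c l)) mt).
      apply: (@ae_eq_Rintegral _ _ _ mu B _ _ mB m1 m2).
      by apply: ae3S (cP l) => x h Bx; rewrite /= (h Bx).
    have t1 := testM_smooth (smooth_lin c) tth.
    have := Rintegral_derive0 l (test_subset (@subsetT _ _) t1).
    rewrite (@Rintegral_supp _ setT B)//; last first.
      by move=> x _ nBx; exact: (test_zero (test_derive l t1) nBx).
    rewrite (@eq_Rintegral _ _ _ mu B (fun x => lin c x * 'D_(e l) (tens th) x + c l * tens th x)); last first.
      move=> x _; rewrite deriveM_smooth; [|exact: smooth_lin|exact: test_smooth tth].
      by rewrite derive_lin; ring.
    rewrite RintegralD//.
    * by move=> h; apply/eqP; rewrite -oppr_eq0 opprB opprK h.
    * exact: (L2M_test_integrable mB Llin (test_derive l tth)).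
    * exact: (@integrableZl _ _ _ mu B mB (c l) _ (test_integrable tth mB)).
  + exact: (L2M_test_integrable mB (Lv j) (test_derive l tth)).
  + exact: (L2M_test_integrable mB Llin (test_derive l tth)).
by exists d; apply: ae3S dP => x h Bx; rewrite -(h Bx) /=; ring.
Qed.

Lemma rigid_unique_box U x : open U -> U x -> U `<=` B ->
  (forall j, {ae mu, forall y, U y -> v j y = 0}) ->
  forall j, {ae mu, forall y, B y -> v j y = 0}.
Proof.
move=> oU Ux UB v0 j; have [c [d cd]] := rigid_affine j.
have [|d0 c0] := @affine_eq0 U c d x oU Ux.
  by apply: ae3S (ae3I cd (v0 j)) => y [h1 h2] Uy; rewrite -(h1 (UB _ Uy)) h2.
apply: ae3S cd => y h By; rewrite h// d0 addr0 /lin big1// => k _.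
by rewrite c0 mul0r.
Qed.

End local.

Definition cube_box (x : pt3 R) (r : R) := open_box (fun i => coord i x - r) (fun i => coord i x + r).

Lemma cube_boxP x r y : cube_box x r y <-> `|y - x| < r.
Proof.
split=> [H|yx i].
  apply: norm_coord_lt => i; rewrite coordD coordN ltr_norml.
  by have /andP[] := H i; lra.
have := le_lt_trans (coord_norm i (y - x)) yx; rewrite coordD coordN ltr_norml => /andP[].
by move=> h1 h2; apply/andP; split; lra.
Qed.

(** The points of [D] near which [v] vanishes form a set that is open and closed in [D]. For
    closedness, a cube around a limit point meets the open set where [v] is zero, and an affine
    function that vanishes on an open set is zero on the whole cube. *)
Theorem strain0_unique D U x (v : 'I_3 -> pt3 R -> R) (W : 'I_3 -> 'I_3 -> pt3 R -> R) :
  open D -> connected D -> (forall i, L2 mu D (v i)) -> (forall i j, L2 mu D (W i j)) ->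
  (forall i j, is_weak_partial D j (v i) (W i j)) ->
  (forall i j, {ae mu, forall x, D x -> W i j x + W j i x = 0}) ->
  open U -> U x -> U `<=` D -> (forall j, {ae mu, forall y, U y -> v j y = 0}) ->
  forall j, {ae mu, forall y, D y -> v j y = 0}.
Proof.
move=> oD cD Lv LW vW W0 oU Ux UD v0.
pose Z : set (pt3 R) := [set y | D y /\ exists2 V, open V /\ V y & forall j, {ae mu, forall z, V z -> v j z = 0}].
have loc y r : D y -> 0 < r -> cube_box y r `<=` D -> forall V z, open V -> V z -> V `<=` cube_box y r ->
  (forall j, {ae mu, forall z, V z -> v j z = 0}) -> forall j, {ae mu, forall z, cube_box y r z -> v j z = 0}.
  move=> Dy r0 yD V z oV Vz VB vV.
  have mB := open_measurable3 (@open_open_box R (fun i => coord i y - r) (fun i => coord i y + r)).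
  apply: (@rigid_unique_box _ _ v W _ _ _ _ _ V z) => // [i|i|i k|i k|i k].
  - by lra.
  - exact: (@L2S _ _ _ mu D _ _ (open_measurable3 oD) mB yD (Lv i)).
  - exact: (@L2S _ _ _ mu D _ _ (open_measurable3 oD) mB yD (LW i k)).
  - exact: is_weak_partialS (vW i k).
  - by apply: ae3S (W0 i k) => t h /yD.
have DZ : D = Z.
  apply/esym; apply: cD.
  - by exists x; split; [exact: UD|exists U].
  - exists Z; last by apply/seteqP; split=> [z Zz|z []//]; split => //; case: Zz.
    rewrite openE => y [Dy [V [oV Vy] vV]].
    have : nbhs y (D `&` V) by apply: open_nbhs_nbhs; split => //; exact: openI.
    apply: filterS => z [Dz Vz]; split => //; by exists V.
  - exists (closure Z); first exact: closed_closure.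
    apply/seteqP; split=> [z Zz|y [Dy cZy]].
      by split; [case: Zz|exact: subset_closure].
    have /nbhs_ballP[r /= r0 rD] := open_nbhs_nbhs (conj oD Dy).
    have yD : cube_box y r `<=` D.
      by move=> z /cube_boxP zy; apply: rD; rewrite -ball_normE /ball_/= distrC.
    have nB : nbhs y (cube_box y r).
      apply: open_nbhs_nbhs; split; first exact: open_open_box.
      by apply/cube_boxP; rewrite subrr normr0.
    have [z [[Dz [V [oV Vz] vV]] Bz]] := cZy _ nB.
    split => //; exists (cube_box y r).
      split; first exact: open_open_box.
      by apply/cube_boxP; rewrite subrr normr0.
    apply: (@loc y r Dy r0 yD (V `&` cube_box y r) z) => //.
    - apply: openI => //; exact: open_open_box.
    - by move=> j; apply: ae3S (vV j) => t h [/h].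
move=> j; apply: ae_openP => y; rewrite {1}DZ => -[_ [V oV vV]].
by exists V.
Qed.

End rigidity.

(** * Boundary charts *)

Lemma lip_continuous (R : realType) (U V : normedModType R) (f : U -> V) (L : R) :
  (forall x y, `|f x - f y| <= L * `|x - y|) -> continuous f.
Proof.
move=> fL x; apply/cvgrPdist_le => e e0.
have L0 : 0 < `|L| + 1 by rewrite ltr_wpDl.
near=> y; apply: (le_trans (fL x y)).
apply: (@le_trans _ _ ((`|L| + 1) * `|x - y|)).
  by rewrite ler_wpM2r// (le_trans (ler_norm _))// lerDl.
rewrite mulrC -ler_pdivlMr//; near: y.
by apply: cvgr_dist_le; [exact: cvg_id|rewrite divr_gt0].
Unshelve. all: by end_near. Qed.

Section charts.
Context (R : realType).
Implicit Types (c : chart R) (D A : set (pt3 R)) (x y z : pt3 R) (i j : 'I_3).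
Local Notation mu := (@leb3 R).

Definition mk3 (f : 'I_3 -> R) : pt3 R :=
  (f ord0, f (@Ordinal 3 1 isT), f (@Ordinal 3 2 isT)).

Lemma coord_mk3 f i : coord i (mk3 f) = f i.
Proof. by case: i => -[|[|[|//]]] p; rewrite /coord/=; congr f; exact: val_inj. Qed.

(** What remains of [boundary_chart] when the domain and the centre are forgotten, with a
    nonnegative Lipschitz constant. Changes of chart on a surface need no more. *)
Definition lipschitz_chart c : Prop :=
  (forall i j, dot (chart_e c i) (chart_e c j) = (i == j)%:R) /\
  exists2 k, 0 <= k & forall s t : pt2 R, `|chart_psi c s - chart_psi c t| <= k * `|s - t|.

Lemma boundary_lipschitz_chart D x c : boundary_chart D x c -> lipschitz_chart c.
Proof.
move=> [_ fr _ [k kl] _ _ _]; split => //; exists `|k| => // s t.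
have := kl (s, t); rewrite /= => /(_ (conj I I)) H; apply: (le_trans H).
by rewrite ler_wpM2r// ler_norm.
Qed.

Definition chart_inv c x : pt3 R := mk3 (fun i => dot (x - chart_o c) (chart_e c i)).

Lemma coord_chart_map c y a : coord a (chart_map c y) =
  coord a (chart_o c) + \sum_i coord i y * coord a (chart_e c i).
Proof.
rewrite /chart_map coordD coord_sum; congr (_ + _); apply: eq_bigr => i _.
by rewrite coordZ.
Qed.

Section lipschitz_charts.
Variable c : chart R.
Hypothesis lc : lipschitz_chart c.
Let fr : forall i j, dot (chart_e c i) (chart_e c j) = (i == j)%:R := lc.1.

(** A right inverse of a square matrix is a left inverse: since the rows of the frame are
    orthonormal, so are its columns. *)
Lemma frame_dual a b : \sum_i coord a (chart_e c i) * coord b (chart_e c i) = (a == b)%:R.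
Proof.
pose M : 'M[R]_3 := \matrix_(i, j) coord j (chart_e c i).
have : M *m M^T = 1%:M.
  apply/matrixP => i j; rewrite !mxE -fr /dot; apply: eq_bigr => k _.
  by rewrite !mxE.
move=> /mulmx1C/matrixP/(_ a b); rewrite !mxE => <-; apply: eq_bigr => k _.
by rewrite !mxE.
Qed.

Lemma chart_mapK y : chart_inv c (chart_map c y) = y.
Proof.
apply: coord_inj => i; rewrite coord_mk3 /dot.
under eq_bigr => a _.
  rewrite coordD coordN coord_chart_map addrAC subrr add0r mulr_suml.
  over.
rewrite exchange_big/= (bigD1 i)//= [X in X + _](_ : _ = coord i y); last first.
  rewrite -[RHS]mulr1 -(_ : dot (chart_e c i) (chart_e c i) = 1); last by rewrite fr eqxx.
  by rewrite /dot mulr_sumr; apply: eq_bigr => a _; rewrite mulrA.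
rewrite big1 ?addr0// => j ji.
transitivity (coord j y * dot (chart_e c j) (chart_e c i)).
  by rewrite /dot mulr_sumr; apply: eq_bigr => a _; rewrite mulrA.
by rewrite fr (negbTE ji) mulr0.
Qed.

Lemma chart_invK x : chart_map c (chart_inv c x) = x.
Proof.
apply: coord_inj => a; rewrite coord_chart_map.
under eq_bigr => i _.
  rewrite coord_mk3 /dot mulr_suml; over.
rewrite exchange_big/= (bigD1 a)//= [X in _ + (X + _)](_ : _ = coord a (x - chart_o c)); last first.
  rewrite -[RHS]mulr1 -(_ : \sum_i coord a (chart_e c i) * coord a (chart_e c i) = 1); last first.
    by rewrite frame_dual eqxx.
  by rewrite mulr_sumr; apply: eq_bigr => i _; rewrite mulrA.
rewrite big1 ?addr0; first by rewrite coordD coordN addrC subrK.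
move=> b ba.
transitivity (coord b (x - chart_o c) * \sum_i coord b (chart_e c i) * coord a (chart_e c i)).
  by rewrite mulr_sumr; apply: eq_bigr => i _; rewrite mulrA.
by rewrite frame_dual (negbTE ba) mulr0.
Qed.

Lemma frame_le1 a i : `|coord a (chart_e c i)| <= 1.
Proof.
have : coord a (chart_e c i) ^+ 2 <= 1.
  rewrite -[leRHS](_ : dot (chart_e c i) (chart_e c i) = 1); last by rewrite fr eqxx.
  by rewrite /dot (bigD1 a)//= expr2 lerDl sumr_ge0// => j _; rewrite -expr2 sqr_ge0.
by move: (coord _ _) => t t2; rewrite ler_norml; apply/andP; split; nra.
Qed.

(** An orthonormal frame is not an isometry for the sup norm. Its entries are bounded by 1, and the
    sum over three of them gives the constant 3. *)
Lemma chart_map_lip y z : `|chart_map c y - chart_map c z| <= 3 * `|y - z|.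
Proof.
apply: norm_coord_le => a; rewrite coordD coordN !coord_chart_map opprD addrACA subrr add0r.
rewrite -sumrB (eq_bigr (fun i => coord i (y - z) * coord a (chart_e c i))); last first.
  by move=> i _; rewrite coordD coordN mulrBl.
rewrite (le_trans (ler_norm_sum _ _ _))//.
have -> : 3 * `|y - z| = \sum_(i < 3) `|y - z| by rewrite sumr_const card_ord mulr_natl.
apply: ler_sum => i _; rewrite normrM -[leRHS]mulr1.
by apply: ler_pM => //; [exact: coord_norm|exact: frame_le1].
Qed.

Lemma chart_inv_lip x z : `|chart_inv c x - chart_inv c z| <= 3 * `|x - z|.
Proof.
apply: norm_coord_le => i; rewrite coordD coordN !coord_mk3 /dot -sumrB.
rewrite (eq_bigr (fun a => coord a (x - z) * coord a (chart_e c i))); last first.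
  by move=> a _; rewrite -mulrBl !(coordD, coordN); congr (_ * _); ring.
rewrite (le_trans (ler_norm_sum _ _ _))//.
have -> : 3 * `|x - z| = \sum_(i < 3) `|x - z| by rewrite sumr_const card_ord mulr_natl.
apply: ler_sum => a _; rewrite normrM -[leRHS]mulr1.
by apply: ler_pM => //; [exact: coord_norm|exact: frame_le1].
Qed.

Lemma chart_inv_continuous : continuous (chart_inv c).
Proof. exact: lip_continuous chart_inv_lip. Qed.

Lemma chart_graph_lip : exists2 L, 0 <= L & forall s t,
  `|chart_graph c s - chart_graph c t| <= L * `|s - t|.
Proof.
have [k k0 kl] := lc.2; exists (3 * (1 + k)).
  by rewrite mulr_ge0 ?addr_ge0.
move=> s t; rewrite (le_trans (chart_map_lip _ _))// -mulrA ler_wpM2l//.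
rewrite prod_normE ge_max /=; apply/andP; split.
  by rewrite ler_peMl// lerDl.
rewrite (le_trans (kl s t))// ler_wpM2r// lerDr//.
Qed.

Lemma chart_graph_continuous : continuous (chart_graph c).
Proof. by have [L _ Ll] := chart_graph_lip; exact: lip_continuous Ll. Qed.

Lemma chart_graph_inv s : chart_inv c (chart_graph c s) = (s, chart_psi c s).
Proof. exact: chart_mapK. Qed.

Lemma chart_graph_expand s t : `|s - t| <= 3 * `|chart_graph c s - chart_graph c t|.
Proof.
have := chart_inv_lip (chart_graph c s) (chart_graph c t).
by rewrite !chart_graph_inv prod_normE ge_max => /andP[].
Qed.

Lemma chart_boxP x : chart_box c x <->
  chart_base c (chart_inv c x).1 /\ `|(chart_inv c x).2| < chart_h c.
Proof.
split=> [[y yb <-]|H]; first by rewrite chart_mapK.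
by exists (chart_inv c x); rewrite ?chart_invK.
Qed.

Lemma open_chart_base : open (chart_base c).
Proof.
have -> : chart_base c = fst @^-1` [set s : R | `|s| < chart_r c] `&` snd @^-1` [set s : R | `|s| < chart_r c] by [].
have oN : open [set s : R | `|s| < chart_r c].
  by rewrite (_ : mkset _ = ball 0 (chart_r c)); [exact: ball_open|
    apply/seteqP; split => s; rewrite -ball_normE /ball_/= sub0r normrN].
apply: openI; (apply: open_comp => [x _|]; last exact: oN).
  exact: cvg_fst.
exact: cvg_snd.
Qed.

Lemma open_chart_box : open (chart_box c).
Proof.
have -> : chart_box c = chart_inv c @^-1` (fst @^-1` chart_base c `&` snd @^-1` [set s : R | `|s| < chart_h c]).
  by apply/seteqP; split=> x /chart_boxP.
have oN : open [set s : R | `|s| < chart_h c].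
  by rewrite (_ : mkset _ = ball 0 (chart_h c)); [exact: ball_open|
    apply/seteqP; split => s; rewrite -ball_normE /ball_/= sub0r normrN].
apply: open_comp => [x _|]; first exact: chart_inv_continuous.
apply: openI; (apply: open_comp => [x _|]; last by [exact: open_chart_base|exact: oN]).
  exact: cvg_fst.
exact: cvg_snd.
Qed.

Lemma leb2_chart_base : (@leb2 R (chart_base c) < +oo)%E.
Proof.
have h : chart_base c `<=` `[- chart_r c, chart_r c]%classic `*` `[- chart_r c, chart_r c]%classic.
  by move=> s [h1 h2]; split; rewrite /= in_itv/= -ler_norml ltW.
have m1 : measurable (`[- chart_r c, chart_r c]%classic : set R) by [].
apply: (@le_lt_trans _ _ (@leb2 R (`[- chart_r c, chart_r c]%classic `*` `[- chart_r c, chart_r c]%classic))).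
  apply: le_measure => //; rewrite inE; first exact: open_measurable2 open_chart_base.
  exact: measurableX.
rewrite leb2X// lebesgue_measure_itv/=; case: ifP => _; last by rewrite mule0 ltry.
by rewrite -EFinB -EFinM ltry.
Qed.

(** Chart coordinates with the height measured from the graph: the graph becomes a horizontal plane,
    and [D] the part above it. The map is only bi-Lipschitz, as much as the comparison of volumes
    requires. *)
Definition flatten_chart x : pt3 R :=
  ((chart_inv c x).1, (chart_inv c x).2 - chart_psi c (chart_inv c x).1).

Lemma flatten_expand : exists2 L, 0 <= L & forall x z,
  `|x - z| <= L * `|flatten_chart x - flatten_chart z|.
Proof.
have [k k0 kl] := lc.2; exists (3 * (1 + k)).
  by rewrite mulr_ge0 ?addr_ge0.
move=> x z; rewrite -{1}(chart_invK x) -{1}(chart_invK z) (le_trans (chart_map_lip _ _))//.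
rewrite -mulrA ler_wpM2l// /flatten_chart.
set y := chart_inv c x; set y' := chart_inv c z.
set N := (X in _ <= _ * X).
have N1 : `|y.1 - y'.1| <= N by rewrite /N prod_normE le_max lexx.
have N2 : `|(y.2 - chart_psi c y.1) - (y'.2 - chart_psi c y'.1)| <= N.
  by rewrite /N prod_normE le_max lexx orbT.
have N0 : 0 <= N by exact: normr_ge0.
rewrite prod_normE ge_max; apply/andP; split; first by nra.
rewrite -[(y - y').2]/(y.2 - y'.2).
have -> : y.2 - y'.2 = ((y.2 - chart_psi c y.1) - (y'.2 - chart_psi c y'.1)) +
    (chart_psi c y.1 - chart_psi c y'.1) by ring.
rewrite (le_trans (ler_normD _ _))// mulrDl mul1r lerD//.
by rewrite (le_trans (kl _ _))// ler_wpM2l.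
Qed.

Lemma flatten_lip : exists2 L, 0 <= L & forall x z,
  `|flatten_chart x - flatten_chart z| <= L * `|x - z|.
Proof.
have [k k0 kl] := lc.2; exists (3 * (1 + k)).
  by rewrite mulr_ge0 ?addr_ge0.
move=> x z; rewrite /flatten_chart.
have := chart_inv_lip x z.
set y := chart_inv c x; set y' := chart_inv c z.
rewrite prod_normE ge_max => /andP[]; set N := `|x - z|.
rewrite -[(y - y').2]/(y.2 - y'.2) -[(y - y').1]/(y.1 - y'.1) => N1 N2.
have N0 : 0 <= N by exact: normr_ge0.
rewrite prod_normE ge_max /=; apply/andP; split.
  by rewrite (le_trans N1)// ler_wpM2r// ler_peMr// lerDl.
rewrite -[_ + - (_ + _)]/((y.2 - chart_psi c y.1) - (y'.2 - chart_psi c y'.1)).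
have -> : (y.2 - chart_psi c y.1) - (y'.2 - chart_psi c y'.1) = (y.2 - y'.2) -
    (chart_psi c y.1 - chart_psi c y'.1) by ring.
rewrite (le_trans (ler_normB _ _))// mulrDr mulr1 mulrDl lerD//.
by rewrite (le_trans (kl _ _))// [3 * k]mulrC -mulrA ler_wpM2l.
Qed.

Lemma flatten_continuous : continuous flatten_chart.
Proof. by have [L _ Ll] := flatten_lip; exact: lip_continuous Ll. Qed.

End lipschitz_charts.

Lemma chart_box_center D x c : boundary_chart D x c -> chart_box c x.
Proof.
move=> bc; exists 0; first by have [r0 h0] := bc_size bc; split; [split|]; rewrite /= normr0.
rewrite -(bc_origin bc) /chart_map big1 ?addr0// => i _.
have -> : coord i 0 = 0 :> R by rewrite -(subrr (0 : pt3 R)) coordD coordN subrr.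
by rewrite scale0r.
Qed.

Lemma chart_graph_box D x c s : boundary_chart D x c -> chart_base c s ->
  chart_box c (chart_graph c s).
Proof.
move=> bc bs; apply/(chart_boxP (boundary_lipschitz_chart bc)).
rewrite (chart_graph_inv (boundary_lipschitz_chart bc)); split => //.
exact: (bc_inside bc bs).
Qed.

Lemma chart_domainP D x c z : boundary_chart D x c -> chart_box c z ->
  D z <-> chart_psi c (chart_inv c z).1 < (chart_inv c z).2.
Proof.
move=> bc; have lc := boundary_lipschitz_chart bc => /(chart_boxP lc)[b h].
by rewrite -{1}(chart_invK lc z); exact: (bc_above bc b h).
Qed.

Lemma below_graph_closure D x c z : boundary_chart D x c -> chart_box c z ->
  (flatten_chart c z).2 < 0 -> ~ closure D z.
Proof.
move=> bc bz lt; have lc := boundary_lipschitz_chart bc => cz.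
have cont : continuous (fun z => (flatten_chart c z).2).
  by move=> y; apply: continuous_comp; [exact: flatten_continuous|exact: cvg_snd].
have oN : open (chart_box c `&` (fun z => (flatten_chart c z).2) @^-1` [set t | t < 0]).
  apply: openI; first exact: open_chart_box.
  by apply: open_comp => [y _|]; [exact: cont|exact: open_lt].
have [|y [Dy [by_ /=]]] := cz (chart_box c `&` (fun z => (flatten_chart c z).2) @^-1` [set t | t < 0]).
  by apply: open_nbhs_nbhs; split.
by have /(chart_domainP bc by_) := Dy; rewrite /flatten_chart/= subr_lt0 => /lt_trans h2 /h2; rewrite ltxx.
Qed.

(** A point strictly above the graph is in [D]. The points strictly below form an open set that
    misses [D], so they are not in the closure; only the graph remains. *)
Lemma frontier_graph D x c z : open D -> boundary_chart D x c -> chart_box c z ->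
  closure D z -> ~ D z -> exists2 s, chart_base c s & chart_graph c s = z.
Proof.
move=> oD bc; have lc := boundary_lipschitz_chart bc => bz cz nDz.
have [b h] := (chart_boxP lc z).1 bz.
exists (chart_inv c z).1 => //; rewrite -[RHS](chart_invK lc) /chart_graph.
suff -> : chart_psi c (chart_inv c z).1 = (chart_inv c z).2 by case: chart_inv.
apply/eqP; rewrite eq_le; apply/andP; split; last first.
  by rewrite leNgt; apply/negP => /(chart_domainP bc bz).
rewrite leNgt; apply/negP => lt; apply: (below_graph_closure bc bz _ cz).
by rewrite subr_lt0.
Qed.

End charts.

(** * Boundary terms in a chart *)

Section boundary_bound.
Context (R : realType).
Implicit Types (c : chart R) (D K : set (pt3 R)) (x y z : pt3 R) (i : 'I_3).
Local Notation e := (@basis R).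
Local Notation mu := (@leb3 R).

Lemma basis_norm_le1 i : `|e i| <= 1.
Proof.
by apply: norm_coord_le => j; rewrite coord_basis ger0_norm ?ler0n// lern1 leq_b1.
Qed.

Lemma continuous_measurable33 (T : pt3 R -> pt3 R) : continuous T ->
  measurable_fun [set: pt3 (measurableTypeR R)] (T : _ -> pt3 (measurableTypeR R)).
Proof.
move=> cT; rewrite (_ : T = fun x => (((T x).1.1, (T x).1.2), (T x).2)); last first.
  by apply/funext => x; case: (T x) => -[].
have m (g : pt3 R -> R) : continuous g -> measurable_fun setT (g \o T).
  move=> cg; apply: continuous_measurable3 => x.
  by apply: continuous_comp; [exact: cT|exact: cg].
apply: measurable_fun_pair; first apply: measurable_fun_pair.
- exact: (m _ (@continuous_coord R ord0)).
- exact: (m _ (@continuous_coord R (@Ordinal 3 1 isT))).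
- exact: (m _ (@continuous_coord R (@Ordinal 3 2 isT))).
Qed.

(** The graph is the preimage of a null plane under a map with a Lipschitz inverse. *)
Lemma graph_null c : lipschitz_chart c ->
  mu (flatten_chart c @^-1` [set z | z.2 = 0]) = 0%E.
Proof.
move=> lc; have [L L0 TL] := flatten_expand lc.
have mT := continuous_measurable33 (flatten_continuous lc).
have mB : measurable ([set: pt2 (measurableTypeR R)] `*` [set 0 : measurableTypeR R]).
  by apply: measurableX.
have := @leb3_lipschitz_pullback R setT (flatten_chart c) L measurableT mT L0 (fun x y _ _ => TL x y) _ mB.
rewrite setTI leb3X// lebesgue_measure_set1 !mule0 => h.
apply/eqP; rewrite eq_le measure_ge0 andbT (le_trans _ h)//.
apply: leb3_le => //; rewrite -[X in measurable X]setTI; apply: mT => //.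
rewrite (_ : mkset _ = [set: pt2 (measurableTypeR R)] `*` [set 0 : measurableTypeR R])//.
by apply/seteqP; split => [z /= ->|z []].
Qed.

Lemma frontierP D x : open D -> frontier D x <-> closure D x /\ ~ D x.
Proof.
move=> oD; split=> -[cx nx]; split=> // Dx; apply: nx; last exact: interior_subset.
by move: oD; rewrite openE; exact.
Qed.

Lemma frontier_null D : open D ->
  (forall x, frontier D x -> exists c, boundary_chart D x c) ->
  {ae mu, forall x, ~ frontier D x}.
Proof.
move=> oD H; suff : {ae mu, forall x, frontier D x -> ~ frontier D x}.
  by apply: ae3S => x h /[dup] /h.
apply: ae_openP => x fx; have [c bc] := H x fx.
have lc := boundary_lipschitz_chart bc.
exists (chart_box c).
  by split; [exact: open_chart_box|exact: chart_box_center bc].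
exists (flatten_chart c @^-1` [set z | z.2 = 0]); split.
- rewrite -[X in measurable X]setTI; apply: (continuous_measurable33 (flatten_continuous lc)) => //.
  rewrite (_ : mkset _ = [set: pt2 (measurableTypeR R)] `*` [set 0 : measurableTypeR R]).
    exact: measurableX.
  by apply/seteqP; split => [z /= ->|z []].
- exact: graph_null.
- move=> z /= /not_implyP[bz /contrapT fz].
  have [cz nDz] := (frontierP z oD).1 fz.
  have [s _ E] := frontier_graph oD bc bz cz nDz.
  by change ((flatten_chart c z).2 = 0); rewrite -E /flatten_chart (chart_graph_inv lc) subrr.
Qed.

Lemma compact_shift K D (v : pt3 R) : compact K -> open D -> K `<=` D ->
  \forall n \near \oo, forall x, K x -> D (x - n.+1%:R^-1 *: v).
Proof.
move=> /compact_near_coveringP cK oD KD.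
apply: (cK nat \oo (fun n x => D (x - n.+1%:R^-1 *: v))) => x Kx.
have : (fun p : pt3 R * nat => p.1 - p.2.+1%:R^-1 *: v) @ filter_prod (nbhs x) \oo --> x - (0 : R) *: v.
  apply: cvgB; first exact: cvg_fst.
  apply: cvgZl; apply: (@cvg_comp _ _ _ snd (fun n : nat => n.+1%:R^-1 : R) _ \oo); first exact: cvg_snd.
  exact: cvg_harmonic.
rewrite scale0r subr0; apply; apply: open_nbhs_nbhs; split => //; exact: KD.
Qed.

Lemma fine_norm_le (x : \bar R) : (`|fine x|%:E <= `|x|)%E.
Proof. by case: x => [r| |] //=; rewrite ?normr0 ?leey. Qed.

Section chart_bound.
Variables (D : set (pt3 R)) (x0 : pt3 R) (c : chart R).
Hypotheses (oD : open D) (bc : boundary_chart D x0 c).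
Let lc := boundary_lipschitz_chart bc.
Let box := chart_box c.
Let base := chart_base c.
Let T := flatten_chart c.

(** The shift changes the height above the graph by at most [L t], and membership in [D] is the sign
    of that height. So the indicator can change only where the height is at most [L t] in absolute
    value. *)
Lemma flatten_jump i (L t G : R) x : (forall x z, `|T x - T z| <= L * `|x - z|) -> 0 <= L ->
  0 <= t -> box x -> box (x - t *: e i) ->
  `|(\1_(D `&` box) (x - t *: e i) - \1_(D `&` box) x) * G| <=
  `|G| * \1_(`[- (L * t), L * t]%classic : set R) (T x).2.
Proof.
move=> TL L0 t0 bx bxt; rewrite normrM mulrC ler_wpM2l// !indicE.
have dT : `|(T x).2 - (T (x - t *: e i)).2| <= L * t.
  have := TL x (x - t *: e i); rewrite opprB addrCA subrr addr0 prod_normE ge_max => /andP[_ h].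
  rewrite (le_trans h)// ler_wpM2l// normrZ ger0_norm// ler_piMr//; exact: basis_norm_le1.
have DP y : box y -> (y \in D `&` box) = (0 < (T y).2).
  move=> by_; rewrite subr_gt0; apply/idP/idP.
    by rewrite inE => -[/(chart_domainP bc by_)].
  by move=> h; rewrite inE; split => //; apply/(chart_domainP bc by_).
rewrite !DP//; move: dT; move: (T x).2 (T (x - t *: e i)).2 => u u' dT.
have Lt0 : 0 <= L * t by rewrite mulr_ge0.
case: (boolP (u \in (`[- (L * t), L * t]%classic : set R))) => [_|].
  by case: (0 < u); case: (0 < u'); rewrite ?subr0 ?sub0r ?subrr ?normrN ?normr1 ?normr0.
rewrite notin_setE /= in_itv/= => nI.
suff -> : (0 < u') = (0 < u) by rewrite subrr normr0.
move: dT; rewrite ler_norml => /andP[h1 h2].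
apply/idP/idP => h; rewrite ltNge; apply/negP => h'; apply: nI; apply/andP; split; lra.
Qed.

(* The difference quotients of the indicator of [D] are supported in a layer around the
   graph whose thickness is proportional to the step, where [G] is close to its values
   on the graph. *)
Lemma chart_boundary_bound i : exists2 C : R, 0 <= C &
  forall G, test_function box G ->
  (`|\int[mu]_(x in D `&` box) 'D_(e i) G x|%:E <=
   C%:E * \int[@leb2 R]_(s in base) `|G (chart_graph c s)|%:E)%E.
Proof.
have [L L0 TL] := flatten_expand lc; have [L' L'0 TL'] := flatten_lip lc.
(* The first factor comes from the change to flattened coordinates, the second is the thickness of
   the layer divided by the step. *)
exists ((2 * L) ^+ 3 * (2 * L')); first by rewrite mulr_ge0 ?exprn_ge0 ?mulr_ge0.
move=> G tG; have [sG [K [cK Kbox G0]]] := tG.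
have obox : open box by exact: open_chart_box.
have oA : open (D `&` box) by exact: openI.
have [M GM] := test_bounded tG.
have [LG LG0 GLG] := test_lipschitz tG.
have cGg : continuous (fun s => G (chart_graph c s)).
  move=> s; apply: continuous_comp; first exact: (chart_graph_continuous lc).
  exact: (test_continuous tG).
have mbase := open_measurable2 (@open_chart_base R c).
have mGg : measurable_fun base (fun s => `|G (chart_graph c s)|).
  apply: measurableT_comp => //; apply: (measurable_funS measurableT (@subsetT _ _)).
  exact: continuous_measurable2.
set I := (\int[@leb2 R]_(s in base) _)%E.
have I0 : (0 <= I)%E by apply: integral_ge0 => s _; rewrite lee_fin.
have Ifin : I \is a fin_num.
  rewrite ge0_fin_numE//.
  apply: (@le_lt_trans _ _ (\int[@leb2 R]_(s in base) (`|M|)%:E)%E).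
    apply: ge0_le_integral => //.
    - exact/measurable_EFinP.
    - by move=> s _; rewrite lee_fin (le_trans (GM _))// ler_norm.
  rewrite integral_cst// -ge0_fin_numE ?mule_ge0// fin_numM//.
  rewrite ge0_fin_numE//; exact: leb2_chart_base.
pose b := fine (@leb2 R base).
have bE : @leb2 R base = b%:E.
  by rewrite fineK// ge0_fin_numE//; exact: leb2_chart_base.
(* Largest variation of [G] between a point of the layer and the point of the graph on the same
   vertical: [LG] is a Lipschitz constant of [G], 3 one of [chart_map], and the last factor is the
   half-thickness. *)
pose eps n := LG * (3 * (L' * n.+1%:R^-1)) : R.
pose a n : R := n.+1%:R * \int[mu]_x ((\1_(D `&` box) (x - n.+1%:R^-1 *: e i) - \1_(D `&` box) x) * G x).
have key : \forall n \near \oo, `|a n| <= ((2 * L) ^+ 3 * (2 * L')) * (fine I + eps n * b).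
  have := compact_shift (e i) cK obox Kbox; apply: filterS => n Kn.
  pose t : R := n.+1%:R^-1.
  have t0 : 0 <= t by rewrite invr_ge0.
  pose g s : R := (`|G (chart_graph c s)| + eps n) * \1_base s.
  pose J : set R := `[- (L' * t), L' * t]%classic.
  have mJ := @measurable_itv R (Interval (BLeft (- (L' * t))) (BRight (L' * t))).
  have lJ : @lebesgue_measure R J = (2 * (L' * t))%:E.
    have h0 : 0 <= L' * t by rewrite mulr_ge0.
    rewrite (@lebesgue_measure_itv R) /= lte_fin; case: ifPn => h.
      by rewrite -EFinB; congr EFin; ring.
    have -> : L' * t = 0.
      by apply: le_anti; rewrite h0 andbT; move: h; rewrite -leNgt; lra.
    by rewrite mulr0.
  have eps0 : 0 <= eps n by rewrite /eps !mulr_ge0.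
  have g0 s : 0 <= g s by rewrite mulr_ge0 ?addr_ge0.
  have mg : measurable_fun setT g.
    apply: measurable_funM; last exact: measurable_indic.
    apply: measurable_funD; last exact: measurable_cst.
    by apply: measurableT_comp => //; exact: continuous_measurable2.
  (* The majorant in flattened coordinates is a function of the base point times the indicator of a
     height interval, so Tonelli yields the thickness times the integral of [g]. *)
  pose f (z : pt3 R) : \bar R := (g z.1 * \1_J z.2)%:E.
  have f0 z : (0 <= f z)%E by rewrite lee_fin mulr_ge0.
  have mf : measurable_fun setT f.
    apply/measurable_EFinP; apply: measurable_funM.
      exact: (measurableT_comp mg (@measurable_fst _ _ _ _)).
    rewrite (_ : (fun z : pt3 R => \1_J z.2) = \1_((snd : pt3 R -> R) @^-1` J))//.
    apply: measurable_indic; apply: closed_measurable3; apply: closed_comp => [z _|].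
      exact: cvg_snd.
    exact: interval_closed.
  have bound x : (`|((\1_(D `&` box) (x - t *: e i) - \1_(D `&` box) x) * G x)%:E| <= f (T x))%E.
    have [Kx|/G0->] := pselect (K x); last by rewrite mulr0 abse0.
    have bx := Kbox _ Kx; have bxt := Kn _ Kx.
    rewrite abse_EFin lee_fin.
    apply: (le_trans (flatten_jump _ TL' L'0 t0 bx bxt)).
    have [Jx|nJx] := boolP ((T x).2 \in J); last first.
      by rewrite /f indicE (negbTE nJx) !mulr0.
    rewrite ler_wpM2r// /g indicE.
    have [hb _] := (chart_boxP lc x).1 bx.
    rewrite mem_set// mulr1 -lerBlDl.
    apply: (le_trans (lerB_dist _ _)); apply: (le_trans (GLG _ _)).
    rewrite /eps ler_wpM2l//.
    rewrite -{1}(chart_invK lc x) (le_trans (chart_map_lip lc _ _))// ler_wpM2l//.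
    rewrite prod_normE ge_max /= subrr normr0 mulr_ge0//=.
    move: Jx; rewrite inE => Jx.
    have : (T x).2 \in `[- (L' * t), L' * t] by exact: Jx.
    by rewrite in_itv/= -ler_norml.
  have If : (\int[mu]_x f x = (2 * (L' * t))%:E * \int[@leb2 R]_s (g s)%:E)%E.
    rewrite leb3_tonelli//.
    transitivity (\int[@leb2 R]_s ((2 * (L' * t))%:E * (g s)%:E))%E.
      apply: eq_integral => s _; rewrite /f /=.
      transitivity (\int[@lebesgue_measure R]_u ((g s)%:E * (\1_J u)%:E))%E.
        by apply: eq_integral => u _; rewrite EFinM.
      have mi := proj2 (measurable_EFinP _ _) (@measurable_indic _ _ R setT J mJ).
      rewrite (@ge0_integralZl _ _ _ (@lebesgue_measure R) setT measurableT _ mi)//.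
      rewrite (@integral_indic _ _ _ (@lebesgue_measure R) setT measurableT J mJ) setIT muleC; congr (_ * _)%E.
        exact: lJ.
      by move=> u _; rewrite lee_fin.
      by rewrite lee_fin.
    apply: (@ge0_integralZl _ _ _ (@leb2 R) setT measurableT (EFin \o g)).
    - exact/measurable_EFinP.
    - by move=> s _; rewrite lee_fin.
    - by rewrite lee_fin !mulr_ge0.
  have Ig : (\int[@leb2 R]_s (g s)%:E <= (fine I + eps n * b)%:E)%E.
    rewrite (_ : (\int[@leb2 R]_s (g s)%:E)%E = (\int[@leb2 R]_(s in base) (`|G (chart_graph c s)| + eps n)%:E)%E); last first.
      rewrite [RHS]integral_mkcond; apply: eq_integral => s _.
      by rewrite /g /patch indicE; case: ifP; rewrite ?mulr1 ?mulr0.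
    under eq_integral => s _ do rewrite EFinD.
    rewrite ge0_integralD//; try by [move=> s _; rewrite lee_fin|exact/measurable_EFinP].
    have -> : (\int[@leb2 R]_(s in base) (eps n)%:E = (eps n)%:E * b%:E)%E.
      by rewrite -bE -(@integral_cst _ _ _ (@leb2 R) base mbase).
    rewrite EFinD (fineK Ifin).
    exact: le_refl.
  have mh : measurable_fun setT (fun x => (\1_(D `&` box) (x - t *: e i) - \1_(D `&` box) x) * G x).
    apply: measurable_funM; last exact: (test_measurable tG measurableT).
    apply: measurable_funB; last by exact: (@measurable_indic _ _ R setT _ (open_measurable3 oA)).
    rewrite (_ : (fun x => _) = \1_((fun x => x - t *: e i) @^-1` (D `&` box)))//.
    apply: measurable_indic; apply: open_measurable3; apply: open_comp => // x _.
    by apply: cvgB; [exact: cvg_id|exact: cvg_cst].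
  rewrite /a normrM ger0_norm//.
  have step1 : `|\int[mu]_x ((\1_(D `&` box) (x - t *: e i) - \1_(D `&` box) x) * G x)|
      <= (2 * L) ^+ 3 * (2 * (L' * t) * (fine I + eps n * b)).
    rewrite -lee_fin (le_trans (fine_norm_le _))//.
    apply: (le_trans (@le_abse_integral _ _ _ mu setT _ measurableT (proj2 (measurable_EFinP _ _) mh))).
    apply: (@le_trans _ _ (\int[mu]_x f (T x))%E).
      apply: ge0_le_integral => //.
      - by apply: measurableT_comp => //; exact/measurable_EFinP.
      - exact: (measurableT_comp mf (continuous_measurable33 (flatten_continuous lc))).
      - by move=> x _; exact: bound.
    apply: (le_trans (@ge0_integral_lipschitz3 R setT T L measurableT
      (continuous_measurable33 (flatten_continuous lc)) L0 (fun x y _ _ => TL x y) f mf f0)).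
    rewrite If [leRHS]EFinM; apply: lee_wpmul2l; first by rewrite lee_fin exprn_ge0// mulr_ge0.
    rewrite [leRHS]EFinM; apply: lee_wpmul2l; first by rewrite lee_fin !mulr_ge0.
    exact: Ig.
  apply: (le_trans (ler_wpM2l _ step1)) => //.
  rewrite [leLHS](_ : _ = (2 * L) ^+ 3 * (2 * L') * (fine I + eps n * b) * (n.+1%:R * t)); last by ring.
  by rewrite /t divff// mulr1.
have tGT := test_subset (@subsetT _ _) tG.
have ca : `|a n| @[n --> \oo] --> `|\int[mu]_(x in D `&` box) 'D_(e i) G x|.
  apply: cvg_norm; exact: (derive_shift_cvg (i := i) (open_measurable3 oA) tGT).
(* The base has finite measure [b], so the error [eps n * b] disappears in the limit and only the
   integral over the graph is left. *)
have cb : (2 * L) ^+ 3 * (2 * L') * (fine I + eps n * b) @[n --> \oo] -->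
    (2 * L) ^+ 3 * (2 * L') * (fine I + LG * (3 * (L' * 0)) * b).
  apply: cvgMr; apply: cvgD; first exact: cvg_cst.
  apply: cvgMl; do 3 apply: cvgMr; exact: cvg_harmonic.
have := ler_cvg_to ca cb key; rewrite !mulr0 mul0r addr0 => H.
rewrite -(fineK Ifin) -EFinM lee_fin; exact: H.
Qed.

End chart_bound.
End boundary_bound.

(** * Change of chart on a surface *)

Section surface_transfer.
Context (R : realType).
Variables (c1 c2 : chart R).
Hypotheses (lc1 : lipschitz_chart c1) (lc2 : lipschitz_chart c2).

Let T (s : pt2 R) : pt2 R := (chart_inv c2 (chart_graph c1 s)).1.

Let mT : measurable_fun setT T.
Proof.
have cT : continuous T.
  move=> s; apply: continuous_comp; last exact: cvg_fst.
  apply: continuous_comp; first exact: (chart_graph_continuous lc1).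
  exact: (chart_inv_continuous lc2).
rewrite (_ : T = fun s => ((T s).1, (T s).2)); last by apply/funext => s; case: (T s).
apply: measurable_fun_pair; apply: continuous_measurable2 => s;
  (apply: continuous_comp; first exact: cT).
  exact: cvg_fst.
exact: cvg_snd.
Qed.

(** The transition map is controlled only at parameters whose points lie on both graphs: there the
    base distance is bounded by that of the points, which the second graph map bounds in turn. The
    additional 1 secures [1 <= L], as required by the planar comparison of areas. *)
Lemma transition_expand : exists2 L : R, 1 <= L & forall s t,
  chart_graph c1 s = chart_graph c2 (T s) -> chart_graph c1 t = chart_graph c2 (T t) ->
  `|s - t| <= L * `|T s - T t|.
Proof.
have [L L0 gL] := chart_graph_lip lc2.
exists (3 * L + 1); first by rewrite lerDr mulr_ge0.
move=> s t Es Et; rewrite (le_trans (chart_graph_expand lc1 _ _))// Es Et.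
apply: (@le_trans _ _ (3 * (L * `|T s - T t|))); first by rewrite ler_wpM2l.
by have := normr_ge0 (T s - T t); move: (`|T s - T t|) => N N0; lra.
Qed.

Section sets.
Variables (E F : set (pt2 R)).
Hypotheses (mE : measurable E) (mF : measurable F).
Hypothesis EF : forall s, E s -> exists t, F t /\ chart_graph c2 t = chart_graph c1 s.

Let ET s : E s -> F (T s) /\ chart_graph c1 s = chart_graph c2 (T s).
Proof. by move=> /EF[t [Ft E12]]; rewrite /T -E12 (chart_graph_inv lc2). Qed.

Lemma surface_measurable_transfer (h : pt3 R -> R) : measurable_fun F (h \o chart_graph c2) ->
  measurable_fun E (h \o chart_graph c1).
Proof.
move=> mh; have mH : measurable_fun setT ((h \o chart_graph c2) \_ F).
  by apply/(measurable_restrict _ mF measurableT); rewrite setTI.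
have mHT := measurable_funS measurableT (@subsetT _ E) (measurableT_comp mH mT).
apply: (eq_measurable_fun _ _ mHT) => s; rewrite inE => /ET[FT E12].
change (((h \o chart_graph c2) \_ F) (T s) = h (chart_graph c1 s)).
by rewrite /patch mem_set//= E12.
Qed.

(** The integrand on [E] is the one on [F] composed with the transition map, so the planar
    comparison applies. It makes convergence of traces in [L2] independent of the chart. *)
Lemma surface_L2_transfer (L : R) (h : pt3 R -> R) : 1 <= L ->
  (forall s t, chart_graph c1 s = chart_graph c2 (T s) ->
    chart_graph c1 t = chart_graph c2 (T t) -> `|s - t| <= L * `|T s - T t|) ->
  measurable_fun F (h \o chart_graph c2) ->
  (L2sq (@leb2 R) E (h \o chart_graph c1) <=
   ((2 * L) ^+ 3)%:E * L2sq (@leb2 R) F (h \o chart_graph c2))%E.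
Proof.
move=> L1 TL mh; have mH : measurable_fun setT ((h \o chart_graph c2) \_ F).
  by apply/(measurable_restrict _ mF measurableT); rewrite setTI.
have TLE s t : E s -> E t -> `|s - t| <= L * `|T s - T t|.
  by move=> /ET[_ h1] /ET[_ h2]; exact: TL.
pose f t : \bar R := ((((h \o chart_graph c2) \_ F) t) ^+ 2)%:E.
have mf : measurable_fun setT f by exact: measurable_sqr.
have f0 t : (0 <= f t)%E by rewrite lee_fin sqr_ge0.
have := @ge0_integral_lipschitz2 R E T L mE mT L1 TLE f mf f0.
have <- : L2sq (@leb2 R) E (h \o chart_graph c1) = (\int[@leb2 R]_(x in E) f (T x))%E.
  apply: eq_integral => s; rewrite inE => /ET[FT E12].
  by rewrite /f /patch mem_set//= E12.
have <- : L2sq (@leb2 R) F (h \o chart_graph c2) = (\int[@leb2 R]_x f x)%E.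
  rewrite /L2sq integral_mkcond; apply: eq_integral => s _; rewrite /f /patch.
  by case: ifP => //; rewrite expr0n.
by [].
Qed.

Lemma surface_ae_transfer (P : pt3 R -> Prop) :
  {ae (@leb2 R), forall t, F t -> P (chart_graph c2 t)} ->
  {ae (@leb2 R), forall s, E s -> P (chart_graph c1 s)}.
Proof.
have [L L1 TL] := transition_expand.
have TLE s t : E s -> E t -> `|s - t| <= L * `|T s - T t|.
  by move=> /ET[_ h1] /ET[_ h2]; exact: TL.
move=> /(@negligible_lipschitz2 R E T L mE mT L1 TLE); apply: negligibleS.
move=> s /= /not_implyP[Es nP]; split => //= PF; apply: nP.
by have [FT ->] := ET Es; exact: PF.
Qed.

End sets.
End surface_transfer.

Section surface_sets.
Context (R : realType).
Implicit Types (c : chart R) (D A : set (pt3 R)).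

Lemma open_chart_part c (U : set (pt3 R)) : lipschitz_chart c -> open U ->
  open (chart_part c U).
Proof.
move=> lc oU; apply: openI; first exact: open_chart_base.
by apply: open_comp => // s _; exact: (chart_graph_continuous lc).
Qed.

Lemma measurable_chart_part c (F U : set (pt3 R)) : lipschitz_chart c -> closed F ->
  open U -> measurable (chart_part c (F `&` U)).
Proof.
move=> lc cF oU; rewrite (_ : chart_part c _ = chart_graph c @^-1` F `&` chart_part c U).
  apply: measurableI; last exact: (open_measurable2 (open_chart_part lc oU)).
  apply: closed_measurable2; apply: closed_comp => // s _.
  exact: (chart_graph_continuous lc).
by apply/seteqP; split=> s /=; [move=> [bs [Fs Us]]|move=> [Fs [bs Us]]].
Qed.

Lemma closed_frontier D : closed (frontier D).
Proof.
rewrite /frontier setDE; apply: closedI; first exact: closed_closure.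
by apply: open_closedC; exact: open_interior.
Qed.

Lemma graph_frontier D x c s : open D -> boundary_chart D x c -> chart_base c s ->
  frontier D (chart_graph c s).
Proof.
move=> oD bc bs; have lc := boundary_lipschitz_chart bc.
apply/(frontierP _ oD); split; last first.
  move=> /(chart_domainP bc (chart_graph_box bc bs)).
  by rewrite (chart_graph_inv lc) /= ltxx.
pose p (n : nat) : pt3 R := chart_map c (s, chart_psi c s + n.+1%:R^-1).
have pc : p @ \oo --> chart_graph c s.
  apply/cvgrPdist_lt => eps eps0; near=> n.
  apply: (le_lt_trans (chart_map_lip lc _ _)); rewrite -ltr_pdivlMl//.
  rewrite prod_normE gt_max; apply/andP; split => /=.
    by rewrite subrr normr0 mulr_gt0// invr_gt0.
  rewrite opprD addrA subrr add0r normrN ger0_norm//; near: n.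
  have e0 : 0 < 3^-1 * eps by rewrite mulr_gt0// invr_gt0.
  exact: (near_infty_natSinv_lt (PosNum e0)).
move=> B nB; have nB' : nbhs (chart_graph c s) (B `&` chart_box c).
  apply: filterI => //; apply: open_nbhs_nbhs; split; first exact: (open_chart_box lc).
  exact: (chart_graph_box bc bs).
have [n _ pB] := pc _ nB'; have [Bp boxp] := pB n (leqnn n).
exists (p n); split => //; apply/(chart_domainP bc boxp).
by rewrite /p (chart_mapK lc) /= ltrDl invr_gt0.
Unshelve. all: by end_near. Qed.

End surface_sets.

(** * Weak derivatives as limits of boundary terms *)

Section green.
Context (R : realType).
Implicit Types (D U : set (pt3 R)) (f w phi : pt3 R -> R) (i : 'I_3).
Local Notation e := (@basis R).
Local Notation mu := (@leb3 R).

Lemma ge0_cvge_fine (a : nat -> R) (b : nat -> \bar R) :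
  (forall n, (`|a n|%:E <= b n)%E) -> b @ \oo --> 0%E -> a @ \oo --> (0 : R).
Proof.
move=> ab b0; have b_ge0 n : (0 <= b n)%E by rewrite (le_trans _ (ab n))// lee_fin.
apply/cvgrPdist_lt => eps eps0.
have := (ge0_cvge0P b_ge0).1 b0 eps eps0; apply: filterS => n bn.
by rewrite sub0r normrN -lte_fin (le_lt_trans (ab n)).
Qed.

Lemma L1_bounded_cvg0 D (h : nat -> pt3 R -> R) (g : pt3 R -> R) (M : R) : measurable D ->
  (forall n, measurable_fun D (h n)) -> measurable_fun D g -> (forall x, `|g x| <= M) ->
  ((fun n => \int[mu]_(x in D) `|h n x|%:E)%E @ \oo --> 0%E) ->
  (fun n => \int[mu]_(x in D) (h n x * g x)) @ \oo --> (0 : R).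
Proof.
move=> mD mh mg gM h0.
apply: (@ge0_cvge_fine _ (fun n => M%:E * \int[mu]_(x in D) `|h n x|%:E)%E); last first.
  by rewrite -(mule0 M%:E); apply: cvgeZl.
move=> n; have M0 : 0 <= M by rewrite (le_trans _ (gM 0)).
have mhg : measurable_fun D (fun x => h n x * g x) by exact: measurable_funM.
apply: (le_trans (fine_norm_le _)).
apply: (le_trans (@le_abse_integral _ _ _ mu D _ mD (proj2 (measurable_EFinP _ _) mhg))).
have mah : measurable_fun D (fun x => `|h n x|%:E).
  by apply/measurable_EFinP; apply: measurableT_comp.
rewrite -(@ge0_integralZl _ _ _ mu D mD _ mah)//.
apply: (@ge0_le_integral _ _ _ mu D mD).
- by move=> x _; exact: abse_ge0.
- by apply: measurableT_comp => //; exact/measurable_EFinP.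
- exact: (measurable_funeM M%:E mah).
- by move=> x _; rewrite /= lee_fin normrM mulrC ler_wpM2r.
Qed.

Lemma smooth_measurable D f : smooth f -> measurable D -> measurable_fun D f.
Proof.
move=> sf mD.
exact: (measurable_funS measurableT (@subsetT _ _) (continuous_measurable3 (smooth_continuous sf))).
Qed.

(** By the Leibniz rule [wgap] is a limit of integrals of exact derivatives of compactly supported
    smooth functions, that is, of pure boundary terms. *)
Lemma green_cvg D f w i (phi_ : nat -> pt3 R -> R) phi U : measurable D -> (mu D < +oo)%E ->
  L2 mu D f -> L2 mu D w -> (forall n, smooth (phi_ n)) -> test_function U phi ->
  (fun n => L2sq mu D (phi_ n \- f)) @ \oo --> 0%E ->
  (fun n => L2sq mu D ('D_(e i) (phi_ n) \- w)) @ \oo --> 0%E ->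
  (fun n => \int[mu]_(x in D) 'D_(e i) (fun y => phi_ n y * phi y) x) @ \oo -->
  wgap D i f w phi.
Proof.
move=> mD Dfin Lf Lw sphi tphi cf cw.
have mf := @L2_measurable _ _ _ mu D f mD Lf; have mw := @L2_measurable _ _ _ mu D w mD Lw.
have tdphi := test_derive i tphi.
have m1 n : measurable_fun D (phi_ n \- f).
  by apply: measurable_funB => //; exact: (smooth_measurable (sphi n) mD).
have m2 n : measurable_fun D ('D_(e i) (phi_ n) \- w).
  by apply: measurable_funB => //; exact: (smooth_measurable (smooth_derive i (sphi n)) mD).
have [M phiM] := test_bounded tphi; have [M' dphiM'] := test_bounded tdphi.
have c1 := L1_bounded_cvg0 mD m1 (test_measurable tdphi mD) dphiM'
  (@L2_cvg_L1 _ _ _ mu D _ mD Dfin m1 cf).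
have c2 := L1_bounded_cvg0 mD m2 (test_measurable tphi mD) phiM
  (@L2_cvg_L1 _ _ _ mu D _ mD Dfin m2 cw).
pose F n := \int[mu]_(x in D) ((phi_ n \- f) x * 'D_(e i) phi x) +
  \int[mu]_(x in D) (('D_(e i) (phi_ n) \- w) x * phi x) + wgap D i f w phi.
have H : F @ \oo --> 0 + 0 + wgap D i f w phi.
  by apply: cvgD; [apply: cvgD; [exact: c1|exact: c2]|exact: cvg_cst].
rewrite !add0r in H; suff -> : (fun n => \int[mu]_(x in D) 'D_(e i) (fun y => phi_ n y * phi y) x) = F by [].
apply/funext => n; rewrite /F.
have t1 := testM_smooth (sphi n) tphi.
have i1 : mu.-integrable D (EFin \o (fun x => 'D_(e i) (fun y => phi_ n y * phi y) x)).
  exact: test_integrable (test_derive i t1) mD.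
have i2 := wgap_integrable i mD Lf Lw tphi.
have i3 : mu.-integrable D (EFin \o (fun x => phi_ n x * 'D_(e i) phi x)).
  exact: test_integrable (testM_smooth (sphi n) tdphi) mD.
have i4 : mu.-integrable D (EFin \o (fun x => 'D_(e i) (phi_ n) x * phi x)).
  exact: test_integrable (testM_smooth (smooth_derive i (sphi n)) tphi) mD.
have if1 := L2M_test_integrable mD Lf tdphi; have iw1 := L2M_test_integrable mD Lw tphi.
have -> : \int[mu]_(x in D) ((phi_ n \- f) x * 'D_(e i) phi x) =
   \int[mu]_(x in D) (phi_ n x * 'D_(e i) phi x) - \int[mu]_(x in D) (f x * 'D_(e i) phi x).
  by rewrite -RintegralB//; apply: eq_Rintegral => x _ /=; rewrite mulrBl.
have -> : \int[mu]_(x in D) (('D_(e i) (phi_ n) \- w) x * phi x) =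
   \int[mu]_(x in D) ('D_(e i) (phi_ n) x * phi x) - \int[mu]_(x in D) (w x * phi x).
  by rewrite -RintegralB//; apply: eq_Rintegral => x _ /=; rewrite mulrBl.
have -> : \int[mu]_(x in D) 'D_(e i) (fun y => phi_ n y * phi y) x =
   \int[mu]_(x in D) (phi_ n x * 'D_(e i) phi x) + \int[mu]_(x in D) ('D_(e i) (phi_ n) x * phi x).
  rewrite -RintegralD//; apply: eq_Rintegral => x _.
  by rewrite deriveM_smooth; [rewrite [phi x * _]mulrC|exact: sphi|exact: test_smooth tphi].
rewrite (wgapE i mD Lf Lw tphi); ring.
Qed.

(** The boundary bound is applied to [k_ n] times [phi]. On a base of finite measure, convergence in
    [L2] gives convergence in [L1]. Outside of [E] nothing is known about [k_ n], but [phi] vanishes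
    on the graph there. *)
Lemma boundary_term_cvg0 D x0 (c : chart R) i (k_ : nat -> pt3 R -> R) phi (E : set (pt2 R)) :
  open D -> boundary_chart D x0 c -> (forall n, smooth (k_ n)) ->
  test_function (chart_box c) phi -> measurable E -> E `<=` chart_base c ->
  (forall s, chart_base c s -> ~ E s -> phi (chart_graph c s) = 0) ->
  (fun n => L2sq (@leb2 R) E (k_ n \o chart_graph c)) @ \oo --> 0%E ->
  (fun n => \int[mu]_(x in D `&` chart_box c) 'D_(e i) (fun y => k_ n y * phi y) x) @ \oo --> (0 : R).
Proof.
move=> oD bc sk tphi mE Eb phi0 k0; have lc := boundary_lipschitz_chart bc.
have [C C0 HC] := chart_boundary_bound oD bc i.
have [M phiM] := test_bounded tphi.
have M0 : 0 <= M by rewrite (le_trans _ (phiM 0)).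
have Efin : (@leb2 R E < +oo)%E.
  apply: le_lt_trans (leb2_chart_base c); apply: le_measure => //; rewrite inE//.
  exact: (open_measurable2 (@open_chart_base R c)).
have cg (f : pt3 R -> R) : smooth f -> continuous (f \o chart_graph c).
  move=> sf s; apply: continuous_comp; first exact: (chart_graph_continuous lc).
  exact: (smooth_continuous sf).
have mE' (f : pt3 R -> R) A : smooth f -> measurable_fun A (f \o chart_graph c).
  move=> sf; apply: (measurable_funS measurableT (@subsetT _ _)).
  by apply: continuous_measurable2; exact: cg.
have mk n : measurable_fun E (k_ n \o chart_graph c) by exact: mE'.
have L1 := @L2_cvg_L1 _ _ _ (@leb2 R) E _ mE Efin mk k0.
apply: (@ge0_cvge_fine _ (fun n => (C * M)%:E * \int[@leb2 R]_(s in E) `|(k_ n \o chart_graph c) s|%:E)%E); last first.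
  by rewrite -(mule0 (C * M)%:E); apply: cvgeZl.
move=> n; apply: (le_trans (HC _ (testM_smooth (sk n) tphi))).
rewrite EFinM -muleA; apply: lee_wpmul2l; first by rewrite lee_fin.
have mak : measurable_fun E (fun s => `|(k_ n \o chart_graph c) s|%:E).
  by apply/measurable_EFinP; apply: measurableT_comp.
rewrite -(@ge0_integralZl _ _ _ (@leb2 R) E mE _ mak)//.
rewrite (@integral_mkcond _ _ _ (@leb2 R) (chart_base c)) (@integral_mkcond _ _ _ (@leb2 R) E).
apply: (@ge0_le_integral _ _ _ (@leb2 R) setT measurableT).
- by move=> s _; rewrite /patch; case: ifP => // _; rewrite lee_fin.
- apply/(measurable_restrict _ (open_measurable2 (@open_chart_base R c)) measurableT).
  rewrite setTI; apply/measurable_EFinP; apply: measurableT_comp => //.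
  apply: (mE' (fun y => k_ n y * phi y)); apply: smoothM => //; exact: test_smooth tphi.
- apply/(measurable_restrict _ mE measurableT); rewrite setTI.
  exact: (measurable_funeM M%:E mak).
- move=> s _; rewrite /patch; have [Es|nEs] := pselect (E s).
    by rewrite !mem_set//; [rewrite -EFinM lee_fin normrM mulrC ler_wpM2r|exact: Eb].
  rewrite [s \in E]memNset//; case: ifPn => // /set_mem bs.
  by rewrite (phi0 _ bs nEs) mulr0 normr0.
Qed.

End green.

(** * Gluing across a surface *)

Section L2_differences.
Context d (T : measurableType d) (R : realType) (mu : {measure set T -> \bar R}).

Lemma L2sqB_cvg0 (D : set T) (f g h : nat -> T -> R) : measurable D ->
  (forall n, measurable_fun D (f n)) -> (forall n, measurable_fun D (g n)) ->
  (forall n x, D x -> h n x = f n x - g n x) ->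
  (fun n => L2sq mu D (f n)) @ \oo --> 0%E -> (fun n => L2sq mu D (g n)) @ \oo --> 0%E ->
  (fun n => L2sq mu D (h n)) @ \oo --> 0%E.
Proof.
move=> mD mf mg hE f0 g0.
apply: (@ge0_cvge0_leD _ _ (fun n => L2sq mu D (f n)) (fun n => L2sq mu D (g n)) 2) => // n.
  exact: L2sq_ge0.
have mh : measurable_fun D (h n).
  apply: (eq_measurable_fun _ _ (measurable_funB (mf n) (mg n))) => x; rewrite inE => Dx.
  by rewrite hE.
apply: L2sq_leD => // x Dx; rewrite hE// -subr_ge0.
have -> : 2 * f n x ^+ 2 + 2 * g n x ^+ 2 - (f n x - g n x) ^+ 2 = (f n x + g n x) ^+ 2 by ring.
exact: sqr_ge0.
Qed.

Lemma L2sq_sub_cvg0 (D E : set T) (f : nat -> T -> R) : measurable D -> measurable E ->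
  E `<=` D -> (forall n, measurable_fun D (f n)) ->
  (fun n => L2sq mu D (f n)) @ \oo --> 0%E -> (fun n => L2sq mu E (f n)) @ \oo --> 0%E.
Proof.
move=> mD mE ED mf; apply: (@ge0_cvge0_le _ _ _ 1) => n; first exact: L2sq_ge0.
by rewrite mul1e; exact: L2sqS.
Qed.

End L2_differences.

Section approximants.
Context (R : realType).
Implicit Types (c : chart R) (D A B : set (pt3 R)) (E : set (pt2 R)) (f tau : pt3 R -> R)
  (W : 'I_3 -> pt3 R -> R).
Local Notation e := (@basis R).
Local Notation mu := (@leb3 R).

(* The data of a trace, transported to an arbitrary chart [c] and subset [E] of its base. *)
Definition approximable B c E f W tau : Prop := exists phi_ : nat -> pt3 R -> R,
  [/\ forall n, smooth (phi_ n),
      (fun n => L2sq mu B (phi_ n \- f)) @ \oo --> 0%E,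
      forall i, (fun n => L2sq mu B ('D_(e i) (phi_ n) \- W i)) @ \oo --> 0%E &
      (fun n => L2sq (@leb2 R) E ((phi_ n \- tau) \o chart_graph c)) @ \oo --> 0%E].

Lemma smooth_graph_measurable c E f : lipschitz_chart c -> smooth f ->
  measurable_fun E (f \o chart_graph c).
Proof.
move=> lc sf; apply: (measurable_funS measurableT (@subsetT _ _)).
apply: continuous_measurable2 => s.
apply: continuous_comp; first exact: (chart_graph_continuous lc).
exact: (smooth_continuous sf).
Qed.

(** Each trace comes with a chart of its own at each point. To compare several traces their
    approximants must be read in one common chart; bounds for the transition map carry the
    convergence over. *)
Lemma approximable_trace D A f tau x : open D -> A `<=` frontier D ->
  (forall c, lipschitz_chart c -> measurable (chart_part c A)) ->
  H1 D f -> is_trace D A f tau -> A x ->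
  exists2 c', boundary_chart D x c' &
    forall B c E, measurable B -> B `<=` D `&` chart_box c' -> lipschitz_chart c ->
    measurable E -> (forall s, E s -> A (chart_graph c s) /\ chart_box c' (chart_graph c s)) ->
    approximable B c E f (fun i => weak_partial D i f) tau /\
    measurable_fun E (tau \o chart_graph c).
Proof.
move=> oD AD mA Hf Hf' Ax; have [c' bc' [Lt [phi [sphi [cf cw] ct]]]] := Hf' x Ax.
exists c' => // B c E mB BD lc mE EA; have lc' := boundary_lipschitz_chart bc'.
have mD := open_measurable3 (openI oD (open_chart_box lc')).
have mF := mA c' lc'.
have mtau := @L2_measurable _ _ _ (@leb2 R) _ _ mF Lt.
have EF s : E s -> exists t, chart_part c' A t /\ chart_graph c' t = chart_graph c s.
  move=> /EA[As bs]; have [cl nD] := (frontierP _ oD).1 (AD _ As).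
  have [t bt E'] := frontier_graph oD bc' bs cl nD.
  by exists t; split => //; split => //; rewrite /preimage/= E'.
have mk n : measurable_fun (chart_part c' A) ((phi n \- tau) \o chart_graph c').
  exact: (measurable_funB (smooth_graph_measurable lc' (sphi n)) mtau).
have DS : D `&` chart_box c' `<=` D by move=> z [].
have mf := @L2_measurable _ _ _ mu _ _ mD (@L2S _ _ _ mu _ _ _ (open_measurable3 oD) mD DS Hf.1).
have mw i := @L2_measurable _ _ _ mu _ _ mD
  (@L2S _ _ _ mu _ _ _ (open_measurable3 oD) mD DS (weak_partial_spec i Hf).1).
split; last exact: (surface_measurable_transfer lc lc' mF EF mtau).
exists phi; split => //.
- apply: (@L2sq_sub_cvg0 _ _ _ mu _ _ _ mD mB BD).
    by move=> n; apply: measurable_funB => //; exact: (smooth_measurable (sphi n) mD).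
  exact: (L2norm_cvg0 _ _ _).1.
- move=> i; apply: (@L2sq_sub_cvg0 _ _ _ mu _ _ _ mD mB BD).
    by move=> n; apply: measurable_funB => //; exact: (smooth_measurable (smooth_derive i (sphi n)) mD).
  exact: (L2norm_cvg0 _ _ _).1.
- have [L L1 TL] := transition_expand lc lc'.
  apply: (@ge0_cvge0_le _ _ (fun n => L2sq (@leb2 R) (chart_part c' A) ((phi n \- tau) \o chart_graph c')) ((2 * L) ^+ 3)).
  + by move=> n; exact: L2sq_ge0.
  + by move=> n; exact: (surface_L2_transfer lc lc' mE mF EF L1 TL (mk n)).
  + exact: (L2norm_cvg0 _ _ _).1.
Qed.

Lemma approximableB B c E f1 f2 W1 W2 tau1 tau2 : measurable B -> measurable E ->
  lipschitz_chart c -> L2 mu B f1 -> L2 mu B f2 ->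
  (forall i, L2 mu B (W1 i)) -> (forall i, L2 mu B (W2 i)) ->
  measurable_fun E (tau1 \o chart_graph c) -> measurable_fun E (tau2 \o chart_graph c) ->
  approximable B c E f1 W1 tau1 -> approximable B c E f2 W2 tau2 ->
  approximable B c E (f1 \- f2) (fun i => W1 i \- W2 i) (tau1 \- tau2).
Proof.
move=> mB mE lc Lf1 Lf2 LW1 LW2 mt1 mt2 [p1 [s1 f1c w1c t1c]] [p2 [s2 f2c w2c t2c]].
exists (fun n => p1 n \- p2 n); split.
- by move=> n; exact: smoothB.
- apply: (@L2sqB_cvg0 _ _ _ mu B (fun n => p1 n \- f1) (fun n => p2 n \- f2) _ mB _ _ _ f1c f2c).
  + by move=> n; apply: measurable_funB; [exact: (smooth_measurable (s1 n) mB)|exact: (@L2_measurable _ _ _ mu)].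
  + by move=> n; apply: measurable_funB; [exact: (smooth_measurable (s2 n) mB)|exact: (@L2_measurable _ _ _ mu)].
  + by move=> n x _ /=; ring.
- move=> i; apply: (@L2sqB_cvg0 _ _ _ mu B (fun n => 'D_(e i) (p1 n) \- W1 i) (fun n => 'D_(e i) (p2 n) \- W2 i) _ mB _ _ _ (w1c i) (w2c i)).
  + by move=> n; apply: measurable_funB; [exact: (smooth_measurable (smooth_derive i (s1 n)) mB)|exact: (@L2_measurable _ _ _ mu)].
  + by move=> n; apply: measurable_funB; [exact: (smooth_measurable (smooth_derive i (s2 n)) mB)|exact: (@L2_measurable _ _ _ mu)].
  + by move=> n x _; rewrite /= (deriveB_smooth _ _ (s1 n) (s2 n)); ring.
- apply: (@L2sqB_cvg0 _ _ _ (@leb2 R) E (fun n => (p1 n \- tau1) \o chart_graph c) (fun n => (p2 n \- tau2) \o chart_graph c) _ mE _ _ _ t1c t2c).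
  + by move=> n; exact: (measurable_funB (smooth_graph_measurable lc (s1 n)) mt1).
  + by move=> n; exact: (measurable_funB (smooth_graph_measurable lc (s2 n)) mt2).
  + by move=> n s _ /=; ring.
Qed.

Lemma Rintegral_ae_split D1 D2 B (F : pt3 R -> R) : open D1 -> open D2 -> open B ->
  (forall x, D1 x -> D2 x -> False) -> {ae mu, forall x, B x -> D1 x \/ D2 x} ->
  mu.-integrable B (EFin \o F) ->
  \int[mu]_(x in B) F x = \int[mu]_(x in D1 `&` B) F x + \int[mu]_(x in D2 `&` B) F x.
Proof.
move=> oD1 oD2 oB D12 aeD iF; have mB := open_measurable3 oB.
have mDB1 := open_measurable3 (openI oD1 oB); have mDB2 := open_measurable3 (openI oD2 oB).
have mU := measurableU _ _ mDB1 mDB2.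
have UB : (D1 `&` B) `|` (D2 `&` B) `<=` B by move=> x [[]|[]].
have iU := integrableS3 mB mU UB iF.
rewrite -(@Rintegral_setU _ _ _ mu _ _ _ mDB1 mDB2 iU); last first.
  by apply/disj_setPS => x [[/D12 h _] [/h]].
have mF := proj1 (measurable_EFinP _ _) (@measurable_int _ _ _ mu _ _ iF).
rewrite Rintegral_mkcond [RHS]Rintegral_mkcond.
apply: ae_eq_Rintegral => //.
- by apply/(measurable_restrict _ mB measurableT); rewrite setTI.
- apply/(measurable_restrict _ mU measurableT); rewrite setTI.
  exact: measurable_funS mB UB mF.
apply: ae3S aeD => x h _; rewrite /patch.
have [Bx|nBx] := pselect (B x).
  by rewrite !mem_set//; have [] := h Bx; [left|right].
by rewrite !memNset// => -[[]|[]].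
Qed.

(** The boundary terms of the approximants tend to zero together with their traces, so no defect is
    left for tests that do not vanish on the graph. This is what permits extension by zero across
    the boundary. *)
Lemma glue_zero_trace D x0 c B E f W i phi : open D -> boundary_chart D x0 c -> open B ->
  B `<=` chart_box c -> (mu B < +oo)%E -> L2 mu (D `&` B) f -> L2 mu (D `&` B) (W i) ->
  measurable E -> E `<=` chart_base c -> (forall s, chart_base c s -> B (chart_graph c s) -> E s) ->
  approximable (D `&` B) c E f W (fun=> 0) -> test_function B phi ->
  wgap (D `&` B) i f (W i) phi = 0.
Proof.
move=> oD bc oB Bb Bfin Lf Lw mE Eb BE [p [sp fc wc tc]] tphi.
have mDB := open_measurable3 (openI oD oB).
have DBfin : (mu (D `&` B) < +oo)%E.
  apply: le_lt_trans Bfin; apply: leb3_le => //; exact: open_measurable3.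
have c1 := green_cvg mDB DBfin Lf Lw sp tphi fc (wc i).
have tc' : (fun n => L2sq (@leb2 R) E (p n \o chart_graph c)) @ \oo --> 0%E.
  rewrite (_ : (fun n => _) = (fun n => L2sq (@leb2 R) E ((p n \- (fun=> 0)) \o chart_graph c)))//.
  apply/funext => n; apply: eq_integral => s _.
  by change ((p n (chart_graph c s) ^+ 2)%:E = ((p n (chart_graph c s) - 0) ^+ 2)%:E); rewrite subr0.
have phi0 s : chart_base c s -> ~ E s -> phi (chart_graph c s) = 0.
  by move=> bs nE; apply: (test_zero tphi) => /(BE s bs).
have c2 := @boundary_term_cvg0 R D x0 c i p phi E oD bc sp (test_subset Bb tphi) mE Eb phi0 tc'.
have Eq : (fun n => \int[mu]_(x in D `&` chart_box c) 'D_(e i) (fun y => p n y * phi y) x) =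
  (fun n => \int[mu]_(x in D `&` B) 'D_(e i) (fun y => p n y * phi y) x).
  apply/funext => n; apply: Rintegral_supp => [x [Dx /Bb]//|x [Dx bx] nDB].
  apply: (test_zero (test_derive i (testM_smooth (sp n) tphi))) => Bx.
  by apply: nDB.
rewrite Eq in c2; exact: (cvg_unique _ c1 c2).
Qed.

(** The two sides cover [B] up to a null set, so a boundary term over [D2] is the opposite of the
    one over [D1]. The sum of the defects is then the limit of the boundary terms over [D1] of
    [p n - q n], whose trace tends to [tau1 - tau2], which is zero. Only a chart of [D1] is
    involved. *)
Lemma glue_two_sides D1 D2 x0 c B E f W tau1 tau2 i phi : open D1 -> open D2 ->
  boundary_chart D1 x0 c -> open B -> B `<=` chart_box c -> (mu B < +oo)%E ->
  (forall x, D1 x -> D2 x -> False) -> {ae mu, forall x, B x -> D1 x \/ D2 x} ->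
  L2 mu (D1 `&` B) f -> L2 mu (D1 `&` B) (W i) -> L2 mu (D2 `&` B) f -> L2 mu (D2 `&` B) (W i) ->
  measurable E -> E `<=` chart_base c -> (forall s, chart_base c s -> B (chart_graph c s) -> E s) ->
  measurable_fun E (tau1 \o chart_graph c) -> measurable_fun E (tau2 \o chart_graph c) ->
  {ae (@leb2 R), forall s, E s -> tau1 (chart_graph c s) = tau2 (chart_graph c s)} ->
  approximable (D1 `&` B) c E f W tau1 -> approximable (D2 `&` B) c E f W tau2 ->
  test_function B phi ->
  wgap (D1 `&` B) i f (W i) phi + wgap (D2 `&` B) i f (W i) phi = 0.
Proof.
move=> oD1 oD2 bc oB Bb Bfin D12 aeD Lf1 Lw1 Lf2 Lw2 mE Eb BE mt1 mt2 t12
  [p [sp fc wc tc]] [q [sq fc2 wc2 tc2]] tphi.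
have lc := boundary_lipschitz_chart bc.
have mB := open_measurable3 oB.
have mDB1 := open_measurable3 (openI oD1 oB); have mDB2 := open_measurable3 (openI oD2 oB).
have DBfin1 : (mu (D1 `&` B) < +oo)%E by apply: le_lt_trans Bfin; apply: leb3_le.
have DBfin2 : (mu (D2 `&` B) < +oo)%E by apply: le_lt_trans Bfin; apply: leb3_le.
have c1 := green_cvg mDB1 DBfin1 Lf1 Lw1 sp tphi fc (wc i).
have c2 := green_cvg mDB2 DBfin2 Lf2 Lw2 sq tphi fc2 (wc2 i).
(* The derivative of a function with compact support in [B] has zero integral over [B]. *)
have split0 G : test_function B G -> \int[mu]_(x in D2 `&` B) 'D_(e i) G x =
    - \int[mu]_(x in D1 `&` B) 'D_(e i) G x.
  move=> tG; apply/eqP; rewrite -addr_eq0; apply/eqP.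
  have iG A : measurable A -> mu.-integrable A (EFin \o 'D_(e i) G).
    exact: test_integrable (test_derive i tG).
  rewrite -(Rintegral_derive0 i (test_subset (@subsetT _ _) tG)).
  rewrite [RHS](@Rintegral_supp _ setT B)//; last first.
    by move=> x _ nBx; exact: (test_zero (test_derive i tG) nBx).
  by rewrite addrC (Rintegral_ae_split oD1 oD2 oB D12 aeD (iG _ mB)).
have tc' : (fun n => L2sq (@leb2 R) E ((p n \- q n) \o chart_graph c)) @ \oo --> 0%E.
  have mp n := measurable_funB (smooth_graph_measurable (E := E) lc (sp n)) mt1.
  have mq n := measurable_funB (smooth_graph_measurable (E := E) lc (sq n)) mt2.
  pose k n s := (p n \- tau1) (chart_graph c s) - (q n \- tau2) (chart_graph c s).
  have kc : (fun n => L2sq (@leb2 R) E (k n)) @ \oo --> 0%E.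
    exact: (@L2sqB_cvg0 _ _ _ (@leb2 R) E _ _ k mE mp mq (fun _ _ _ => erefl) tc tc2).
  rewrite (_ : (fun n => _) = (fun n => L2sq (@leb2 R) E (k n)))//.
  apply/funext => n; apply: ae_eq_integral => //.
  - by apply: measurable_sqr; exact: (smooth_graph_measurable (E := E) lc (smoothB (sp n) (sq n))).
  - by apply: measurable_sqr; exact: (measurable_funB (mp n) (mq n)).
  - apply: ae2S t12 => s h Es; congr (EFin (_ ^+ 2)).
    by rewrite /k /= (h Es); ring.
have phi0 s : chart_base c s -> ~ E s -> phi (chart_graph c s) = 0.
  by move=> bs nE; apply: (test_zero tphi) => /(BE s bs).
have c3 := @boundary_term_cvg0 R D1 x0 c i (fun n => p n \- q n) phi E oD1 bc (fun n => smoothB (sp n) (sq n)) (test_subset Bb tphi) mE Eb phi0 tc'.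
have Eq : (fun n => \int[mu]_(x in D1 `&` chart_box c) 'D_(e i) (fun y => (p n \- q n) y * phi y) x) =
  (fun n => \int[mu]_(x in D1 `&` B) 'D_(e i) (fun y => p n y * phi y) x +
            \int[mu]_(x in D2 `&` B) 'D_(e i) (fun y => q n y * phi y) x).
  apply/funext => n.
  have tp := testM_smooth (sp n) tphi; have tq := testM_smooth (sq n) tphi.
  rewrite (split0 _ tq) -RintegralB//; last 2 first.
  - exact: test_integrable (test_derive i tp) mDB1.
  - exact: test_integrable (test_derive i tq) mDB1.
  rewrite (@Rintegral_supp _ _ (D1 `&` B)).
  - apply: eq_Rintegral => x _.
    rewrite -(deriveB_smooth _ _ (test_smooth tp) (test_smooth tq)); congr ('D_(e i) _ x).
    by apply/funext => y /=; ring.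
  - by move=> x [Dx /Bb].
  move=> x [Dx bx] nDB.
  apply: (test_zero (test_derive i (testM_smooth (smoothB (sp n) (sq n)) tphi))) => Bx.
  by apply: nDB.
rewrite Eq in c3; exact: (cvg_unique _ (cvgD c1 c2) c3).
Qed.

End approximants.

Section outer.
Context (R : realType).
Implicit Types (D Omega : set (pt3 R)).

Lemma closure_outer D Omega x c : open Omega -> boundary_chart D x c -> Omega x ->
  closure (Omega `\` closure D) x.
Proof.
move=> oO bc Ox; have lc := boundary_lipschitz_chart bc.
pose p (n : nat) : pt3 R := chart_map c (0, - n.+1%:R^-1).
have cm0 : chart_map c 0 = x.
  rewrite -(bc_origin bc) /chart_map big1 ?addr0// => i _.
  have -> : coord i 0 = 0 :> R by rewrite -(subrr (0 : pt3 R)) coordD coordN subrr.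
  by rewrite scale0r.
have pc : p @ \oo --> x.
  rewrite -cm0; apply/cvgrPdist_lt => eps eps0; near=> n.
  apply: (le_lt_trans (chart_map_lip lc _ _)); rewrite -ltr_pdivlMl// sub0r normrN.
  rewrite prod_normE gt_max; apply/andP; split => /=.
    by rewrite normr0 mulr_gt0// invr_gt0.
  rewrite normrN ger0_norm//; near: n.
  have e0 : 0 < 3^-1 * eps by rewrite mulr_gt0// invr_gt0.
  exact: (near_infty_natSinv_lt (PosNum e0)).
move=> B nB; have nB' : nbhs x ((B `&` Omega) `&` chart_box c).
  apply: filterI; last by apply: open_nbhs_nbhs; split; [exact: (open_chart_box lc)|exact: chart_box_center bc].
  by apply: filterI => //; exact: open_nbhs_nbhs.
have [n _ pB] := pc _ nB'; have [[Bp Op] boxp] := pB n (leqnn n).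
exists (p n); split => //; split => //; apply: (below_graph_closure bc boxp).
by rewrite /flatten_chart /p (chart_mapK lc) /= (bc_center bc) subr0 oppr_lt0 invr_gt0.
Unshelve. all: by end_near. Qed.

End outer.

(** * Removability of a Lipschitz curve *)

Section edge.
Context (R : realType).
Implicit Types (D K V : set (pt3 R)) (i j : 'I_3).
Local Notation e := (@basis R).
Local Notation mu := (@leb3 R).

Lemma derive_invariant (f : pt3 R -> R) i x : (forall y (s : R), f (y + s *: e i) = f y) ->
  'D_(e i) f x = 0.
Proof.
move=> fi; apply: cvg_lim => //; apply: cvg_near_cst; near=> s.
by rewrite /= [X in f X - _]addrC fi subrr scaler0.
Unshelve. all: by end_near. Qed.

Lemma smooth_prod (I : Type) (r : seq I) (F : I -> pt3 R -> R) : (forall k, smooth (F k)) ->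
  smooth (fun x => \prod_(k <- r) F k x).
Proof.
move=> sF; elim: r => [|k r IH].
  rewrite (_ : (fun x => _) = fun=> 1); first exact: smooth_cst.
  by apply/funext => x; rewrite big_nil.
rewrite (_ : (fun x => _) = fun x => F k x * \prod_(k <- r) F k x); first exact: smoothM.
by apply/funext => x; rewrite big_cons.
Qed.

Definition closed_box (p q : 'I_3 -> R) : set (pt3 R) :=
  `[p ord0, q ord0]%classic `*` `[p (@Ordinal 3 1 isT), q (@Ordinal 3 1 isT)]%classic `*`
  `[p (@Ordinal 3 2 isT), q (@Ordinal 3 2 isT)]%classic.

Lemma closed_boxP p q x : closed_box p q x <-> forall j, p j <= coord j x <= q j.
Proof.
split=> [[[h0 h1] h2]|H]; last first.
  by split; [split|]; rewrite /= in_itv/=; exact: (H (Ordinal _)).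
move: h0 h1 h2; rewrite /= !in_itv/= => h0 h1 h2 [[|[|[|//]]] pr]; rewrite /coord/=.
- by rewrite (_ : Ordinal pr = ord0)//; exact: val_inj.
- by rewrite (_ : Ordinal pr = @Ordinal 3 1 isT)//; exact: val_inj.
- by rewrite (_ : Ordinal pr = @Ordinal 3 2 isT)//; exact: val_inj.
Qed.

Lemma measurable_closed_box p q : measurable (closed_box p q).
Proof. by apply: measurableX; [apply: measurableX|]; exact: measurable_itv. Qed.

Lemma leb3_closed_box p q : (forall j, p j <= q j) ->
  mu (closed_box p q) = (\prod_j (q j - p j))%:E.
Proof.
move=> pq; have lI (a b : R) : a <= b -> @lebesgue_measure R `[a, b]%classic = (b - a)%:E.
  move=> ab; rewrite (@lebesgue_measure_itv R) /= lte_fin; case: ltP => // ba.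
  have -> : b = a by apply/eqP; rewrite eq_le ba ab.
  by rewrite subrr.
rewrite /closed_box leb3XX; [|exact: measurable_itv..].
rewrite !lI// -!EFinM; congr EFin; rewrite !big_ord_recl big_ord0 mulr1 mulrA.
by congr (_ * (_ - _) * (_ - _)); [congr q|congr p|congr q|congr p]; exact: val_inj.
Qed.

Section removal.
Variables (D K V : set (pt3 R)) (f w : pt3 R -> R) (i : 'I_3).
Variables (gam : R -> pt3 R) (L r0 : R).
Hypotheses (oD : open D) (oDK : open (D `\` K)).
Hypotheses (Lf : L2 mu D f) (Lw : L2 mu D w).
Hypotheses (L0 : 0 < L) (r00 : 0 < r0).
Hypothesis gamL : forall s t, `|gam s - gam t| <= L * `|s - t|.
Hypothesis KV : forall x, K x -> V x -> exists2 s, `|s| <= r0 & gam s = x.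
Hypothesis weak : forall phi, test_function (D `\` K) phi -> wgap (D `\` K) i f w phi = 0.

Section cut.
Variable N : nat.
Hypothesis N0 : (0 < N)%N.

(** Parameters spaced by [2 r0 / N], from [- r0] to [r0]: there are [N.+1] of them. [rho] bounds the
    variation of the curve over one spacing. *)
Let node (k : nat) : R := k%:R * (2 * r0 / N%:R) - r0.
Let rho : R := L * (2 * r0 / N%:R).

Let h0 : 0 < 2 * r0 / N%:R.
Proof. by rewrite divr_gt0 ?mulr_gt0// ltr0n. Qed.

Let rho0 : 0 < rho. Proof. by rewrite mulr_gt0. Qed.

Lemma node_near s : `|s| <= r0 -> exists2 k, (k < N.+1)%N & `|gam s - gam (node k)| <= rho.
Proof.
rewrite ler_norml => /andP[s1 s2].
pose t := (s + r0) / (2 * r0 / N%:R).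
have t0 : 0 <= t by rewrite divr_ge0 ?(ltW h0)//; lra.
have tE : t * (2 * r0 / N%:R) = s + r0 by rewrite /t divfK// gt_eqF.
exists (Num.truncn t).
  rewrite ltnS -(ler_nat R) (@le_trans _ _ t)// ?truncn_le//.
  have NE : N%:R * (2 * r0 / N%:R) = 2 * r0 by rewrite mulrC divfK// pnatr_eq0 -lt0n.
  by rewrite -(ler_pM2r h0) tE NE; lra.
rewrite (le_trans (gamL _ _))// ler_pM2l//.
have := truncn_itv t0; rewrite -natr1 => /andP[t1 t2].
rewrite /node (_ : s - _ = (t - (Num.truncn t)%:R) * (2 * r0 / N%:R)); last first.
  by rewrite mulrBl tE; ring.
rewrite normrM [X in _ * X](ger0_norm (ltW h0)) ler_piMl ?(ltW h0)//.
by rewrite ger0_norm; lra.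
Qed.

(** Equal to 1 up to distance [2 rho] from the node and to 0 beyond [3 rho], in the two directions
    other than [i]. Each point of the curve is within [rho] of a node, which leaves a margin: the
    cutoff vanishes in a whole neighbourhood of the curve. *)
Let strip (k : nat) : 'I_3 -> R -> R := fun j => if j == i then (fun=> 1) else
  window (coord j (gam (node k)) - 3 * rho) (coord j (gam (node k)) + 3 * rho) rho^-1.

Let hole (k : nat) : pt3 R -> R := tens (strip k).

Let smooth_hole k : smooth (hole k).
Proof.
apply: smooth_tens => j; rewrite /strip; case: eqP => _; last exact: smooth1_window.
by move=> n; exact: C1n_cst.
Qed.

(* The cutoff does not depend on the coordinate [i]: derivatives of a test function in the
   direction [i] are not affected by it, so that a curve can be removed although the
   gradient of the cutoff is not controlled. *)
Definition curve_cutoff (x : pt3 R) : R := \prod_(k < N.+1) (1 + -1 * hole k x).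

Lemma smooth_curve_cutoff : smooth curve_cutoff.
Proof.
apply: smooth_prod => k; apply: smoothD; first exact: smooth_cst.
exact: smoothZ.
Qed.

Let strip01 k j t : 0 <= strip k j t <= 1.
Proof.
rewrite /strip; case: eqP => _; first by rewrite ler01 lexx.
by rewrite window_ge0 window_le1.
Qed.

Let hole01 k x : 0 <= hole k x <= 1.
Proof.
rewrite /hole /tens prodr_ge0/=; last by move=> j _; have /andP[] := strip01 k j (coord j x).
apply: (@le_trans _ _ (\prod_(j < 3) (1 : R))); last by rewrite big1.
by apply: ler_prod => j _; exact: strip01.
Qed.

Lemma curve_cutoff01 x : 0 <= curve_cutoff x <= 1.
Proof.
have H k : 0 <= 1 + -1 * hole k x <= 1.
  by have /andP[a b] := hole01 k x; apply/andP; split; lra.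
rewrite /curve_cutoff prodr_ge0/=; last by move=> k _; have /andP[] := H k.
apply: (@le_trans _ _ (\prod_(k < N.+1) (1 : R))); last by rewrite big1.
by apply: ler_prod => k _; exact: H.
Qed.

Lemma derive_curve_cutoff x : 'D_(e i) curve_cutoff x = 0.
Proof.
apply: derive_invariant => y s; apply: eq_bigr => k _; congr (1 + -1 * _).
apply: eq_bigr => j _; rewrite /strip; case: eqP => // /eqP ji.
by rewrite coordD coordZ coord_basis (negbTE ji) mulr0 addr0.
Qed.

Lemma curve_cutoff_near k x : (k < N.+1)%N -> `|x - gam (node k)| < 2 * rho -> curve_cutoff x = 0.
Proof.
move=> kN xk; suff h1 : hole k x = 1.
  by rewrite /curve_cutoff (bigD1 (Ordinal kN))//= h1 mulr1 subrr mul0r.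
rewrite /hole /tens big1// => j _; rewrite /strip; case: eqP => // _.
have := le_lt_trans (coord_norm j (x - gam (node k))) xk.
rewrite coordD coordN ltr_norml => /andP[h1 h2].
by rewrite window_in ?invr_gt0// invrK; lra.
Qed.

(** The strips are unbounded in direction [i]; truncating them at [M], a bound for the support of
    the test function, gives them finite volume. *)
Let bad_box (M : R) (k : nat) : set (pt3 R) :=
  closed_box (fun j => if j == i then - M else coord j (gam (node k)) - 3 * rho)
             (fun j => if j == i then M else coord j (gam (node k)) + 3 * rho).

Definition bad_set (M : R) : set (pt3 R) := \big[setU/set0]_(k < N.+1) bad_box M k.

Lemma curve_cutoff_far M x : `|x| <= M -> ~ bad_set M x -> curve_cutoff x = 1.
Proof.
move=> xM nb; rewrite /curve_cutoff big1// => k _.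
suff -> : hole k x = 0 by rewrite mulr0 addr0.
have nbk : ~ bad_box M k x.
  by move=> H; apply: nb; rewrite /bad_set -bigcup_mkord; exists (val k) => //=.
have /existsNP[j nj] : ~ (forall j, (if j == i then - M else coord j (gam (node k)) - 3 * rho) <=
    coord j x <= (if j == i then M else coord j (gam (node k)) + 3 * rho)).
  by move=> H; apply: nbk; apply/closed_boxP.
rewrite /hole /tens (bigD1 j)//= /strip; move: nj; case: eqP => _.
  move=> nj; exfalso; apply: nj; rewrite -ler_norml; exact: le_trans (coord_norm j x) xM.
move=> /negP; rewrite negb_and -!ltNge => /orP h; rewrite window_out ?mul0r ?invr_ge0 ?(ltW rho0)//.
by case: h => h; [left|right]; exact: ltW.
Qed.

Lemma measurable_bad_set M : measurable (bad_set M).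
Proof. by apply: bigsetU_measurable => k _; exact: measurable_closed_box. Qed.

Let leb3_bad_box M k : 0 <= M -> mu (bad_box M k) = ((6 * rho) ^+ 2 * (2 * M))%:E.
Proof.
move=> M0; rewrite leb3_closed_box; last by move=> j; case: eqP => _; [lra|have := rho0; lra].
congr EFin; rewrite (bigD1 i)//= eqxx (eq_bigr (fun=> 6 * rho)); last first.
  by move=> j /negbTE ->; ring.
rewrite prodr_const.
have -> : #|[pred j : 'I_3 | j != i]| = 2%N.
  have -> : #|[pred j : 'I_3 | j != i]| = #|predC (pred1 i)|.
    by apply: eq_card => j; rewrite !inE.
  by have := cardC (pred1 i); rewrite card1 card_ord add1n => -[].
by ring.
Qed.

(** There are [N + 1 <= 2 N] boxes with cross-section [(6 rho)^2], of order [1 / N^2], and length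
    [2 M]. The total volume is of order [1 / N]: codimension two is what makes it small. *)
Lemma leb3_bad_set M : 0 <= M ->
  (mu (bad_set M) <= (144 * M * (L * (2 * r0)) ^+ 2 / N%:R)%:E)%E.
Proof.
move=> M0; apply: (@le_trans _ _ (\sum_(k < N.+1) ((6 * rho) ^+ 2 * (2 * M))%:E)%E).
  have H := @Boole_inequality _ _ _ mu (bad_box M) N.+1 (fun k _ => @measurable_closed_box _ _).
  apply: (le_trans H); apply: lee_sum => k _.
  exact: (eq_ind_r (fun x => (x <= _)%E) (lexx _) (leb3_bad_box k M0)).
rewrite sumEFin sumr_const card_ord lee_fin -[X in X <= _]mulr_natl.
have N0' : 0 < N%:R :> R by rewrite ltr0n.
have -> : 144 * M * (L * (2 * r0)) ^+ 2 / N%:R = (2 * N%:R) * ((6 * rho) ^+ 2 * (2 * M)).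
  by rewrite /rho; field; rewrite gt_eqF.
rewrite ler_wpM2r//; first by rewrite mulr_ge0 ?sqr_ge0// mulr_ge0.
by rewrite -natr1 mulr_natl mulr2n lerD2l ler1n.
Qed.

End cut.

(* With [N = m^2] nodes the bad set has volume [O(1 / m^2)], and
   [2 |F| <= F^2 / m + m] on it. *)
Lemma edge_removal phi : test_function (D `&` V) phi -> wgap D i f w phi = 0.
Proof.
move=> tphi; have [sphi [K0 [cK0 K0D phi0]]] := tphi.
have mD := open_measurable3 oD.
have tphiD : test_function D phi by apply: test_subset tphi => x [].
pose F x := f x * 'D_(e i) phi x + w x * phi x.
have [M1 phiM1] := test_bounded tphi; have [M2 dphiM2] := test_bounded (test_derive i tphi).
have LF : L2 mu D F.
  apply: (@L2D _ _ _ mu D) => //.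
    exact: (@L2_bounded_integrable _ _ _ mu D f _ M2 mD Lf (test_measurable (test_derive i tphi) mD) (fun x _ => dphiM2 x)).
  exact: (@L2_bounded_integrable _ _ _ mu D w _ M1 mD Lw (test_measurable tphi mD) (fun x _ => phiM1 x)).
have mF := @L2_measurable _ _ _ mu D F mD LF.
have [M M0 K0M] : exists2 M : R, 0 <= M & forall x, K0 x -> `|x| <= M.
  have [M M0 KM] := bounded_cube (compact_bounded cK0).
  by exists M => // x /KM/cubeP; rewrite subr0.
have F0 x : ~ K0 x -> F x = 0.
  by move=> nK; rewrite /F phi0// (test_derive_out _ (compact_closed3 cK0) phi0)// !mulr0 addr0.
pose Q := fine (L2sq mu D F).
have QE : L2sq mu D F = Q%:E.
  by rewrite fineK// ge0_fin_numE ?L2sq_ge0//; exact: (@L2_lty _ _ _ mu D F mD LF).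
pose c := 144 * M * (L * (2 * r0)) ^+ 2.
have c0 : 0 <= c by apply: mulr_ge0; [rewrite mulr_ge0|exact: sqr_ge0].
have key m : (0 < m)%N -> `|wgap D i f w phi| <= (Q + c) / m%:R.
  move=> m0; have N0 : (0 < m * m)%N by rewrite muln_gt0 m0.
  have mR : 0 < m%:R :> R by rewrite ltr0n.
  pose chi := curve_cutoff (m * m).
  have schi : smooth chi by exact: smooth_curve_cutoff.
  have snchi : smooth (fun y => 1 + -1 * chi y).
    by apply: smoothD; [exact: smooth_cst|exact: smoothZ].
  have t1 : test_function D (fun y => chi y * phi y) by exact: testM_smooth.
  have t2 : test_function D (fun y => (1 + -1 * chi y) * phi y) by exact: testM_smooth.
  have tK : test_function (D `\` K) (fun y => chi y * phi y).
    split; first by case: t1.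
    (* The union of the balls of radius [2 rho] around the nodes, where the cutoff vanishes.
       Removing it from the support leaves a compact set that avoids [K], so the truncated function
       is a test function away from the edge. *)
    pose O : set (pt3 R) := \bigcup_(k in `I_(m * m).+1) ball (gam (k%:R * (2 * r0 / (m * m)%:R) - r0)) (2 * (L * (2 * r0 / (m * m)%:R))).
    have oO : open O by apply: bigcup_open => k _; exact: ball_open.
    exists (K0 `\` O); split.
    - apply: (subclosed_compact _ cK0) => [|x []//].
      apply: closedI; first exact: compact_closed3.
      exact: open_closedC.
    - move=> x [K0x nO]; have [Dx Vx] := K0D x K0x; split => // Kx; apply: nO.
      have [s sr E] := KV Kx Vx; have [k kN kP] := node_near N0 sr.
      exists k => //; rewrite -ball_normE /ball_/= distrC -E (le_lt_trans kP)//.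
      by rewrite ltr_pMl ?ltr1n// mulr_gt0// divr_gt0 ?mulr_gt0// ltr0n.
    - move=> x nx; have [K0x|/phi0->] := pselect (K0 x); last by rewrite mulr0.
      have [k kN] : O x by apply: contrapT => nO; exact: nx.
      rewrite -ball_normE /ball_/= distrC => xk.
      by rewrite [chi x](curve_cutoff_near N0 kN xk) mul0r.
  (* The part truncated away from [K] contributes nothing by [weak]. In the other part the cutoff
     passes through the derivative in direction [i] and only multiplies [F]. *)
  have E : wgap D i f w phi = \int[mu]_(x in D) ((1 + -1 * chi x) * F x).
    rewrite (_ : phi = fun y => chi y * phi y + (1 + -1 * chi y) * phi y); last first.
      by apply/funext => y; ring.
    rewrite (wgapD i mD Lf Lw t1 t2) (wgap_supp i f w (@subDsetl _ D K) tK) weak// add0r.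
    apply: eq_Rintegral => x _; rewrite (deriveM_smooth _ _ snchi sphi).
    have -> : 'D_(e i) (fun y => 1 + -1 * chi y) x = 0.
      rewrite (deriveD_smooth _ _ (smooth_cst 1) (smoothZ (-1) schi)).
      rewrite (deriveM_smooth _ _ (smooth_cst (-1)) schi) derive_curve_cutoff.
      by rewrite -[fun=> 1]/(cst 1) -[fun=> -1]/(cst (-1)) !derive_cst !mulr0 !addr0.
    by rewrite /F; ring.
  have mcF : measurable_fun D (fun x => (1 + -1 * chi x) * F x).
    by apply: measurable_funM => //; exact: (smooth_measurable snchi mD).
  have mb := measurable_bad_set (m * m) M.
  have ms := measurable_sqr mF.
  have mB1 : measurable_fun D (fun x => (\1_(bad_set (m * m) M) x : R)%:E).
    by apply/measurable_EFinP; exact: measurable_indic.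
  have m1F : measurable_fun D (fun x => (m%:R^-1)%:E * (F x ^+ 2)%:E)%E.
    exact: (measurable_funeM _ ms).
  have m2F : measurable_fun D (fun x => m%:R%:E * (\1_(bad_set (m * m) M) x : R)%:E)%E.
    exact: (measurable_funeM _ mB1).
  rewrite E -lee_fin; apply: (le_trans (fine_norm_le _)).
  apply: (le_trans (@le_abse_integral _ _ _ mu D _ mD (proj2 (measurable_EFinP _ _) mcF))).
  apply: (@le_trans _ _ (\int[mu]_(x in D) ((m%:R^-1)%:E * (F x ^+ 2)%:E +
    m%:R%:E * (\1_(bad_set (m * m) M) x : R)%:E))%E).
    apply: (@ge0_le_integral _ _ _ mu D mD).
    - by move=> x _; exact: abse_ge0.
    - by apply: measurableT_comp => //; exact/measurable_EFinP.
    - exact: emeasurable_funD.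
    move=> x Dx; rewrite /= -!EFinM -EFinD lee_fin.
    have [K0x|nK] := pselect (K0 x); last first.
      by rewrite F0// mulr0 normr0 expr0n mulr0 add0r mulr_ge0.
    rewrite indicE; case: (boolP (x \in _)) => [_|]; last first.
      rewrite notin_setE => nb; rewrite [chi x](curve_cutoff_far N0 (K0M _ K0x) nb).
      by rewrite mulr1 subrr mul0r normr0 mulr0 addr0 mulr_ge0 ?sqr_ge0.
    have /andP[a b] := curve_cutoff01 (m * m) x.
    rewrite normrM (@le_trans _ _ (1 * `|F x|))//.
      rewrite ler_wpM2r// ger0_norm; rewrite -/chi in a b *; lra.
    rewrite mul1r mulr1 -(ler_pM2l mR) mulrDr mulrA divff ?gt_eqF// mul1r.
    rewrite -[F x ^+ 2]real_normK ?num_real//; move: (`|F x|) => y; nra.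
  rewrite (@ge0_integralD _ _ _ mu D mD); last 4 first.
  - by move=> x _; rewrite -EFinM lee_fin mulr_ge0 ?sqr_ge0.
  - exact: m1F.
  - by move=> x _; rewrite -EFinM lee_fin mulr_ge0.
  - exact: m2F.
  rewrite (@ge0_integralZl _ _ _ mu D mD _ ms); last 2 first.
  - by move=> x _; rewrite lee_fin sqr_ge0.
  - by rewrite lee_fin.
  rewrite (@ge0_integralZl _ _ _ mu D mD _ mB1); last 2 first.
  - by move=> x _; rewrite lee_fin.
  - by rewrite lee_fin.
  rewrite -/(L2sq mu D F) QE (@integral_indic _ _ _ mu D mD _ mb) -EFinM.
  have bound : (mu (bad_set (m * m) M `&` D) <= (c / (m * m)%:R)%:E)%E.
    apply: le_trans (leb3_bad_set N0 M0); apply: leb3_le => //.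
    exact: measurableI.
  apply: (@le_trans _ _ ((m%:R^-1 * Q)%:E + m%:R%:E * (c / (m * m)%:R)%:E)%E).
    by rewrite leeD2l// lee_wpmul2l// lee_fin.
  rewrite -EFinM -EFinD lee_fin natrM [leRHS]mulrDl [_ * Q]mulrC lerD2l.
  rewrite (_ : m%:R * _ = c / m%:R)//; field; by rewrite gt_eqF.
apply/eqP; rewrite -normr_eq0 eq_le normr_ge0 andbT.
have Q0 : 0 <= Q by rewrite fine_ge0// L2sq_ge0.
have cv : (fun n => (Q + c) * n.+1%:R^-1) @ \oo --> (Q + c) * (0 : R).
  by apply: cvgMr; exact: cvg_harmonic.
rewrite mulr0 in cv; apply: (ler_cvg_to (@cvg_cst _ `|wgap D i f w phi| _ \oo _) cv).
by apply: nearW => n; exact: key.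
Qed.

End removal.
End edge.

(** * The difference of two solutions *)

Section transversal.
Context (R : realType).
Local Notation mu := (@leb3 R).

Lemma ae2I (P Q : pt2 R -> Prop) : {ae (@leb2 R), forall x, P x} ->
  {ae (@leb2 R), forall x, Q x} -> {ae (@leb2 R), forall x, P x /\ Q x}.
Proof.
move=> [N [mN N0 PN]] [M [mM M0 QM]]; exists (N `|` M); split.
- exact: measurableU.
- by apply: null_set_setU.
- move=> x /= /not_andP[nP|nQ]; [left; exact: PN|right; exact: QM].
Qed.

Lemma H1_sub (D D' : set (pt3 R)) f : open D -> open D' -> D' `<=` D -> H1 D f -> H1 D' f.
Proof.
move=> oD oD' DD [Lf Hf]; split.
  exact: (@L2S _ _ _ mu _ _ _ (open_measurable3 oD) (open_measurable3 oD') DD Lf).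
move=> i; have [w [Lw Hw]] := Hf i; exists w; split.
  exact: (@L2S _ _ _ mu _ _ _ (open_measurable3 oD) (open_measurable3 oD') DD Lw).
exact: is_weak_partialS Hw.
Qed.

Lemma eq_ae_approximable (B : set (pt3 R)) (c : chart R) (E : set (pt2 R)) f f' (tau : pt3 R -> R)
    (W W' : 'I_3 -> pt3 R -> R) : measurable B -> L2 mu B f -> L2 mu B f' ->
  (forall i, L2 mu B (W i)) -> (forall i, L2 mu B (W' i)) ->
  {ae mu, forall x, B x -> f x = f' x} ->
  (forall i, {ae mu, forall x, B x -> W i x = W' i x}) ->
  approximable B c E f W tau -> approximable B c E f' W' tau.
Proof.
move=> mB Lf Lf' LW LW' ff' WW' [p [sp fc wc tc]].
have mL g : L2 mu B g -> measurable_fun B g by exact: (@L2_measurable _ _ _ mu B).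
exists p; split => //.
- rewrite (_ : (fun n => _) = (fun n => L2sq mu B (p n \- f)))//; apply/funext => n.
  apply: ae_eq_integral => //; first by apply: measurable_sqr; apply: measurable_funB; [exact: (smooth_measurable (sp n) mB)|exact: mL].
    by apply: measurable_sqr; apply: measurable_funB; [exact: (smooth_measurable (sp n) mB)|exact: mL].
  by apply: ae3S ff' => x h Bx; rewrite /= (h Bx).
- move=> i; rewrite (_ : (fun n => _) = (fun n => L2sq mu B ('D_(@basis R i) (p n) \- W i)))//; apply/funext => n.
  have sd := smooth_measurable (smooth_derive i (sp n)) mB.
  apply: ae_eq_integral => //; first by apply: measurable_sqr; apply: measurable_funB; [exact: sd|exact: mL].
    by apply: measurable_sqr; apply: measurable_funB; [exact: sd|exact: mL].
  by apply: ae3S (WW' i) => x h Bx; rewrite /= (h Bx).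
Qed.

(** The determinant [dd] of the pair has square 1, and [b] is [dd] times the rotation of [a] by a
    right angle. This gives the dual orthonormality relations used in the expansion. *)
Lemma orthonormal2 (a b : pt2 R) (y : pt2 R) : a.1 ^+ 2 + a.2 ^+ 2 = 1 ->
  b.1 ^+ 2 + b.2 ^+ 2 = 1 -> a.1 * b.1 + a.2 * b.2 = 0 ->
  y = (y.1 * a.1 + y.2 * a.2) *: a + (y.1 * b.1 + y.2 * b.2) *: b.
Proof.
case: a b y => [a1 a2] [b1 b2] [y1 y2] /= ha hb hab.
pose dd := a1 * b2 - a2 * b1.
have dd2 : dd ^+ 2 = 1.
  have -> : dd ^+ 2 = (a1 ^+ 2 + a2 ^+ 2) * (b1 ^+ 2 + b2 ^+ 2) - (a1 * b1 + a2 * b2) ^+ 2 by rewrite /dd; ring.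
  by rewrite ha hb hab; ring.
have b1E : b1 = - dd * a2.
  have -> : - dd * a2 = (a1 ^+ 2 + a2 ^+ 2) * b1 - a1 * (a1 * b1 + a2 * b2) by rewrite /dd; ring.
  by rewrite ha hab; ring.
have b2E : b2 = dd * a1.
  have -> : dd * a1 = (a1 ^+ 2 + a2 ^+ 2) * b2 - a2 * (a1 * b1 + a2 * b2) by rewrite /dd; ring.
  by rewrite ha hab; ring.
have e11 : a1 ^+ 2 + b1 ^+ 2 = 1 by rewrite b1E exprMn sqrrN dd2 mul1r.
have e22 : a2 ^+ 2 + b2 ^+ 2 = 1 by rewrite b2E exprMn dd2 mul1r addrC.
have e12 : a1 * a2 + b1 * b2 = 0.
  have -> : b1 * b2 = - (dd ^+ 2) * (a1 * a2) by rewrite b1E b2E; ring.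
  by rewrite dd2; ring.
congr (_, _); rewrite /=.
  have -> : (y1 * a1 + y2 * a2) *: a1 + (y1 * b1 + y2 * b2) *: b1 =
    y1 * (a1 ^+ 2 + b1 ^+ 2) + y2 * (a1 * a2 + b1 * b2) by rewrite /GRing.scale/=; ring.
  by rewrite e11 e12; ring.
have -> : (y1 * a1 + y2 * a2) *: a2 + (y1 * b1 + y2 * b2) *: b2 =
  y2 * (a2 ^+ 2 + b2 ^+ 2) + y1 * (a1 * a2 + b1 * b2) by rewrite /GRing.scale/=; ring.
by rewrite e22 e12; ring.
Qed.

Lemma unit2_norm (a : pt2 R) : a.1 ^+ 2 + a.2 ^+ 2 = 1 -> `|a| <= 1.
Proof.
move=> ha; rewrite prod_normE ge_max !ler_norml.
by apply/andP; split; apply/andP; split; have := sqr_ge0 a.1; have := sqr_ge0 a.2; nra.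
Qed.

Lemma closure_in_frontier (F S U : set (pt3 R)) : closed F -> S = F `&` U -> closure S `<=` F.
Proof.
by move=> cF -> x cx; apply: cF => B /cx[y [[Fy _] By]]; exists y.
Qed.

(** In the base of the chart, [S] is the part strictly above the graph of [psi]. A point of the
    closure cannot lie strictly below, since an open set around it would miss [S]; a point outside
    of [S] cannot lie strictly above. Edge points are thus on the image of the graph of [psi], a
    Lipschitz curve. *)
Lemma edge_on_curve (Om S U : set (pt3 R)) x : open Om -> S = frontier Om `&` U -> open U ->
  lipschitz_edge_at Om S x ->
  exists gam L r0 (V : set (pt3 R)), [/\ open V /\ V x, 0 < L, 0 < r0,
    forall s t : R, `|gam s - gam t| <= L * `|s - t| &
    forall z, (closure S `\` S) z -> V z -> exists2 s, `|s| <= r0 & gam s = z].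
Proof.
move=> oOm SE oU [c bc [a [b [r [h [psi [[ha hb hab] [[r0 h0 [k kl] psi0] [psih H]]]]]]]]].
have lc := boundary_lipschitz_chart bc.
have [Lg Lg0 gL] := chart_graph_lip lc.
have na := unit2_norm ha; have nb := unit2_norm hb.
have klE s t : `|psi s - psi t| <= `|k| * `|s - t|.
  have := kl (s, t); rewrite /= => /(_ (conj I I)) h1; apply: (le_trans h1).
  by rewrite ler_wpM2r// ler_norm.
pose gam s := chart_graph c (s *: a + psi s *: b).
pose sc z : R := (chart_inv c z).1.1 * a.1 + (chart_inv c z).1.2 * a.2.
pose tc z : R := (chart_inv c z).1.1 * b.1 + (chart_inv c z).1.2 * b.2.
have cI := chart_inv_continuous lc.
have c1 : continuous (fun z => (chart_inv c z).1.1).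
  by move=> z; apply: (continuous_comp (g := coord ord0)); [exact: cI|exact: continuous_coord].
have c2 : continuous (fun z => (chart_inv c z).1.2).
  by move=> z; apply: (continuous_comp (g := coord (@Ordinal 3 1 isT))); [exact: cI|exact: continuous_coord].
have csc : continuous sc by move=> z; apply: cvgD; apply: cvgMl; [exact: c1|exact: c2].
have ctc : continuous tc by move=> z; apply: cvgD; apply: cvgMl; [exact: c1|exact: c2].
have cpsi : continuous psi by exact: lip_continuous klE.
have open_abs (f : pt3 R -> R) (m : R) : continuous f -> open [set z | `|f z| < m].
  move=> cf; have -> : [set z | `|f z| < m] = (fun z => `|f z|) @^-1` [set t | t < m] by [].
  apply: open_comp => [z _|]; last exact: open_lt.
  by apply: cvg_norm; exact: cf.
have open_ltf (f g : pt3 R -> R) : continuous f -> continuous g -> open [set z | f z < g z].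
  move=> cf cg; have -> : [set z | f z < g z] = (fun z => f z - g z) @^-1` [set t | t < 0].
    by apply/seteqP; split => z /=; rewrite subr_lt0.
  apply: open_comp => [z _|]; last exact: open_lt.
  by apply: cvgB; [exact: cf|exact: cg].
pose V := chart_box c `&` ([set z | `|sc z| < r] `&` [set z | `|tc z| < h]).
have oV : open V.
  by apply: openI; [exact: (open_chart_box lc)|apply: openI; exact: open_abs].
have inv0 : chart_inv c x = 0.
  apply: coord_inj => i; rewrite coord_mk3 (bc_origin bc) subrr /dot big1.
    by rewrite -(subrr (0 : pt3 R)) coordD coordN subrr.
  by move=> j _; rewrite -(subrr (0 : pt3 R)) coordD coordN subrr mul0r.
have Vx : V x.
  split; first exact: chart_box_center bc.
  by split; rewrite /= /sc /tc inv0 /= !mul0r addr0 normr0.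
have onV z : V z -> frontier Om z -> [/\ `|sc z| < r, `|tc z| < h,
    chart_graph c (sc z *: a + tc z *: b) = z & S z <-> psi (sc z) < tc z].
  move=> [bz [sz tz]] fz; have [cz nz] := (frontierP z oOm).1 fz.
  have [y yb E] := frontier_graph oOm bc bz cz nz.
  have Ey : sc z *: a + tc z *: b = y.
    by rewrite /sc /tc -E (chart_graph_inv lc) /= -orthonormal2.
  have [_ HS] := H (sc z) (tc z) sz tz.
  by split; rewrite ?Ey//; rewrite Ey E in HS.
exists gam, (Lg * (1 + `|k|) + 1), r, V; split => //.
- by rewrite ltr_wpDl// mulr_ge0// addr_ge0.
- move=> s t; rewrite (le_trans (gL _ _))// (@le_trans _ _ (Lg * ((1 + `|k|) * `|s - t|)))//.
    rewrite ler_wpM2l//.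
    have -> : (s *: a + psi s *: b) - (t *: a + psi t *: b) = (s - t) *: a + (psi s - psi t) *: b.
      by rewrite !scalerBl opprD addrACA.
    rewrite (le_trans (ler_normD _ _))// !normrZ mulrDl mul1r lerD//.
      by rewrite ler_piMr.
    by rewrite (le_trans _ (klE s t))// ler_piMr.
  by have := normr_ge0 (s - t); move: (`|s - t|) => q q0; lra.
- move=> z [cz nSz] Vz; have fz := closure_in_frontier (@closed_frontier R Om) SE cz.
  have [sz tz E HS] := onV z Vz fz.
  exists (sc z); first exact: ltW.
  suff E2 : tc z = psi (sc z) by rewrite /gam -E2.
  apply/eqP; rewrite eq_le; apply/andP; split.
    by rewrite leNgt; apply/negP => /HS.
  rewrite leNgt; apply/negP => lt.
  have oV' : open (V `&` [set z | tc z < psi (sc z)]).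
    apply: openI => //; apply: open_ltf => //.
    by move=> y; apply: continuous_comp; [exact: csc|exact: cpsi].
  have [|y [Sy [Vy /= lty]]] := cz (V `&` [set z | tc z < psi (sc z)]).
    by apply: open_nbhs_nbhs.
  have fy : frontier Om y by move: Sy; rewrite SE => -[].
  have [_ _ _ [HSy _]] := onV y Vy fy.
  by have := lt_trans (HSy Sy) lty; rewrite ltxx.
Qed.

End transversal.

(** * Weak derivatives of the difference across the slit *)

Section crossing.
Context (R : realType).
Variables (Omega S Gamma Om : set (pt3 R)).
Hypotheses (oO : open Omega) (Ofin : (@leb3 R Omega < +oo)%E).
Hypothesis hS : dislocation_surface Omega S Gamma Om.
Local Notation mu := (@leb3 R).
Let D := slit_domain Omega S.
Let Dp := outer_part Omega Om.

Let oOm : open Om. Proof. by have [[_ oOm _] _ _] := ds_inner hS. Qed.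
Let cGam : closed Gamma. Proof. by rewrite (ds_closed_surface hS); exact: closed_frontier. Qed.
Let clS : closure S `<=` Gamma.
Proof. by have [U oU SE] := ds_open hS; exact: closure_in_frontier cGam SE. Qed.
Let oD : open D. Proof. by apply: openI => //; apply: closed_openC; exact: closed_closure. Qed.
Let oDp : open Dp. Proof. by apply: openI => //; apply: closed_openC; exact: closed_closure. Qed.
Let OmD : Om `<=` D.
Proof.
move=> x Omx; split; first exact: (ds_inner_sub hS).
move=> /clS; rewrite (ds_closed_surface hS) => /(frontierP _ oOm)[_]; exact.
Qed.
Let DpD : Dp `<=` D.
Proof.
move=> x [Ox nx]; split => // /clS; rewrite (ds_closed_surface hS) => -[cx _].
exact: nx.
Qed.
Let Om_Dp x : Om x -> Dp x -> False.
Proof. by move=> Omx [_]; apply; exact: subset_closure. Qed.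
Let DO : D `<=` Omega. Proof. by move=> x []. Qed.

Let gam_null : {ae mu, forall x, ~ Gamma x}.
Proof.
rewrite (ds_closed_surface hS); apply: frontier_null => //.
by have [_ _ H] := ds_inner hS.
Qed.

Lemma slit_ae : {ae mu, forall x, Omega x -> D x}.
Proof. by apply: ae3S gam_null => x nG Ox; split => // /clS. Qed.

Let ae_sides : {ae mu, forall x, Omega x -> Om x \/ Dp x}.
Proof.
apply: ae3S gam_null => x nG Ox; have [Omx|nOm] := pselect (Om x); first by left.
right; split => // cx; apply: nG; rewrite (ds_closed_surface hS).
by apply/(frontierP _ oOm).
Qed.

Let SOm : S `<=` frontier Om.
Proof. by have [U _ SE] := ds_open hS; rewrite SE (ds_closed_surface hS) => x []. Qed.

Let SDp : S `<=` frontier Dp.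
Proof.
move=> x Sx; have [_ _ H] := ds_inner hS; have fx := SOm Sx; have [c bc] := H x fx.
apply/(frontierP _ oDp); split.
  apply: (closure_outer oO bc); apply: (ds_closed_surface_sub hS).
  by rewrite (ds_closed_surface hS).
by move=> [_]; apply; case: fx.
Qed.

Let mS c : lipschitz_chart c -> measurable (chart_part c S).
Proof.
move=> lc; have [U oU ->] := ds_open hS; exact: (measurable_chart_part lc cGam oU).
Qed.

Variables (f1 f2 gi : pt3 R -> R).
Hypotheses (Hf1 : H1 D f1) (Hf2 : H1 D f2).
Hypothesis jump1 : exists taup taum, [/\ is_trace Dp S f1 taup, is_trace Om S f1 taum &
  surface_ae Om S (fun x => taup x - taum x = gi x)].
Hypothesis jump2 : exists taup taum, [/\ is_trace Dp S f2 taup, is_trace Om S f2 taum &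
  surface_ae Om S (fun x => taup x - taum x = gi x)].

(** Patched by zero off [D], so that one and the same function can be considered on [Omega], on the
    slit domain and on each side. *)
Definition slit_diff : pt3 R -> R := (f1 \- f2) \_ D.
Definition slit_diff_partial (i : 'I_3) : pt3 R -> R := (weak_partial D i f1 \- weak_partial D i f2) \_ D.
Let f := slit_diff.
Let W := slit_diff_partial.

Let L2_patch A h : D `<=` A -> L2 mu D h -> L2 mu A (h \_ D).
Proof.
move=> DA; rewrite /L2; suff -> : (h \_ D) \_ A = h \_ D by [].
apply/funext => x; rewrite /patch; case: ifPn => // nA; case: ifPn => // Dx.
by move: nA; rewrite notin_setE => /(_ (DA _ (set_mem Dx))).
Qed.

Lemma L2_slit_diff : L2 mu Omega f.
Proof.
apply: (L2_patch DO); exact: (@L2B _ _ _ mu D f1 f2 (open_measurable3 oD) Hf1.1 Hf2.1).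
Qed.

Lemma L2_slit_diff_partial i : L2 mu Omega (W i).
Proof.
apply: (L2_patch DO).
exact: (@L2B _ _ _ mu D _ _ (open_measurable3 oD) (weak_partial_spec i Hf1).1 (weak_partial_spec i Hf2).1).
Qed.

Let fE x : D x -> f x = f1 x - f2 x.
Proof. by move=> Dx; rewrite /f /slit_diff /patch mem_set. Qed.
Let WE i x : D x -> W i x = weak_partial D i f1 x - weak_partial D i f2 x.
Proof. by move=> Dx; rewrite /W /slit_diff_partial /patch mem_set. Qed.

Let slit_weak i : is_weak_partial D i f (W i).
Proof.
have [L1 w1] := weak_partial_spec i Hf1; have [L2' w2] := weak_partial_spec i Hf2.
have := is_weak_partialB oD Hf1.1 L1 Hf2.1 L2' w1 w2.
by apply: eq_is_weak_partial => x Dx; rewrite ?fE ?WE.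
Qed.

Let fin_sub A : open A -> A `<=` Omega -> (mu A < +oo)%E.
Proof. by move=> oA AO; apply: le_lt_trans Ofin; apply: leb3_le => //; exact: open_measurable3. Qed.

Let L2O A h : open A -> A `<=` Omega -> L2 mu Omega h -> L2 mu A h.
Proof. by move=> oA AO; apply: (@L2S _ _ _ mu) => //; exact: open_measurable3. Qed.

(** A trace taken from the side [A] involves weak derivatives chosen for [A], whereas [W] is built
    from those chosen for [D]. Restricted to [A] both are weak derivatives of the same function,
    hence equal almost everywhere. *)
Let side_approximable A c E tau1 tau2 B : open A -> A `<=` D -> open B ->
  lipschitz_chart c -> measurable E ->
  approximable (A `&` B) c E f1 (fun i => weak_partial A i f1) tau1 ->
  approximable (A `&` B) c E f2 (fun i => weak_partial A i f2) tau2 ->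
  measurable_fun E (tau1 \o chart_graph c) -> measurable_fun E (tau2 \o chart_graph c) ->
  approximable (A `&` B) c E f W (tau1 \- tau2).
Proof.
move=> oA AD oB lc mE a1 a2 m1 m2.
have oAB := openI oA oB; have mAB := open_measurable3 oAB; have mA := open_measurable3 oA.
have ABA : A `&` B `<=` A by move=> x [].
have ABO : A `&` B `<=` Omega by move=> x [/AD/DO].
have H1A := H1_sub oD oA AD Hf1; have H2A := H1_sub oD oA AD Hf2.
have LS h : L2 mu A h -> L2 mu (A `&` B) h by exact: (@L2S _ _ _ mu).
have Lf1 := LS _ H1A.1; have Lf2 := LS _ H2A.1.
have LW1 i := LS _ (weak_partial_spec i H1A).1; have LW2 i := LS _ (weak_partial_spec i H2A).1.
have := approximableB mAB mE lc Lf1 Lf2 LW1 LW2 m1 m2 a1 a2.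
apply: (eq_ae_approximable mAB (@L2B _ _ _ mu _ _ _ mAB Lf1 Lf2) (L2O oAB ABO L2_slit_diff)
  (fun i => @L2B _ _ _ mu _ _ _ mAB (LW1 i) (LW2 i)) (fun i => L2O oAB ABO (L2_slit_diff_partial i))).
  by apply: aeW => x [/AD Dx _]; rewrite fE.
move=> i; have Afin := fin_sub oA (subset_trans AD DO).
have e1 := weak_partial_unique oA Afin (weak_partial_spec i H1A).1
  (@L2S _ _ _ mu _ _ _ (open_measurable3 oD) mA AD (weak_partial_spec i Hf1).1)
  (weak_partial_spec i H1A).2 (is_weak_partialS AD (weak_partial_spec i Hf1).2).
have e2 := weak_partial_unique oA Afin (weak_partial_spec i H2A).1
  (@L2S _ _ _ mu _ _ _ (open_measurable3 oD) mA AD (weak_partial_spec i Hf2).1)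
  (weak_partial_spec i H2A).2 (is_weak_partialS AD (weak_partial_spec i Hf2).2).
apply: ae3S (ae3I e1 e2) => x [h1 h2] [Ax _].
by rewrite (WE _ (AD _ Ax)) /= (h1 Ax) (h2 Ax).
Qed.

(** Both solutions have the same jump [gi], so the traces of their difference from the two sides
    agree, and [glue_two_sides] applies on a small ball. *)
Lemma crossing_gap x i : S x -> exists2 r, 0 < r &
  forall phi, test_function (Omega `&` ball x r) phi -> wgap Omega i f (W i) phi = 0.
Proof.
move=> Sx.
have [tp1 [tm1 [trp1 trm1 g1]]] := jump1; have [tp2 [tm2 [trp2 trm2 g2]]] := jump2.
have [U oU SE] := ds_open hS.
have [cp1 bp1 ap1] := approximable_trace oDp SDp mS (H1_sub oD oDp DpD Hf1) trp1 Sx.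
have [cp2 bp2 ap2] := approximable_trace oDp SDp mS (H1_sub oD oDp DpD Hf2) trp2 Sx.
have [cm1 bm1 am1] := approximable_trace oOm SOm mS (H1_sub oD oOm OmD Hf1) trm1 Sx.
have [cm2 bm2 am2] := approximable_trace oOm SOm mS (H1_sub oD oOm OmD Hf2) trm2 Sx.
have [c1 b1 G1] := g1 x Sx; have [c2 b2 G2] := g2 x Sx.
(* Four traces and two jump relations come with six unrelated charts. Everything is transferred to
   [cm1], a chart of the inner side. *)
have lc := boundary_lipschitz_chart bm1.
have bx (A : set (pt3 R)) (c : chart R) : boundary_chart A x c -> nbhs x (chart_box c).
  move=> bc; apply: open_nbhs_nbhs; split; first exact: (open_chart_box (boundary_lipschitz_chart bc)).
  exact: chart_box_center bc.
have Ox : Omega x by apply: (ds_closed_surface_sub hS); rewrite (ds_closed_surface hS); exact: SOm.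
have Ux : U x by move: Sx; rewrite SE => -[].
(* A ball inside all six boxes and [Omega]. It is also taken inside [U], so that the whole graph
   within the ball belongs to [S] and no boundary term escapes. *)
have : nbhs x (((chart_box cp1 `&` chart_box cp2) `&` (chart_box cm1 `&` chart_box cm2)) `&`
   ((chart_box c1 `&` chart_box c2) `&` (Omega `&` U))).
  have nO : nbhs x Omega by apply: open_nbhs_nbhs.
  have nU : nbhs x U by apply: open_nbhs_nbhs.
  have [n1 n2] := (bx _ _ bp1, bx _ _ bp2); have [n3 n4] := (bx _ _ bm1, bx _ _ bm2).
  have [n5 n6] := (bx _ _ b1, bx _ _ b2).
  by apply: filterI; apply: filterI; apply: filterI.
move=> /nbhs_ballP[r /= r0 rB]; exists r => // phi tphi.
pose B := ball x r; pose E := chart_part cm1 (S `&` B).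
have oB : open B by exact: ball_open.
have BO : B `<=` Omega by move=> y /rB[_ [_ []]].
have mE : measurable E.
  rewrite /E SE -setIA; apply: (measurable_chart_part lc cGam); exact: openI.
have Eb : E `<=` chart_base cm1 by move=> s [].
have BE s : chart_base cm1 s -> B (chart_graph cm1 s) -> E s.
  move=> bs Bs; split => //; split => //; rewrite SE (ds_closed_surface hS).
  by split; [exact: (graph_frontier oOm bm1 bs)|have [_ [_ []]] := rB _ Bs].
have ES s : E s -> S (chart_graph cm1 s) /\ B (chart_graph cm1 s) by move=> [_ []].
have [p1 mp1] : approximable (Dp `&` B) cm1 E f1 (fun i => weak_partial Dp i f1) tp1 /\
    measurable_fun E (tp1 \o chart_graph cm1).
  apply: ap1 => //; first exact: open_measurable3 (openI oDp oB).
    by move=> y [Dy /rB[[[]]]].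
  by move=> s /ES[? /rB[[[]]]].
have [p2 mp2] : approximable (Dp `&` B) cm1 E f2 (fun i => weak_partial Dp i f2) tp2 /\
    measurable_fun E (tp2 \o chart_graph cm1).
  apply: ap2 => //; first exact: open_measurable3 (openI oDp oB).
    by move=> y [Dy /rB[[[]]]].
  by move=> s /ES[? /rB[[[]]]].
have [m1 mm1] : approximable (Om `&` B) cm1 E f1 (fun i => weak_partial Om i f1) tm1 /\
    measurable_fun E (tm1 \o chart_graph cm1).
  apply: am1 => //; first exact: open_measurable3 (openI oOm oB).
    by move=> y [Dy /rB[[_ []]]].
  by move=> s /ES[? /rB[[_ []]]].
have [m2 mm2] : approximable (Om `&` B) cm1 E f2 (fun i => weak_partial Om i f2) tm2 /\
    measurable_fun E (tm2 \o chart_graph cm1).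
  apply: am2 => //; first exact: open_measurable3 (openI oOm oB).
    by move=> y [Dy /rB[[_ []]]].
  by move=> s /ES[? /rB[[_ []]]].
have tr (c : chart R) (P : pt3 R -> Prop) : boundary_chart Om x c -> B `<=` chart_box c ->
    {ae (@leb2 R), forall y, chart_part c S y -> P (chart_graph c y)} ->
    {ae (@leb2 R), forall s, E s -> P (chart_graph cm1 s)}.
  move=> bc Bc H; apply: (surface_ae_transfer (F := chart_part c S) lc (boundary_lipschitz_chart bc) mE _ H).
  move=> s /ES[Ss /Bc bs]; have [cl nD] := (frontierP _ oOm).1 (SOm Ss).
  have [t bt E'] := frontier_graph oOm bc bs cl nD.
  by exists t; split => //; split => //; rewrite /preimage/= E'.
have Bc1 : B `<=` chart_box c1 by move=> y /rB[_ [[]]].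
have Bc2 : B `<=` chart_box c2 by move=> y /rB[_ [[]]].
have G1' := tr c1 (fun z => tp1 z - tm1 z = gi z) b1 Bc1 G1.
have G2' := tr c2 (fun z => tp2 z - tm2 z = gi z) b2 Bc2 G2.
have t12 : {ae (@leb2 R), forall s, E s ->
    (tm1 \- tm2) (chart_graph cm1 s) = (tp1 \- tp2) (chart_graph cm1 s)}.
  apply: ae2S (ae2I G1' G2') => s [h1 h2] Es; have := h1 Es; have := h2 Es => /= <-.
  by move: (tp1 _) (tp2 _) (tm1 _) (tm2 _) => *; lra.
have aM := side_approximable oOm OmD oB lc mE m1 m2 mm1 mm2.
have aP := side_approximable oDp DpD oB lc mE p1 p2 mp1 mp2.
have LB A h : open A -> L2 mu Omega h -> L2 mu (A `&` B) h.
  by move=> oA; apply: L2O; [exact: openI|move=> y [_ /BO]].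
have tB : test_function B phi by apply: test_subset tphi => y [].
rewrite (wgap_supp i f (W i) BO tB) /wgap.
rewrite (@Rintegral_ae_split R Om Dp B _ oOm oDp oB Om_Dp).
- apply: (glue_two_sides (x0 := x) (c := cm1) (E := E) (tau1 := tm1 \- tm2) (tau2 := tp1 \- tp2) (W := W) oOm oDp bm1 oB _ (fin_sub oB BO) Om_Dp _ _ _ _ _ mE Eb BE _ _ t12 aM aP tB).
  + by move=> y /rB[[_ []]].
  + by apply: ae3S ae_sides => y h /BO.
  + exact: LB L2_slit_diff.
  + exact: LB (L2_slit_diff_partial i).
  + exact: LB L2_slit_diff.
  + exact: LB (L2_slit_diff_partial i).
  + exact: measurable_funB mm1 mm2.
  + exact: measurable_funB mp1 mp2.
- by apply: ae3S ae_sides => y h /BO.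
- exact: (wgap_integrable i (open_measurable3 oB) (L2O oB BO L2_slit_diff) (L2O oB BO (L2_slit_diff_partial i)) tB).
Qed.

(** Localisation is used twice: removal of the edge presupposes weak derivatives in [Omega] minus
    the edge, so these are established before any point of the edge is considered. *)
Lemma slit_diff_weak i : is_weak_partial Omega i f (W i).
Proof.
have [U oU SE] := ds_open hS; have SE' := SE; rewrite (ds_closed_surface hS) in SE'.
pose K := surface_boundary S.
(* The edge is closed because [S] is relatively open in [Gamma], which contains the closure of [S];
   so its complement is an admissible open set. *)
have KE : K = closure S `&` ~` U.
  apply/seteqP; split=> z [cz nz]; split => //.
    by move=> Uz; apply: nz; rewrite SE; split => //; exact: clS.
  by rewrite SE => -[].
have oOK : open (Omega `\` K).
  rewrite setDE; apply: openI => //; rewrite KE setCI setCK; apply: openU => //.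
  by apply: closed_openC; exact: closed_closure.
have OKO : Omega `\` K `<=` Omega by move=> z [].
have LfK := L2O oOK OKO L2_slit_diff; have LWK := L2O oOK OKO (L2_slit_diff_partial i).
have weakK phi : test_function (Omega `\` K) phi -> wgap (Omega `\` K) i f (W i) phi = 0.
  move: phi; apply/(weak_partialP i oOK LfK LWK); apply: wgap_local => // x [Ox nK].
  have [Sx|nS] := pselect (S x).
    have [r r0 H] := crossing_gap i Sx; exists r => // phi tphi.
    have t' : test_function (Omega `\` K) phi by apply: test_subset tphi => y [].
    rewrite -(wgap_supp i f (W i) OKO t'); apply: H.
    by apply: test_subset tphi => y [[]].
  have Dx : D x by split => // cx; apply: nK.
  have /nbhs_ballP[r /= r0 rD] := open_nbhs_nbhs (conj oD Dx).
  exists r => // phi tphi.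
  have tD : test_function D phi by apply: test_subset tphi => y [_ /rD].
  have DK : D `<=` Omega `\` K by move=> y [Oy ny]; split => // -[].
  rewrite (wgap_supp i f (W i) DK tD).
  exact: ((weak_partialP i oD (L2O oD DO L2_slit_diff) (L2O oD DO (L2_slit_diff_partial i))).1 (slit_weak i)).
apply: (wgap_local oO L2_slit_diff (L2_slit_diff_partial i)) => x Ox.
have [Kx|nK] := pselect (K x).
  have [gam [L [r0 [V [[oV Vx] L0 r00 gL KV]]]]] := edge_on_curve oOm SE' oU (ds_edge hS Kx).
  have /nbhs_ballP[r /= rp rV] := open_nbhs_nbhs (conj oV Vx).
  exists r => // phi tphi.
  apply: (edge_removal oO L2_slit_diff (L2_slit_diff_partial i) L0 r00 gL KV weakK).
  by apply: test_subset tphi => y [Oy /rV].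
have /nbhs_ballP[r /= rp rO] := open_nbhs_nbhs (conj oOK (conj Ox nK)).
exists r => // phi tphi.
have tK : test_function (Omega `\` K) phi by apply: test_subset tphi => y [_ /rO].
by rewrite (wgap_supp i f (W i) OKO tK); exact: weakK.
Qed.

End crossing.

(** * Zero traces and the energy identity *)

Section shrinking.
Context (R : realType).
Implicit Types (D : set (pt3 R)) (c : chart R).

Lemma shrink_chart D x c (O : set (pt3 R)) : boundary_chart D x c -> open O -> O x ->
  exists2 c', boundary_chart D x c' & chart_box c' `<=` O `&` chart_box c.
Proof.
move=> bc oO Ox; have lc := boundary_lipschitz_chart bc.
have /nbhs_ballP[r /= r0 rO] := open_nbhs_nbhs (conj oO Ox).
have [k k0 kl] := lc.2; have [cr ch] := bc_size bc.
(* The chart map expands distances at most three times, so half-sizes below [r / 4] keep the box in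
   the ball of radius [r]. The bound [h' / (k + 1)] on the base keeps the graph, of slope at most
   [k] and through the origin, below height [h']. *)
pose h' := Num.min (chart_h c) (r / 4).
have h0 : 0 < h' by rewrite lt_min ch divr_gt0.
pose r' := Num.min (chart_r c) (Num.min (r / 4) (h' / (k + 1))).
have k1 : 0 < k + 1 by rewrite ltr_wpDl.
have r'0 : 0 < r' by rewrite !lt_min cr !divr_gt0.
have hch : h' <= chart_h c by rewrite ge_min lexx.
have hr : h' <= r / 4 by rewrite ge_min lexx orbT.
have rcr : r' <= chart_r c by rewrite ge_min lexx.
have rr : r' <= r / 4 by rewrite !ge_min lexx !orbT.
have rk : r' <= h' / (k + 1) by rewrite !ge_min lexx !orbT.
pose c' := Chart (chart_o c) (chart_e c) r' h' (chart_psi c).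
have bb y : chart_base c' y -> chart_base c y.
  by move=> [y1 y2]; split; [exact: (lt_le_trans y1)|exact: (lt_le_trans y2)].
have map0 : chart_map c 0 = x.
  rewrite -(bc_origin bc) /chart_map big1 ?addr0// => i _.
  have -> : coord i 0 = 0 :> R by rewrite -(subrr (0 : pt3 R)) coordD coordN subrr.
  by rewrite scale0r.
exists c'.
  split.
  - exact: bc_origin bc.
  - exact: bc_frame bc.
  - by split.
  - exact: bc_lipschitz bc.
  - exact: bc_center bc.
  - move=> y [y1 y2].
    have := kl y 0; rewrite subr0 (bc_center bc) subr0 => h1; apply: (le_lt_trans h1).
    have yr : `|y| <= r' by rewrite prod_normE ge_max !ltW.
    apply: (@le_lt_trans _ _ (k * r')); first by rewrite ler_wpM2l.
    have : (k + 1) * r' <= h' by rewrite mulrC -ler_pdivlMr.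
    by rewrite /c'/=; lra.
  - move=> y yb yh; apply: (bc_above bc (bb _ yb)); exact: lt_le_trans yh hch.
move=> _ [y [yb yh] <-]; split; last first.
  by exists y => //; split; [exact: bb|exact: lt_le_trans yh hch].
apply: rO; rewrite -ball_normE /ball_/= distrC -map0.
have -> : chart_map c' y = chart_map c y by [].
apply: (le_lt_trans (chart_map_lip lc y 0)); rewrite subr0.
have : `|y| <= r / 4.
  have [y1 y2] := yb.
  rewrite !prod_normE !ge_max (le_trans (ltW y1) rr) (le_trans (ltW y2) rr)/=.
  exact: le_trans (ltW yh) hr.
by lra.
Qed.

Lemma eq_boundary_chart D D' x c : (forall z, chart_box c z -> (D z <-> D' z)) ->
  boundary_chart D x c -> boundary_chart D' x c.
Proof.
move=> DD bc; split.
- exact: bc_origin bc.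
- exact: bc_frame bc.
- exact: bc_size bc.
- exact: bc_lipschitz bc.
- exact: bc_center bc.
- exact: (bc_inside bc).
- move=> y yb yh; rewrite -DD; first exact: (bc_above bc yb yh).
  by exists y.
Qed.

End shrinking.

Section zero_trace.
Context (R : realType).
Variables (Omega S Sigma : set (pt3 R)) (f1 f2 : pt3 R -> R).
Hypotheses (oO : open Omega) (Ofin : (@leb3 R Omega < +oo)%E) (SO : closure S `<=` Omega).
Local Notation mu := (@leb3 R).
Let D := slit_domain Omega S.
Let f := slit_diff Omega S f1 f2.
Let W := slit_diff_partial Omega S f1 f2.
Hypotheses (Hf1 : H1 D f1) (Hf2 : H1 D f2).
Hypotheses (Lf : L2 mu Omega f) (LW : forall i, L2 mu Omega (W i)).
Hypothesis wW : forall i, is_weak_partial Omega i f (W i).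
Hypotheses (cSig : closed Sigma) (SigO : Sigma `<=` frontier Omega).
Hypotheses (t1 : is_trace D Sigma f1 (fun=> 0)) (t2 : is_trace D Sigma f2 (fun=> 0)).

(** The closure of [S] stays away from the boundary of [Omega], so in a small chart around a point
    of [Sigma] the slit domain and [Omega] coincide. The approximants of both solutions then
    converge on one common box and are subtracted. *)
Lemma slit_diff_zero_trace : is_trace Omega Sigma f (fun=> 0).
Proof.
have oD : open D by apply: openI => //; apply: closed_openC; exact: closed_closure.
have DO : D `<=` Omega by move=> x [].
have SigD : Sigma `<=` frontier D.
  move=> x Sx; have [cx nO] := (frontierP _ oO).1 (SigO Sx).
  apply/(frontierP _ oD); split; last by move=> [].
  move=> B nB; have nB' : nbhs x (B `&` ~` closure S).
    apply: filterI => //; apply: open_nbhs_nbhs; split; last by move=> /SO.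
    by apply: closed_openC; exact: closed_closure.
  by have [y [Oy [By nS]]] := cx _ nB'; exists y.
have mSig c : lipschitz_chart c -> measurable (chart_part c Sigma).
  by move=> lc; rewrite -[Sigma]setIT; apply: measurable_chart_part => //; exact: openT.
move=> x Sx.
have [c1 b1 ap1] := approximable_trace oD SigD mSig Hf1 t1 Sx.
have [c2 b2 ap2] := approximable_trace oD SigD mSig Hf2 t2 Sx.
have [_ nOx] := (frontierP _ oO).1 (SigO Sx).
have [||c bc cb] := @shrink_chart R D x c1 (~` closure S `&` chart_box c2) b1.
- apply: openI; last exact: (open_chart_box (boundary_lipschitz_chart b2)).
  by apply: closed_openC; exact: closed_closure.
- by split; [move=> /SO|exact: chart_box_center b2].
have lc := boundary_lipschitz_chart bc.
have bcO : boundary_chart Omega x c.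
  apply: (eq_boundary_chart _ bc) => z /cb[[nS _] _]; split; first exact: DO.
  by move=> Oz.
exists c => //.
pose B := D `&` chart_box c; pose E := chart_part c Sigma.
have mE : measurable E by exact: mSig.
have oB : open B by apply: openI => //; exact: (open_chart_box lc).
have mB := open_measurable3 oB; have mD := open_measurable3 oD.
have BD : B `<=` D by move=> z [].
have BO : B `<=` Omega := subset_trans BD DO.
have BE : Omega `&` chart_box c = B.
  by apply/seteqP; split=> z [zO zb]; split => //; [split => //; have [[]] := cb _ zb|exact: DO].
have bxE s : E s -> chart_box c (chart_graph c s).
  by move=> [bs _]; exact: (chart_graph_box bc bs).
have [a1 m1] : approximable B c E f1 (fun i => weak_partial D i f1) (fun=> 0) /\
    measurable_fun E ((fun _ : pt3 R => 0 : R) \o chart_graph c).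
  apply: ap1 => // [z [Dz /cb[]]//|s Es]; split; first by case: Es.
  by have [] := cb _ (bxE s Es).
have [a2 m2] : approximable B c E f2 (fun i => weak_partial D i f2) (fun=> 0) /\
    measurable_fun E ((fun _ : pt3 R => 0 : R) \o chart_graph c).
  apply: ap2 => // [z [Dz /cb[[]]]//|s Es]; split; first by case: Es.
  by have [[]] := cb _ (bxE s Es).
have LS h : L2 mu D h -> L2 mu B h by exact: (@L2S _ _ _ mu).
have LSO h : L2 mu Omega h -> L2 mu B h.
  by apply: (@L2S _ _ _ mu) => //; exact: open_measurable3.
have L1 := LS _ Hf1.1; have L2' := LS _ Hf2.1.
have LW1 i := LS _ (weak_partial_spec i Hf1).1; have LW2 i := LS _ (weak_partial_spec i Hf2).1.
have HO : H1 Omega f by split => // i; exists (W i).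
have := approximableB mB mE lc L1 L2' LW1 LW2 m1 m2 a1 a2.
move=> /(eq_ae_approximable mB (@L2B _ _ _ mu _ _ _ mB L1 L2') (LSO _ Lf)
  (fun i => @L2B _ _ _ mu _ _ _ mB (LW1 i) (LW2 i))
  (fun i => LSO _ (weak_partial_spec i HO).1)).
case.
- by apply: aeW => z [Dz _]; rewrite /f /slit_diff /patch mem_set.
- move=> i; have e1 := weak_partial_unique oO Ofin (weak_partial_spec i HO).1 (LW i)
    (weak_partial_spec i HO).2 (wW i).
  apply: ae3S e1 => z h Bz; rewrite (h (BO _ Bz)) /W /slit_diff_partial /patch mem_set//.
  exact: BD.
move=> phi [sphi fc wc tc]; split.
  apply/(@L2P _ _ _ (@leb2 R) _ _ mE); split; first exact: measurable_cst.
  rewrite /L2sq (eq_integral (fun=> 0%E)) ?integral0 ?ltry// => s _.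
  by congr EFin; rewrite expr0n.
exists phi; split => //.
- by rewrite /H1_cvg BE; split => [|i]; apply/L2norm_cvg0; [exact: fc|exact: wc].
- apply/L2norm_cvg0; rewrite (_ : (fun n => _) = (fun n => L2sq (@leb2 R) E ((phi n \- ((fun=> 0) \- (fun=> 0))) \o chart_graph c)))//.
  apply/funext => n; apply: eq_integral => s _; congr (EFin (_ ^+ 2)).
  by rewrite /= subrr.
Qed.

End zero_trace.

Section Linfty_products.
Context d (T : measurableType d) (R : realType) (mu : {measure set T -> \bar R}).

Lemma Linfty_bounded (D : set T) (f : T -> R) : measurable D -> Linfty mu D f ->
  measurable_fun D f /\ exists M : R, {ae mu, forall x, D x -> `|f x| <= M}.
Proof.
move=> mD; rewrite /Linfty inE => /andP[]; rewrite !inE/= => mf; rewrite /finite_norm => fin.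
split; first exact: (proj2 (measurable_restrictT f mD) mf).
move: fin; rewrite unlock /Lnorm; case: ifPn => [_ fin|m0 _].
  have [M fM] := @ess_supr_bounded _ _ _ mu (fun x => `|(f \_ D) x|) fin.
  by exists M; apply: filterS fM => x; rewrite /patch => + Dx; rewrite mem_set.
(* The essential norm is zero by convention on a null space; every bound holds almost everywhere
   there. *)
exists 0; exists setT; split => //.
by apply/eqP; rewrite eq_le measure_ge0 andbT leNgt.
Qed.

Lemma L2_Linfty (D : set T) (f g : T -> R) (M : R) : measurable D -> measurable_fun D g ->
  {ae mu, forall x, D x -> `|g x| <= M} -> L2 mu D f -> L2 mu D (fun x => g x * f x).
Proof.
move=> mD mg gM /(L2P _ _ mD)[mf ff]; apply/(L2P _ _ mD).
have mgf : measurable_fun D (fun x => g x * f x) by exact: measurable_funM.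
split => //; apply: (@le_lt_trans _ _ (\int[mu]_(x in D) ((M ^+ 2)%:E * (f x ^+ 2)%:E))%E).
  apply: ae_ge0_le_integral => //.
  - by move=> x _; rewrite lee_fin sqr_ge0.
  - exact: measurable_sqr.
  - by move=> x _; rewrite -EFinM lee_fin mulr_ge0 ?sqr_ge0.
  - by apply: measurable_funeM; exact: measurable_sqr.
  - apply: filterS gM => x h Dx; rewrite -EFinM lee_fin exprMn ler_wpM2r ?sqr_ge0//.
    rewrite -[leLHS]real_normK ?num_real// lerXn2r// ?nnegrE//; last exact: h.
    by rewrite (le_trans _ (h Dx)).
rewrite (@ge0_integralZl _ _ _ mu D mD _ (measurable_sqr mf)).
- by rewrite lte_mul_pinfty// lee_fin sqr_ge0.
- by move=> x _; rewrite lee_fin sqr_ge0.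
- by rewrite lee_fin sqr_ge0.
Qed.

End Linfty_products.

Section matrices.
Context (R : realType).
Implicit Types (A B : 'M[R]_3) (C : tensor4 R).

Lemma tapplyB C A B : tapply C (A - B) = tapply C A - tapply C B.
Proof.
apply/matrixP => i j; rewrite !mxE -sumrB; apply: eq_bigr => k _.
by rewrite -sumrB; apply: eq_bigr => h _; rewrite !mxE mulrBr.
Qed.

Lemma ddotBl A A' B : ddot (A - A') B = ddot A B - ddot A' B.
Proof.
rewrite /ddot -sumrB; apply: eq_bigr => i _; rewrite -sumrB; apply: eq_bigr => j _.
by rewrite !mxE mulrBl.
Qed.

Lemma ddot_ge0 A : 0 <= ddot A A.
Proof. by do 2 (apply: sumr_ge0 => ? _); rewrite -expr2 sqr_ge0. Qed.

Lemma mnorm_le0 A : mnorm A ^+ 2 <= 0 -> forall i j, A i j = 0.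
Proof.
rewrite sqr_sqrtr ?ddot_ge0// => A0 i j.
have A00 : ddot A A = 0 by apply/eqP; rewrite eq_le A0 ddot_ge0.
have p k l : 0 <= A k l * A k l by rewrite -expr2 sqr_ge0.
have H1 := psumr_eq0P (fun k _ => sumr_ge0 _ (fun l _ => p k l)) A00.
have H2 := psumr_eq0P (fun l _ => p i l) (H1 i isT).
by have /eqP := H2 j isT; rewrite mulf_eq0 orbb => /eqP.
Qed.

End matrices.

Section energy.
Context (R : realType).
Local Notation mu := (@leb3 R).
Implicit Types (D : set (pt3 R)).

Lemma integrable_sum3 D (F : 'I_3 -> pt3 R -> R) : measurable D ->
  (forall i, mu.-integrable D (EFin \o F i)) ->
  mu.-integrable D (EFin \o (fun x => \sum_i F i x)).
Proof.
move=> mD iF; rewrite (_ : (fun x => _) = fun x => F ord0 x + (F (lift ord0 ord0) x + F (lift ord0 (lift ord0 ord0)) x)).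
  exact: (@integrableD _ _ _ mu D mD _ _ (iF _) (@integrableD _ _ _ mu D mD _ _ (iF _) (iF _))).
by apply/funext => x; rewrite !big_ord_recl big_ord0 addr0.
Qed.

Lemma L2_sum3 D (F : 'I_3 -> pt3 R -> R) : measurable D ->
  (forall i, L2 mu D (F i)) -> L2 mu D (fun x => \sum_i F i x).
Proof.
move=> mD iF; rewrite (_ : (fun x => _) = F ord0 \+ (F (lift ord0 ord0) \+ F (lift ord0 (lift ord0 ord0)))).
  exact: (@L2D _ _ _ mu D _ _ mD (iF _) (@L2D _ _ _ mu D _ _ mD (iF _) (iF _))).
by apply/funext => x; rewrite !big_ord_recl big_ord0 addr0.
Qed.

Lemma energy_integrable D (C : pt3 R -> tensor4 R) (A B : pt3 R -> 'M[R]_3) : measurable D ->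
  (forall i j k h, measurable_fun D (fun x => C x i j k h) /\
    exists M : R, {ae mu, forall x, D x -> `|C x i j k h| <= M}) ->
  (forall i j, L2 mu D (fun x => A x i j)) -> (forall i j, L2 mu D (fun x => B x i j)) ->
  mu.-integrable D (EFin \o (fun x => ddot (tapply (C x) (A x)) (B x))).
Proof.
move=> mD LC LA LB.
apply: (integrable_sum3 (F := fun i x => \sum_j tapply (C x) (A x) i j * B x i j) mD) => i.
apply: (integrable_sum3 (F := fun j x => tapply (C x) (A x) i j * B x i j) mD) => j.
apply: (@L2M_integrable _ _ _ mu D (fun x => tapply (C x) (A x) i j) _ mD _ (LB i j)).
rewrite (_ : (fun x => _) = fun x => \sum_k \sum_h C x i j k h * A x k h); last first.
  by apply/funext => x; rewrite mxE.
apply: (L2_sum3 (F := fun k x => \sum_h C x i j k h * A x k h) mD) => k.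
apply: (L2_sum3 (F := fun h x => C x i j k h * A x k h) mD) => h.
have [mC [M CM]] := LC i j k h.
exact: (@L2_Linfty _ _ _ mu D (fun x => A x k h) (fun x => C x i j k h) M mD mC CM (LA k h)).
Qed.

Lemma Linfty_sub D D' (f : pt3 R -> R) : measurable D -> measurable D' -> D' `<=` D ->
  Linfty mu D f -> measurable_fun D' f /\ exists M : R, {ae mu, forall x, D' x -> `|f x| <= M}.
Proof.
move=> mD mD' DD Lf; have [mf [M fM]] := @Linfty_bounded _ _ _ mu D f mD Lf.
split; first exact: (measurable_funS mD DD mf).
by exists M; apply: ae3S fM => x h /DD.
Qed.

Lemma Rintegral_ge0_eq0 D (f : pt3 R -> R) : measurable D -> mu.-integrable D (EFin \o f) ->
  {ae mu, forall x, D x -> 0 <= f x} -> \int[mu]_(x in D) f x = 0 ->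
  {ae mu, forall x, D x -> f x = 0}.
Proof.
move=> mD iF f0 If; have mf := @measurable_int _ _ _ mu _ _ iF.
have I0 : (\int[mu]_(x in D) `|(EFin \o f) x| = 0)%E.
  rewrite (@ae_eq_integral _ _ _ mu D (EFin \o f))//.
  - by rewrite /comp/= (integral_Rintegral3 mD iF) If.
  - by apply: measurableT_comp.
  - by apply: ae3S f0 => x h Dx; rewrite /= ger0_norm// h.
have := (ae_eq_integral_abs mu mD mf).1 I0.
by apply: ae3S => x h Dx; have [] := h Dx.
Qed.

Lemma strainE D (u : pt3 R -> pt3 R) x i j : strain D u x i j =
  2^-1 * (weak_partial D j (Defs.comp i u) x + weak_partial D i (Defs.comp j u) x).
Proof. by rewrite !mxE. Qed.

End energy.

Lemma ord3_ind (P : 'I_3 -> Prop) : P ord0 -> P (@Ordinal 3 1 isT) -> P (@Ordinal 3 2 isT) ->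
  forall i, P i.
Proof.
move=> P0 P1 P2 [[|[|[|//]]] p].
- by rewrite (_ : Ordinal p = ord0)//; exact: val_inj.
- by rewrite (_ : Ordinal p = @Ordinal 3 1 isT)//; exact: val_inj.
- by rewrite (_ : Ordinal p = @Ordinal 3 2 isT)//; exact: val_inj.
Qed.

Section zero_extension.
Context (R : realType).
Variables (Omega Sigma U : set (pt3 R)) (v : pt3 R -> pt3 R).
Hypotheses (dO : domain Omega) (Ofin : (@leb3 R Omega < +oo)%E).
Hypotheses (oU : open U) (SE : Sigma = closure (frontier Omega `&` U)).
Hypothesis neU : (frontier Omega `&` U) !=set0.
Hypothesis Hv : H1_zero_on Sigma Omega v.
Hypothesis strain0 : forall i j, {ae (@leb3 R), forall x, Omega x -> strain Omega v x i j = 0}.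
Local Notation mu := (@leb3 R).

(* The extension of [v] by zero across the clamped part of the boundary has zero strain
   near a boundary point and vanishes outside of [Omega], hence it vanishes on a
   neighbourhood by rigidity. *)
Lemma korn_uniqueness i : {ae mu, forall x, Omega x -> Defs.comp i v x = 0}.
Proof.
have [_ oO cO] := dO.
have mO := open_measurable3 oO.
have [x [fx Ux]] := neU.
have SigO : Sigma `<=` frontier Omega.
  by rewrite SE => y cy; apply: closed_frontier => B /cy[z [[fz _] Bz]]; exists z.
have USig y : frontier Omega y -> U y -> Sigma y.
  by move=> fy Uy; rewrite SE; apply: subset_closure.
have mSig c : lipschitz_chart c -> measurable (chart_part c Sigma).
  move=> lc; rewrite -[Sigma]setIT; apply: measurable_chart_part => //; last exact: openT.
  by rewrite SE; exact: closed_closure.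
have [cx nOx] := (frontierP _ oO).1 fx.
pose f a := Defs.comp a v; pose w a j := weak_partial Omega j (f a).
have Lf a : L2 mu Omega (f a) by have [] := Hv.1 a.
have Lw a j : L2 mu Omega (w a j) by have [] := weak_partial_spec j (Hv.1 a).
have ww a j : is_weak_partial Omega j (f a) (w a j) by have [] := weak_partial_spec j (Hv.1 a).
have w0 a j : {ae mu, forall y, Omega y -> w a j y + w j a y = 0}.
  apply: ae3S (strain0 a j) => y h Oy; have := h Oy; rewrite strainE => /eqP.
  by rewrite mulf_eq0 invr_eq0 pnatr_eq0/= => /eqP.
have /choice[c cP] : forall a, exists c, boundary_chart Omega x c /\
    forall B c' E, measurable B -> B `<=` Omega `&` chart_box c -> lipschitz_chart c' ->
    measurable E -> (forall s, E s -> Sigma (chart_graph c' s) /\ chart_box c (chart_graph c' s)) ->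
    approximable B c' E (f a) (w a) (fun=> 0) /\
    measurable_fun E ((fun _ : pt3 R => 0 : R) \o chart_graph c').
  move=> a; have [c bc H] := approximable_trace oO SigO mSig (Hv.1 a) (Hv.2 a) (USig x fx Ux).
  by exists c.
(* The zero trace of each component has its own chart. One ball inside all three boxes allows each
   component to be treated in its own chart. *)
have : nbhs x (U `&` [set y | forall a, chart_box (c a) y]).
  apply: filterI; first exact: open_nbhs_nbhs.
  have nb a : nbhs x (chart_box (c a)).
    have [bc _] := cP a; apply: open_nbhs_nbhs; split; last exact: chart_box_center bc.
    exact: (open_chart_box (boundary_lipschitz_chart bc)).
  apply: filterS (filterI (nb ord0) (filterI (nb (@Ordinal 3 1 isT)) (nb (@Ordinal 3 2 isT)))).
  by move=> y [y0 [y1 y2]]; apply: ord3_ind.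
move=> /nbhs_ballP[r /= r0 rU].
pose B := cube_box x r.
have BU : B `<=` U `&` [set y | forall a, chart_box (c a) y].
  by move=> y /cube_boxP yx; apply: rU; rewrite -ball_normE /ball_/= distrC.
have oB : open B by exact: open_open_box.
have Bx : B x by apply/cube_boxP; rewrite subrr normr0.
have mB := open_measurable3 oB.
have Bfin : (mu B < +oo)%E by exact: leb3_open_box_fin.
have oOB : open (Omega `&` B) by exact: openI.
have mOB := open_measurable3 oOB.
pose f' a := f a \_ Omega; pose w' a j := w a j \_ Omega.
have Lpatch h : L2 mu Omega h -> L2 mu B (h \_ Omega).
  move=> Lh; have : L2 mu setT (h \_ Omega).
    rewrite /L2; suff -> : (h \_ Omega) \_ setT = h \_ Omega by [].
    by apply/funext => y; rewrite /patch in_setT.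
  by apply: (@L2S _ _ _ mu).
have LOB h : L2 mu Omega h -> L2 mu (Omega `&` B) h by apply: (@L2S _ _ _ mu) => // y [].
have weak' a j : is_weak_partial B j (f' a) (w' a j).
  apply/(weak_partialP j oB (Lpatch _ (Lf a)) (Lpatch _ (Lw a j))) => phi tphi.
  have -> : wgap B j (f' a) (w' a j) phi = wgap (Omega `&` B) j (f a) (w a j) phi.
    rewrite /wgap (@Rintegral_supp _ B (Omega `&` B))//; last first.
      move=> y By nOB; have nO : ~ Omega y by move=> Oy; apply: nOB.
      by rewrite /f' /w' /patch memNset// !mul0r addr0.
    by apply: eq_Rintegral => y; rewrite inE => -[Oy _]; rewrite /f' /w' /patch mem_set.
  have [bc ap] := cP a; have lc := boundary_lipschitz_chart bc.
  pose E := chart_part (c a) (Sigma `&` B).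
  have mE : measurable E.
    by apply: measurable_chart_part => //; rewrite SE; exact: closed_closure.
  have [app _] : approximable (Omega `&` B) (c a) E (f a) (w a) (fun=> 0) /\
      measurable_fun E ((fun _ : pt3 R => 0 : R) \o chart_graph (c a)).
    apply: ap => //; first by move=> y [Oy /BU[_ /(_ a)]].
    by move=> s [bs [Ss Bs]]; split => //; exact: chart_graph_box bc bs.
  apply: (glue_zero_trace (x0 := x) (c := c a) (E := E) (W := w a) oO bc oB _ Bfin (LOB _ (Lf a)) (LOB _ (Lw a j)) mE _ _ app tphi).
  - by move=> y /BU[_ /(_ a)].
  - by move=> s [].
  - move=> s bs Bs; split => //; split => //; apply: USig; last by have [] := BU _ Bs.
    exact: (graph_frontier oO bc bs).
have strain' a j : {ae mu, forall y, B y -> w' a j y + w' j a y = 0}.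
  apply: ae3S (w0 a j) => y h By.
  change ((w a j \_ Omega) y + (w j a \_ Omega) y = 0); rewrite /patch.
  have [Oy|nO] := pselect (Omega y); first by rewrite (mem_set Oy); exact: h.
  by rewrite (memNset nO) addr0.
have [V [oV [y Vy] VB V0]] : exists V : set (pt3 R), [/\ open V, V !=set0, V `<=` B &
    forall a, {ae mu, forall y, V y -> f' a y = 0}].
  exists (B `&` ~` closure Omega); split.
  - by apply: openI => //; apply: closed_openC; exact: closed_closure.
  (* With the whole space as ambient set, [closure_outer] says that [x] is a limit of points outside
     the closure of [Omega], so the extended field vanishes on a nonempty open part of the cube. *)
  - have [bc _] := cP ord0; have := closure_outer openT bc I.
    by move=> /(_ B (open_nbhs_nbhs (conj oB Bx)))[y [[_ nc] By]]; exists y.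
  - by move=> y [].
  - move=> a; apply: aeW => y [_ nc]; rewrite /f' /patch memNset//.
    by move=> Oy; apply: nc; exact: subset_closure.
have ab j : coord j x - r < coord j x + r by lra.
have f'0 := rigid_unique_box ab (fun a => Lpatch _ (Lf a)) (fun a j => Lpatch _ (Lw a j)) weak' strain' oV Vy VB V0.
(* Since [x] is also in the closure of [Omega], the cube contains points of [Omega], from which the
   vanishing spreads by connectedness. *)
have [y' [Oy' By']] := cx B (open_nbhs_nbhs (conj oB Bx)).
have OBO : Omega `&` B `<=` Omega by move=> z [].
have f0 a : {ae mu, forall z, (Omega `&` B) z -> f a z = 0}.
  apply: ae3S (f'0 a) => z h [Oz Bz]; have := h Bz.
  by rewrite /f' /patch mem_set.
exact: (@strain0_unique R Omega (Omega `&` B) y' f w oO cO Lf Lw ww w0 oOB (conj Oy' By') OBO f0 i).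
Qed.

End zero_extension.

Section energy_identity.
Context (R : realType).
Local Notation mu := (@leb3 R).

Lemma ae3_all (P : 'I_3 -> pt3 R -> Prop) : (forall i, {ae mu, forall x, P i x}) ->
  {ae mu, forall x, forall i, P i x}.
Proof.
move=> H; apply: ae3S (ae3I (H ord0) (ae3I (H (@Ordinal 3 1 isT)) (H (@Ordinal 3 2 isT)))).
by move=> x [h0 [h1 h2]]; apply: ord3_ind.
Qed.

Lemma L2_strain (D D' : set (pt3 R)) (u : pt3 R -> pt3 R) i j : open D -> open D' -> D' `<=` D ->
  H1_vec D u -> L2 mu D' (fun x => strain D u x i j).
Proof.
move=> oD oD' DD Hu; have mD := open_measurable3 oD; have mD' := open_measurable3 oD'.
have LS h : L2 mu D h -> L2 mu D' h by exact: (@L2S _ _ _ mu).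
rewrite (_ : (fun x => _) = fun x => 2^-1 * (weak_partial D j (Defs.comp i u) \+ weak_partial D i (Defs.comp j u)) x); last first.
  by apply/funext => x; rewrite strainE.
apply: (@L2Z _ _ _ mu D') => //; apply: (@L2D _ _ _ mu D') => //; apply: LS.
  exact: (weak_partial_spec j (Hu i)).1.
exact: (weak_partial_spec i (Hu j)).1.
Qed.

Lemma Rintegral_ae_sub0 (D : set (pt3 R)) (E f g : pt3 R -> R) : measurable D ->
  mu.-integrable D (EFin \o E) -> mu.-integrable D (EFin \o f) ->
  mu.-integrable D (EFin \o g) -> {ae mu, forall x, D x -> E x = f x - g x} ->
  \int[mu]_(x in D) f x = 0 -> \int[mu]_(x in D) g x = 0 -> \int[mu]_(x in D) E x = 0.
Proof.
move=> mD iE i1 i2 aeE f0 g0.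
have mI h : mu.-integrable D (EFin \o h) -> measurable_fun D h.
  by move=> ih; exact: (proj1 (measurable_EFinP _ _) (@measurable_int _ _ _ mu _ _ ih)).
rewrite (@ae_eq_Rintegral _ _ _ mu D E (fun x => f x - g x) mD (mI _ iE)
    (measurable_funB (mI _ i1) (mI _ i2)) aeE).
by rewrite RintegralB// f0 g0 subrr.
Qed.

End energy_identity.

Theorem theorem3p5 (R : realType) (Omega Sigma S Gamma Om : set (pt3 R))
    (C : pt3 R -> tensor4 R) (g : pt3 R -> pt3 R)
    (hOmega : lipschitz_domain Omega)
    (hSigma : boundary_portion Omega Sigma)
    (hC : elasticity_tensor Omega C)
    (hS : dislocation_surface Omega S Gamma Om)
    (hg : H12_00_vec Om S g)
    (u1 u2 : pt3 R -> pt3 R)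
    (hu1 : weak_solution Omega Sigma S Om C g u1)
    (hu2 : weak_solution Omega Sigma S Om C g u2) :
  {ae (@leb3 R), forall x, slit_domain Omega S x -> u1 x = u2 x}.
Proof.
have [dO bO _] := hOmega; have [_ oO _] := dO.
have mO := open_measurable3 oO; have Ofin := leb3_bounded mO bO.
pose D := slit_domain Omega S.
have oD : open D by apply: openI => //; apply: closed_openC; exact: closed_closure.
have mD := open_measurable3 oD.
have DO : D `<=` Omega by move=> x [].
have aeD : {ae (@leb3 R), forall x, Omega x -> D x} by exact: slit_ae hS.
have [U [oU neU SE]] := hSigma.
have cSig : closed Sigma by rewrite SE; exact: closed_closure.
have SigO : Sigma `<=` frontier Omega.
  by rewrite SE => y cy; apply: closed_frontier => B /cy[z [[fz _] Bz]]; exists z.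
have [[Hu1 tr1] ju1 var1] := hu1; have [[Hu2 tr2] ju2 var2] := hu2.
pose f a := slit_diff Omega S (Defs.comp a u1) (Defs.comp a u2).
pose W a := slit_diff_partial Omega S (Defs.comp a u1) (Defs.comp a u2).
have Lf a : L2 (@leb3 R) Omega (f a) by exact: L2_slit_diff.
have LW a i : L2 (@leb3 R) Omega (W a i) by exact: L2_slit_diff_partial.
have weakW a i : is_weak_partial Omega i (f a) (W a i).
  exact: (slit_diff_weak oO Ofin hS (Hu1 a) (Hu2 a) (ju1 a) (ju2 a)).
pose v x := mk3 (fun a => f a x).
have vE a : Defs.comp a v = f a by apply/funext => x; rewrite /Defs.comp coord_mk3.
have Hv : H1_zero_on Sigma Omega v.
  split=> a; rewrite vE; first by split => // i; exists (W a i).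
  exact: (slit_diff_zero_trace oO Ofin (ds_compactly_inside hS) (Hu1 a) (Hu2 a) (Lf a) (LW a) (weakW a) cSig SigO (tr1 a) (tr2 a)).
(* The weak derivatives of [v] chosen on [Omega] and those of the solutions chosen on [D] are
   unrelated representatives; uniqueness relates them almost everywhere. *)
have grad_v : {ae (@leb3 R), forall x, forall a i, D x ->
    weak_partial Omega i (Defs.comp a v) x =
    weak_partial D i (Defs.comp a u1) x - weak_partial D i (Defs.comp a u2) x}.
  apply: ae3_all => a; apply: ae3_all => i.
  have [L1 w1] := weak_partial_spec i (Hv.1 a).
  have wW := weakW a i; rewrite -vE in wW.
  apply: ae3S (weak_partial_unique oO Ofin L1 (LW a i) w1 wW) => x h Dx.
  by rewrite (h (DO _ Dx)) /W /slit_diff_partial /patch mem_set.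
have strain_v : {ae (@leb3 R), forall x, D x ->
    strain Omega v x = strain D u1 x - strain D u2 x}.
  apply: ae3S grad_v => x h Dx; apply/matrixP => i j.
  rewrite [RHS]mxE [X in _ = _ + X]mxE !strainE (h i j Dx) (h j i Dx).
  by rewrite -mulrN -mulrDr opprD addrACA.
have LC i j k l : measurable_fun D (fun x => C x i j k l) /\
    exists M : R, {ae (@leb3 R), forall x, D x -> `|C x i j k l| <= M}.
  exact: (Linfty_sub mO mD DO (et_bounded hC i j k l)).
have Ls1 i j := L2_strain i j oD oD (@subset_refl _ D) Hu1.
have Ls2 i j := L2_strain i j oD oD (@subset_refl _ D) Hu2.
have Lsv i j := L2_strain i j oO oD DO Hv.1.
pose E x := ddot (tapply (C x) (strain Omega v x)) (strain Omega v x).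
have iE : (@leb3 R).-integrable D (EFin \o E).
  exact: (@energy_integrable R D C (strain Omega v) (strain Omega v) mD LC Lsv Lsv).
have i1 : (@leb3 R).-integrable D (EFin \o (fun x => ddot (tapply (C x) (strain D u1 x)) (strain Omega v x))).
  exact: (@energy_integrable R D C (strain D u1) (strain Omega v) mD LC Ls1 Lsv).
have i2 : (@leb3 R).-integrable D (EFin \o (fun x => ddot (tapply (C x) (strain D u2 x)) (strain Omega v x))).
  exact: (@energy_integrable R D C (strain D u2) (strain Omega v) mD LC Ls2 Lsv).
have E0 : \int[@leb3 R]_(x in D) E x = 0.
  pose e1 x := ddot (tapply (C x) (strain D u1 x)) (strain Omega v x).
  pose e2 x := ddot (tapply (C x) (strain D u2 x)) (strain Omega v x).
  (* The energy of [v] is the difference of the two variational forms, both tested with [v], and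
     each of them is zero. *)
  have aeE : {ae (@leb3 R), forall x, D x -> E x = e1 x - e2 x}.
    by apply: ae3S strain_v => x h Dx; rewrite /E /e1 /e2 -ddotBl -tapplyB -(h Dx).
  exact: (@Rintegral_ae_sub0 R D E e1 e2 mD iE i1 i2 aeE (var1 v Hv) (var2 v Hv)).
have [c c0 conv] := et_convex hC.
(* [strain] is by definition the symmetric part of a gradient, so convexity is used with that
   gradient as [A]. *)
have E_ge x : Omega x -> (forall A : 'M[R]_3, c * mnorm (sym_part A) ^+ 2 <=
    ddot (tapply (C x) (sym_part A)) (sym_part A)) -> c * mnorm (strain Omega v x) ^+ 2 <= E x.
  by move=> _; exact.
have Epos : {ae (@leb3 R), forall x, D x -> 0 <= E x}.
  apply: ae3S conv => x h Dx; apply: le_trans (E_ge x (DO _ Dx) (h (DO _ Dx))).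
  by rewrite mulr_ge0 ?sqr_ge0// ltW.
have Ez := Rintegral_ge0_eq0 mD iE Epos E0.
(* The slit is a null set, so a statement almost everywhere on [D] holds almost everywhere on
   [Omega]. *)
have strain0 i j : {ae (@leb3 R), forall x, Omega x -> strain Omega v x i j = 0}.
  apply: ae3S (ae3I aeD (ae3I conv Ez)) => x [hD [h hE]] Ox; apply: mnorm_le0.
  have := E_ge x Ox (h Ox); rewrite (hE (hD Ox)) => H.
  by rewrite -(pmulr_rle0 _ c0).
have v0 : {ae (@leb3 R), forall x, forall i, Omega x -> Defs.comp i v x = 0}.
  by apply: ae3_all => i; exact: (korn_uniqueness dO oU SE neU Hv strain0).
apply: ae3S v0 => x h Dx; apply: coord_inj => i; apply/eqP; rewrite -subr_eq0.
by have := h i (DO _ Dx); rewrite vE /f /slit_diff /patch mem_set// => /eqP.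
Qed.
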